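(* Let $N\in\mathbb{N}$, $0<\alpha<1$, $h>0$, $1\le p\le\infty$, let $f\in L^1(\mathbb{R}^N)$ and $M:=\int_{\mathbb{R}^N}f(x)\,dx$. Let $u$ be the solution of $${_C}\delta^{\alpha}u(nh,x)=\Delta u(nh,x),\ n\in\mathbb{N},\ x\in\mathbb{R}^N,\qquad u(0,x)=f(x),$$ given by $u(nh,\cdot)=\mathcal{G}^{\alpha}_{n,h}*f$ for $n\in\mathbb{N}$. (i) Then $$(nh)^{\frac{\alpha N}{2}\left(1-\frac1p\right)}\,\|u(nh)-M\mathcal{G}^{\alpha}_{n,h}\|_p\to0\quad\text{as } n\to\infty,$$ for $p\in[1,\infty)$ if $N=1$, and for $p\in[1,\frac{N}{N-1})$ if $N>1$. (ii) Suppose in addition that $|x|f\in L^1(\mathbb{R}^N)$. Then there is a constant $C$, independent of $n$ and $h$, such that for all $n\in\mathbb{N}$ $$(nh)^{\frac{\alpha N}{2}\left(1-\frac1p\right)}\,\|u(nh)-M\mathcal{G}^{\alpha}_{n,h}\|_p\le C\,(nh)^{-\alpha/2},$$ for $p\in[1,\infty)$ if $N=1$, and for $p\in[1,\frac{N}{N-1})$ if $N>1$.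
   Context: Here $\mathbb{N}=\{1,2,\dots\}$, $\mathbb{N}_0=\{0,1,2,\dots\}$, $*$ is convolution on $\mathbb{R}^N$, $\|\cdot\|_p$ is the norm of $L^p(\mathbb{R}^N)$, and $u(nh)$ denotes $u(nh,\cdot)$. Cesàro numbers: for $\beta\in\mathbb{C}$, $k^\beta(0)=1$ and $k^\beta(n)=\frac{\beta(\beta+1)\cdots(\beta+n-1)}{n!}$ for $n\in\mathbb{N}$. For a sequence $g$ on $\{0,h,2h,\dots\}$ put $\delta_{\rm left}g(nh)=\frac{g(nh)-g((n-1)h)}{h}$ ($n\in\mathbb{N}$). The Caputo fractional $h$-difference is ${_C}\delta^{\alpha}g(nh)=h^{1-\alpha}\sum_{j=1}^n k^{1-\alpha}(n-j)\,\delta_{\rm left}g(jh)$, $n\in\mathbb{N}$, acting on $u$ in the variable $nh$; $\Delta$ is the Laplacian in $x$. Discrete scaled Wright function: for $0<\alpha<1$, $\beta\ge0$, $h>0$, $n,j\in\mathbb{N}_0$, $$\varphi^h_{\alpha,\beta}(n,j)=\frac{1}{2\pi i}\int_{\Upsilon}\frac{1}{z^{n+1}}\frac{\left(1-h(\frac{1-z}{h})^{\alpha}\right)^{j}}{(\frac{1-z}{h})^{\beta}}\,dz,$$ where $\Upsilon$ is the positively oriented circle centred at $0$ of radius $r\in(0,1)$ (principal powers). Gaussian kernel: $G_t(x)=(4\pi t)^{-N/2}e^{-|x|^2/(4t)}$, $t>0$, $x\in\mathbb{R}^N$. Discrete Gaussian kernel: $\mathcal{G}_{n,h}(x)=\frac{1}{h^n\Gamma(n)}\int_0^\infty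 e^{-t/h}t^{n-1}G_t(x)\,dt$, $n\in\mathbb{N}$. Fundamental solution: $$\mathcal{G}^{\alpha}_{n,h}(x)=\sum_{j=1}^{\infty}\varphi^h_{\alpha,1-\alpha}(n-1,j-1)\,\mathcal{G}_{j,h}(x),\quad n\in\mathbb{N}.$$
   Formalization: The series defining the fundamental solution diverges when h^{1-α}>2 (and for large n when h^{1-α}=2), so the solution is undefined there; the formal theorem assumes that the series converges for all n and all x≠0, which holds whenever h^{1-α}<2. *)

(* Defs.v *)
From HB Require Import structures.
From mathcomp Require Import all_boot all_order all_algebra.
From mathcomp Require Import complex.
From mathcomp Require Import all_classical all_reals all_analysis.
Set Implicit Arguments.
Unset Strict Implicit.
Unset Printing Implicit Defensive.
Import Order.TTheory GRing.Theory Num.Theory.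
Import numFieldNormedType.Exports.

Local Open Scope classical_set_scope.
Local Open Scope ring_scope.

(** * Lebesgue measure on R^N *)

(* R^N is [N.-tuple R], with the product (= Borel) sigma-algebra that the
   library puts on tuples; its Lebesgue measure is the iterated product of the
   one-dimensional one, transported along (x, v) |-> x :: v. *)

Section tuple_measure.
Context {R : realType}.

Definition cons_pair (N : nat) (xv : measurableTypeR R * N.-tuple R) : N.+1.-tuple R :=
  [tuple of xv.1 :: xv.2].

Lemma measurable_cons_pair (N : nat) :
  measurable_fun [set: measurableTypeR R * N.-tuple R] (@cons_pair N).
Proof. by apply: measurable_cons => //; exact: measurable_fst. Qed.

Section cons_measure.
Variables (N : nat) (mu : {sigma_finite_measure set (N.-tuple R) -> \bar R}).

Definition cons_measure : set (N.+1.-tuple R) -> \bar R :=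
  pushforward (@lebesgue_measure R \x mu)%E (@cons_pair N).

Let mcons := @measurable_cons_pair N.

Let cons_measure0 : cons_measure set0 = 0%E.
Proof. by rewrite /cons_measure /pushforward preimage_set0 measure0. Qed.

Let cons_measure_ge0 A : (0 <= cons_measure A)%E.
Proof. by rewrite /cons_measure /pushforward; exact: measure_ge0. Qed.

Let cons_measure_sigma_additive : semi_sigma_additive cons_measure.
Proof.
have mf := mcons.
exact: measure_semi_sigma_additive.
Qed.

HB.instance Definition _ := isMeasure.Build _ _ _ cons_measure
  cons_measure0 cons_measure_ge0 cons_measure_sigma_additive.

Lemma cons_measure_sigma_finite : sigma_finite setT cons_measure.
Proof.
pose nu := @lebesgue_measure R.
have /sigma_finiteP[F [TF ndF Foo]] := sigma_finiteT nu.
have /sigma_finiteP[G [TG ndG Goo]] := sigma_finiteT mu.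
pose split (x : N.+1.-tuple R) : measurableTypeR R * N.-tuple R :=
  (thead x, [tuple of behead x]).
have msplit : measurable_fun setT split.
  apply: measurable_fun_pair; first exact: measurable_tnth.
  exact: measurable_behead.
exists (fun n => split @^-1` (F n `*` G n)).
  apply/seteqP; split => // x _.
  have [j _ Fj] : (\bigcup_i F i) (thead x) by rewrite -TF.
  have [k _ Gk] : (\bigcup_i G i) [tuple of behead x] by rewrite -TG.
  exists (maxn j k) => //; split => /=.
  - by move: Fj; exact/subsetPset/ndF/leq_maxl.
  - by move: Gk; exact/subsetPset/ndG/leq_maxr.
move=> n; have [mF Fn] := Foo n; have [mG Gn] := Goo n; split.
  by rewrite -[X in measurable X]setTI; apply: msplit => //; exact: measurableX.
rewrite /cons_measure /pushforward -comp_preimage.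
rewrite (_ : split \o _ = id).
  rewrite preimage_id product_measure1E//; apply: lte_mul_pinfty => //.
  by rewrite ge0_fin_numE.
by apply/funext => -[a v]; congr pair; apply: val_inj.
Qed.

HB.instance Definition _ := Measure_isSigmaFinite.Build _ _ _ cons_measure
  cons_measure_sigma_finite.

End cons_measure.

Fixpoint lebesgueN (N : nat) : {sigma_finite_measure set (N.-tuple R) -> \bar R} :=
  if N is N'.+1 then cons_measure (lebesgueN N') else dirac [tuple].

Lemma lebesgueN_box (N : nat) (A : 'I_N -> set R) :
  (forall i, measurable (A i)) ->
  lebesgueN N [set x | forall i, A i (tnth x i)] =
  (\prod_(i < N) lebesgue_measure (A i))%E.
Proof.
elim: N A => [|N IH] A mA.
  rewrite big_ord0 /= diracE mem_set//.
  by case.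
pose B := [set v : N.-tuple R | forall i, A (lift ord0 i) (tnth v i)].
have mB : measurable B.
  rewrite (_ : B = \bigcap_(i in [set: 'I_N])
      ((@tnth _ R)^~ i @^-1` A (lift ord0 i))).
    apply: fin_bigcap_measurable => // i _.
    rewrite -[X in measurable X]setTI; exact: measurable_tnth.
  by apply/seteqP; split => v H i; [move=> _; exact: H|exact: (H i I)].
rewrite big_ord_recl /= /cons_measure /pushforward.
rewrite (_ : _ @^-1` _ = A ord0 `*` B); last first.
  apply/seteqP; split => -[a v] /=.
  - move=> H; split; first exact: (H ord0).
    by move=> i; have := H (lift ord0 i); rewrite tnthS.
  - move=> [Aa Av] i; case: (unliftP ord0 i) => [j|] ->; last exact: Aa.
    by rewrite tnthS; exact: Av.
rewrite product_measure1E; [|exact: mA|exact: mB]; congr (_ * _)%E.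
by apply: (IH (fun i => A (lift ord0 i))) => i; exact: mA.
Qed.

End tuple_measure.
Arguments lebesgueN {R} N.


Section geometry.
Context {R : realType} {N : nat}.
Implicit Types x y : N.-tuple R.

Definition enorm x : R := Num.sqrt (\sum_(i < N) tnth x i ^+ 2).

Definition tuple_sub x y : N.-tuple R := [tuple tnth x i - tnth y i | i < N].

Definition row_of_tuple x : 'rV[R]_N := \row_i tnth x i.

Definition convol (g f : N.-tuple R -> R) x : R :=
  \int[lebesgueN N]_y (g (tuple_sub x y) * f y).

End geometry.

(** * The Laplacian on L^1(R^N) *)

Section laplacian.
Context {R : realType} {N : nat}.

(* Derivatives are taken on row vectors, the normed space structure of R^N in
   the library. *)
Definition iter_partial (s : seq 'I_N) (psi : 'rV[R]_N -> R) : 'rV[R]_N -> R :=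
  foldr (fun i g => 'D_('e_i) g) psi s.

Definition smooth (psi : 'rV[R]_N -> R) : Prop :=
  forall s : seq 'I_N, continuous (iter_partial s psi) /\
    forall (i : 'I_N) (v : 'rV[R]_N), derivable (iter_partial s psi) v 'e_i.

Definition test_function (psi : 'rV[R]_N -> R) : Prop :=
  smooth psi /\ exists K : R, forall v, K < `|v| -> psi v = 0.

Definition laplacian (psi : 'rV[R]_N -> R) (v : 'rV[R]_N) : R :=
  \sum_(i < N) iter_partial [:: i; i] psi v.

(* [v] belongs to the domain of the Laplacian in L^1 and [g] is its Laplacian,
   in the sense of distributions. *)
Definition has_laplacian (v g : N.-tuple R -> R) : Prop :=
  [/\ (lebesgueN N).-integrable setT (EFin \o v),
      (lebesgueN N).-integrable setT (EFin \o g) &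
      forall psi, test_function psi ->
        \int[lebesgueN N]_x (g x * psi (row_of_tuple x)) =
        \int[lebesgueN N]_x (v x * laplacian psi (row_of_tuple x))].

End laplacian.

(** * The Caputo fractional difference *)

Definition cesaro (F : fieldType) (beta : F) (n : nat) : F :=
  (\prod_(i < n) (beta + i%:R)) / n`!%:R.

(* A sequence on the mesh {0, h, 2h, ...} is represented by [g : nat -> R],
   with [g n] standing for its value at n h. *)

Definition delta_left {R : realType} (h : R) (g : nat -> R) (n : nat) : R :=
  (g n - g n.-1) / h.

Definition caputo {R : realType} (alpha h : R) (g : nat -> R) (n : nat) : R :=
  h `^ (1 - alpha) *
  \sum_(1 <= j < n.+1) cesaro (1 - alpha) (n - j) * delta_left h g j.

Definition caputo_heat_solution {R : realType} {N : nat} (alpha h : R)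
    (f : N.-tuple R -> R) (u : nat -> N.-tuple R -> R) : Prop :=
  (forall x, u 0%N x = f x) /\
  forall n, (0 < n)%N ->
    has_laplacian (u n) (fun x => caputo alpha h (fun m => u m x) n).

(** * The discrete scaled Wright function *)

Section wright.
Context {R : realType}.
Local Open Scope complex_scope.

Definition cmod (z : R[i]) : R :=
  Num.sqrt (complex.Re z ^+ 2 + complex.Im z ^+ 2).

(* Principal argument, in ]- pi, pi] for z != 0. *)
Definition carg (z : R[i]) : R :=
  let t := acos (complex.Re z / cmod z) in
  if 0 <= complex.Im z then t else - t.

Definition cis (t : R) : R[i] := cos t +i* sin t.

(* Principal power z^a with real exponent; used only for z != 0. *)
Definition cpow (z : R[i]) (a : R) : R[i] :=
  (cmod z `^ a)%:C * cis (a * carg z).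

Definition Cintegral (a b : R) (g : R -> R[i]) : R[i] :=
  (\int[lebesgue_measure]_(t in `[a, b]) complex.Re (g t)) +i*
  (\int[lebesgue_measure]_(t in `[a, b]) complex.Im (g t)).

(* Integral over the positively oriented circle t |-> r e^(i t). *)
Definition circle_integral (r : R) (F : R[i] -> R[i]) : R[i] :=
  Cintegral 0 (2 * pi) (fun t => F (r%:C * cis t) * ('i%C * r%:C * cis t)).

(* The contour integral is real, its integrand commuting with complex
   conjugation; hence the real part. *)
Definition wright (r alpha beta h : R) (n j : nat) : R :=
  complex.Re ((2 * pi%:C * 'i%C)^-1 * circle_integral r (fun z =>
    (z ^+ n.+1)^-1 *
    ((1 - h%:C * cpow ((1 - z) / h%:C) alpha) ^+ j /
     cpow ((1 - z) / h%:C) beta))).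

End wright.

(** * Gaussian kernels and the fundamental solution *)

Section kernels.
Context {R : realType} {N : nat}.
Implicit Types (x : N.-tuple R) (h : R).

Definition gauss_kernel (t : R) x : R :=
  (4 * pi * t) `^ (- (N%:R / 2)) * expR (- (enorm x ^+ 2 / (4 * t))).

(* For n >= 1; Gamma(n) = (n - 1)! *)
Definition discrete_gauss h (n : nat) x : R :=
  (h ^+ n * n.-1`!%:R)^-1 *
  \int[lebesgue_measure]_(t in `]0, +oo[)
    (expR (- (t / h)) * t ^+ n.-1 * gauss_kernel t x).

(* [G n] is the sum of the series over j >= 1 (shifted here to j >= 0). The
   origin is left out: there the integral defining [discrete_gauss h j] is
   infinite when j <= N / 2. *)
Definition is_fundamental_solution (r alpha h : R)
    (G : nat -> N.-tuple R -> R) : Prop :=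
  forall n x, (0 < n)%N -> 0 < enorm x ->
    series (fun j => wright r alpha (1 - alpha) h n.-1 j *
                     discrete_gauss h j.+1 x) @ \oo --> G n x.

End kernels.

(* Main.v *)
From HB Require Import structures.
Require Import Defs.
From mathcomp Require Import all_boot all_order all_algebra.
From mathcomp Require Import complex.
From mathcomp Require Import all_classical all_reals all_analysis.
From mathcomp Require Import measurable_realfun ring lra.
Set Implicit Arguments.
Unset Strict Implicit.
Unset Printing Implicit Defensive.
Import Order.TTheory GRing.Theory Num.Theory.
Import numFieldNormedType.Exports.
Local Open Scope classical_set_scope.
Local Open Scope ring_scope.
Local Notation cesaro := Defs.cesaro.

(** The theorem is a statement about subordination. Put H = h^alpha. The n-th
    fundamental solution is an average of heat kernels

      G_n(x) = int_0^oo psi_n(t) G_t(x) dt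

    against a probability density psi_n ([time_density]), a finite mixture of
    Gamma densities of scale H, and psi_n lives on the time scale (n h)^alpha in
    the sense that int psi_n(t) t^(-a) dt <= C_a (n h)^(-alpha a) for 0 <= a < 1.
    Granted this, heat kernel estimates are averaged over t.

    The mixture. On the circle |z| = r the Wright integrand is a combination of
    powers of 1 - z, whose Taylor coefficients are Cesaro numbers ([circ_coef]);
    so with c = h^(1 - alpha) a Wright value is a binomial sum of Cesaro numbers
    ([wrightE]). Writing 1 - c (1 - X)^alpha = (1 - c) + c (1 - (1 - X)^alpha)
    and expanding in the last bracket ([wright_sib]) brings in the numbers
    [sib alpha n i], the coefficients of X^n in
    (1 - X)^(alpha - 1) (1 - (1 - X)^alpha)^i, which are the weights of the
    mixture for G_(n+1). These are nonnegative, as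
    1 - (1 - X)^alpha has nonnegative coefficients (it generates the Sibuya
    distribution), and vanish for i > n. Summing over j first then replaces the
    Gamma averages of scale h by those of scale h / c = H
    ([series_wright_gamma_avg]). That exchange needs c < 2; for c >= 2 the
    defining series diverges at some x <> 0, so that no fundamental solution
    exists ([fundamental_solution_powR_lt2]).

    The moments. The moment of order -a of the Gamma density of shape i + 1 is
    at most a constant times H^(-a) times the Cesaro number of order 1 - a at i
    ([gamma_int_le]). The weights [sib alpha n i] sum Cesaro numbers exactly
    ([sum_sib_cesaro]), leaving the Cesaro number of order 1 - alpha a at n,
    which is at most (n + 1)^(- alpha a) ([cesaro_le_powR]).

    The conclusion. Let g = N/2 (1 - 1/p). For every t > 0,

      |G_t(x - y) - G_t(x)| <= min(1, |y| / sqrt t) (W_t(x - y) + W_t(x)),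

    where W_t is a wider Gaussian and the L^p norm of t^g W_t does not depend
    on t ([gauss_kernel_diff], [integral_shift_weight_powR_le]). Since
    u - M G_n is the integral of (G_t(x - y) - G_t(x)) f(y) against psi_n(t) dt dy,
    Minkowski's integral inequality ([integral_poweR_le]) bounds its L^p norm by
    a constant times

      int int psi_n(t) t^(-g) min(1, |y| / sqrt t) |f(y)| dt dy
        <= C (n h)^(-alpha g) int |f(y)| min(1, |y| (n h)^(-alpha/2)) dy;

    the moments used have orders -g and -(g + 1/2), and the condition on p says
    exactly that g + 1/2 < 1. The last integral tends to 0 by dominated
    convergence, and it is at most (n h)^(-alpha/2) int |y| |f(y)| dy. *)

(** * Real derivatives and polar coordinates *)

Section real_derivatives.
Context {R : realType}.
Implicit Types (f g : R -> R) (x a b c : R).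

(** The value of the derivative is a plain argument, to be computed last by
    [has_deriv_eq] and [ring] or [field]. *)
Definition has_deriv f x a : Prop := is_derive x 1 f a.

Lemma has_deriv_eq f x a b : has_deriv f x a -> a = b -> has_deriv f x b.
Proof. by move=> + <-. Qed.

Lemma has_deriv_id x : has_deriv (fun s : R => s) x 1.
Proof. exact: is_derive_id. Qed.

Lemma has_deriv_cst c x : has_deriv (fun _ : R => c) x 0.
Proof. exact: is_derive_cst. Qed.

Lemma has_derivD f g x a b : has_deriv f x a -> has_deriv g x b ->
  has_deriv (fun s => f s + g s) x (a + b).
Proof. by move=> hf hg; exact: (is_deriveD hf hg). Qed.

Lemma has_derivN f x a : has_deriv f x a ->
  has_deriv (fun s => - f s) x (- a).
Proof. by move=> hf; exact: (is_deriveN hf). Qed.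

Lemma has_derivM f g x a b : has_deriv f x a -> has_deriv g x b ->
  has_deriv (fun s => f s * g s) x (f x * b + g x * a).
Proof. by move=> hf hg; exact: (is_deriveM hf hg). Qed.

Lemma has_deriv_sqr f x a : has_deriv f x a ->
  has_deriv (fun s => f s ^+ 2) x (2 * f x * a).
Proof. by move=> hf; apply: has_deriv_eq (has_derivM hf hf) _; ring. Qed.

Lemma has_derivV f x a : f x != 0 -> has_deriv f x a ->
  has_deriv (fun s => (f s)^-1) x (- (f x) ^- 2 * a).
Proof. by move=> f0 hf; exact: (is_deriveV f0 hf). Qed.

Lemma has_deriv_comp f g x a b : has_deriv f (g x) a -> has_deriv g x b ->
  has_deriv (fun s => f (g s)) x (a * b).
Proof. by move=> hf hg; exact: (is_derive1_comp hf hg). Qed.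

Lemma has_deriv_continuous f x a : has_deriv f x a -> {for x, continuous f}.
Proof. by move=> [df _]; exact/differentiable_continuous/derivable1_diffP. Qed.

End real_derivatives.

Section polar_derivatives.
Context {R : realType}.
Implicit Types (u v g : R -> R) (x a : R).

(** The real and imaginary parts of the logarithm of u + i v, for u > 0. *)
Definition lmod u v s : R := ln (u s ^+ 2 + v s ^+ 2) / 2.
Definition larg u v s : R := atan (v s / u s).

Lemma sqrD_gt0 (p q : R) : 0 < p -> 0 < p ^+ 2 + q ^+ 2.
Proof. by move=> p0; rewrite ltr_wpDr ?sqr_ge0 // exprn_gt0. Qed.

Lemma has_deriv_lmod u v x du dv : has_deriv u x du -> has_deriv v x dv ->
  0 < u x ->
  has_deriv (lmod u v) x ((u x * du + v x * dv) / (u x ^+ 2 + v x ^+ 2)).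
Proof.
move=> hu hv ux; have D0 := sqrD_gt0 (v x) ux.
apply: has_deriv_eq.
  apply: has_derivM; last exact: has_deriv_cst.
  apply: (@has_deriv_comp _ (@ln R)); first exact: is_derive1_ln D0.
  by apply: has_derivD; apply: has_deriv_sqr; eassumption.
by rewrite /=; field; rewrite gt_eqF.
Qed.

Lemma has_deriv_larg u v x du dv : has_deriv u x du -> has_deriv v x dv ->
  0 < u x ->
  has_deriv (larg u v) x ((u x * dv - v x * du) / (u x ^+ 2 + v x ^+ 2)).
Proof.
move=> hu hv ux; have D0 := sqrD_gt0 (v x) ux.
have u0 : u x != 0 by rewrite gt_eqF.
apply: has_deriv_eq.
  apply: (@has_deriv_comp _ (@atan R)); first exact: is_derive1_atan.
  apply: has_derivM; first eassumption.
  by apply: has_derivV; eassumption.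
by rewrite /=; field; rewrite u0 gt_eqF.
Qed.

(** The real and imaginary parts of (u + i v)^a e^(- i g). *)
Definition pcos u v a g s := expR (a * lmod u v s) * cos (a * larg u v s - g s).
Definition psin u v a g s := expR (a * lmod u v s) * sin (a * larg u v s - g s).

Lemma has_deriv_pcos u v a g x du dv dg :
  has_deriv u x du -> has_deriv v x dv -> has_deriv g x dg -> 0 < u x ->
  has_deriv (pcos u v a g) x
   (a * ((u x * du + v x * dv) / (u x ^+ 2 + v x ^+ 2)) * pcos u v a g x -
   (a * ((u x * dv - v x * du) / (u x ^+ 2 + v x ^+ 2)) - dg) * psin u v a g x).
Proof.
move=> hu hv hg ux.
have hl := has_deriv_lmod hu hv ux; have ha := has_deriv_larg hu hv ux.
apply: has_deriv_eq.
  apply: has_derivM.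
    apply: (@has_deriv_comp _ expR); first exact: is_derive_expR.
    apply: has_derivM; [exact: has_deriv_cst | exact: hl].
  apply: (@has_deriv_comp _ cos); first exact: is_derive_cos.
  apply: has_derivD; last by apply: has_derivN; exact: hg.
  apply: has_derivM; [exact: has_deriv_cst | exact: ha].
by rewrite /pcos /psin /=; ring.
Qed.

Lemma has_deriv_psin u v a g x du dv dg :
  has_deriv u x du -> has_deriv v x dv -> has_deriv g x dg -> 0 < u x ->
  has_deriv (psin u v a g) x
   (a * ((u x * du + v x * dv) / (u x ^+ 2 + v x ^+ 2)) * psin u v a g x +
   (a * ((u x * dv - v x * du) / (u x ^+ 2 + v x ^+ 2)) - dg) * pcos u v a g x).
Proof.
move=> hu hv hg ux.
have hl := has_deriv_lmod hu hv ux; have ha := has_deriv_larg hu hv ux.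
apply: has_deriv_eq.
  apply: has_derivM.
    apply: (@has_deriv_comp _ expR); first exact: is_derive_expR.
    apply: has_derivM; [exact: has_deriv_cst | exact: hl].
  apply: (@has_deriv_comp _ sin); first exact: is_derive_sin.
  apply: has_derivD; last by apply: has_derivN; exact: hg.
  apply: has_derivM; [exact: has_deriv_cst | exact: ha].
by rewrite /pcos /psin /=; ring.
Qed.

End polar_derivatives.

(** * Cesaro numbers and Sibuya weights *)

Section cesaro_numbers.
Context {R : realFieldType}.
Implicit Types a b d : R.

Lemma cesaro0 a : cesaro a 0 = 1.
Proof. by rewrite /cesaro big_ord0 fact0 divr1. Qed.

Lemma cesaroS a n : cesaro a n.+1 * n.+1%:R = (a + n%:R) * cesaro a n.
Proof.
rewrite /cesaro big_ord_recr /= factS natrM.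
have h1 : (n.+1%:R : R) != 0 by rewrite pnatr_eq0.
have h2 : (n`!%:R : R) != 0 by rewrite pnatr_eq0 -lt0n fact_gt0.
by field; rewrite h2 nat1r h1.
Qed.

(** The Cesaro numbers of order a are the coefficients of (1 - X)^(- a), so
    adding orders convolves the numbers. *)
Lemma cesaro_vandermonde a b n :
  cesaro (a + b) n = \sum_(k < n.+1) cesaro a k * cesaro b (n - k).
Proof.
elim: n => [|n IH]; first by rewrite big_ord1 !cesaro0 mulr1.
have h1 : (n.+1%:R : R) != 0 by rewrite pnatr_eq0.
apply: (mulIf h1); rewrite cesaroS IH mulr_suml.
transitivity (\sum_(k < n.+2) cesaro a k * k%:R * cesaro b (n.+1 - k) +
  \sum_(k < n.+2) cesaro a k * (cesaro b (n.+1 - k) * (n.+1 - k)%:R)); last first.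
  rewrite -big_split /=; apply: eq_bigr => k _.
  rewrite [X in _ = _ * X](_ : _ = k%:R + (n.+1 - k)%:R); first by ring.
  by rewrite -natrD subnKC // -ltnS.
rewrite [X in _ = X + _]big_ord_recl /= mulr0 mul0r add0r [X in _ = _ + X]big_ord_recr /=.
rewrite subnn mulr0 mulr0 addr0 -big_split /= mulr_sumr; apply: eq_bigr => k _.
rewrite /bump /= add1n subSS cesaroS subSn -1?ltnS // cesaroS.
have -> : (n%:R : R) = k%:R + (n - k)%:R by rewrite -natrD subnKC // -ltnS.
by ring.
Qed.

Lemma cesaro_ge0 a n : 0 <= a -> 0 <= cesaro a n.
Proof.
by move=> a0; rewrite divr_ge0 // prodr_ge0 // => i _; rewrite addr_ge0.
Qed.

Lemma cesaro_Nnat k n : cesaro (- k%:R : R) n = (-1) ^+ n * 'C(k, n)%:R.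
Proof.
elim: n => [|n IH]; first by rewrite cesaro0 bin0 expr0 mulr1.
have h1 : (n.+1%:R : R) != 0 by rewrite pnatr_eq0.
have E : 'C(k, n.+1)%:R * n.+1%:R = (k%:R - n%:R) * 'C(k, n)%:R :> R.
  rewrite -natrM mulnC mul_bin_left natrM.
  case: (leqP n k) => nk; first by rewrite natrB.
  by rewrite (bin_small nk) !mulr0.
by apply: (mulIf h1); rewrite cesaroS IH -[RHS]mulrA E exprS; ring.
Qed.

Definition cesaro_poly n : {poly R} :=
  n`!%:R^-1 *: \prod_(i < n) ('X + i%:R%:P).

Lemma horner_cesaro_poly n d : (cesaro_poly n).[d] = cesaro d n.
Proof.
rewrite hornerZ horner_prod mulrC; congr (_ / _).
by apply: eq_bigr => i _; rewrite hornerD hornerX hornerC.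
Qed.

(** Identities between polynomials in the order of Cesaro numbers need only
    be checked at the nonpositive integers, where [cesaro_Nnat] makes them finite
    binomial sums. *)
Lemma poly_eq_nat (p q : {poly R}) :
  (forall k : nat, p.[- k%:R] = q.[- k%:R]) -> p = q.
Proof.
move=> H; apply/eqP; rewrite -subr_eq0; apply/negPn/negP => nz.
pose s := [seq - (k%:R : R) | k <- iota 0 (size (p - q))].
have := @max_poly_roots _ _ s nz.
rewrite size_map size_iota ltnn => F; suff: false by [].
apply: F; last first.
  by rewrite map_inj_uniq ?iota_uniq // => i j /oppr_inj /eqP; rewrite eqr_nat => /eqP.
by apply/allP => x /mapP[k _ ->]; rewrite rootE hornerD hornerN H subrr.
Qed.

(** Both bounds can replace each other when the terms beyond either vanish;
    used to pass between sums up to j and up to n. *)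
Lemma sum_ord_trunc (F : nat -> R) m n :
  (forall i, (m < i)%N -> F i = 0) -> (forall i, (n < i)%N -> F i = 0) ->
  \sum_(i < m.+1) F i = \sum_(i < n.+1) F i.
Proof.
move=> Fm Fn.
have W p q : (forall i, (p < i)%N -> F i = 0) -> (p <= q)%N ->
    \sum_(i < p.+1) F i = \sum_(i < q.+1) F i.
  move=> Fp pq; rewrite (big_ord_widen q.+1 F) //.
  rewrite big_mkcond /=; apply: eq_bigr => i _; case: ifP => // /negbT.
  by rewrite -leqNgt => /Fp ->.
by rewrite (W m (maxn m n)) ?leq_maxl // (W n (maxn m n)) ?leq_maxr.
Qed.

Section sibuya.
Variable alpha : R.
Hypothesis alpha01 : 0 < alpha < 1.

(** The truncation of (1 - X)^(- a) at degree n; coefficients up to n of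
    products are those of the power series. *)
Definition binomial_poly n a : {poly R} := \poly_(k < n.+1) cesaro a k.
Definition sibuya_poly n : {poly R} := 1 - binomial_poly n (- alpha).
Definition sib n i : R := (binomial_poly n (1 - alpha) * sibuya_poly n ^+ i)`_n.

Lemma coef_binomial_poly n a k : (k <= n)%N -> (binomial_poly n a)`_k = cesaro a k.
Proof. by move=> kn; rewrite coef_poly ltnS kn. Qed.

Lemma coef_binomial_polyM n a l k : (k <= n)%N ->
  (binomial_poly n a * binomial_poly n (- alpha) ^+ l)`_k =
  cesaro (a - alpha * l%:R) k.
Proof.
elim: l k => [|l IH] k kn.
  by rewrite expr0 mulr1 mulr0 subr0 coef_binomial_poly.
rewrite exprSr mulrA coefM.
rewrite -natr1 mulrDr mulr1 opprD addrA cesaro_vandermonde.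
apply: eq_bigr => i _; have ik := leq_trans (leq_ord i) kn.
by rewrite IH // coef_binomial_poly // (leq_trans (leq_subr _ _)).
Qed.

Lemma coef_sibuya0 n : (sibuya_poly n)`_0 = 0.
Proof. by rewrite coefB coef1 coef_binomial_poly // cesaro0 subrr. Qed.

(** The k-th coefficient is alpha (1 - alpha) ... (k - 1 - alpha) / k!; this
    is where alpha < 1 enters. *)
Lemma coef_sibuya_ge0 n k : 0 <= (sibuya_poly n)`_k.
Proof.
case: k => [|k]; first by rewrite coef_sibuya0.
have [a0 a1] := andP alpha01.
rewrite coefB coef1 /= sub0r coef_poly; case: ifP => _; last by rewrite oppr0.
rewrite /cesaro -mulNr divr_ge0 // big_ord_recl /= addr0 mulNr opprK.
apply: mulr_ge0; first exact: ltW.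
apply: prodr_ge0 => i _.
by rewrite /bump /= natrD; have := ler0n R i; lra.
Qed.

Lemma coefM_ge0 (p q : {poly R}) : (forall k, 0 <= p`_k) -> (forall k, 0 <= q`_k) ->
  forall k, 0 <= (p * q)`_k.
Proof. by move=> hp hq k; rewrite coefM sumr_ge0 // => i _; rewrite mulr_ge0. Qed.

Lemma sib_ge0 n i : 0 <= sib n i.
Proof.
apply: coefM_ge0.
  move=> k; rewrite coef_poly; case: ifP => // _; apply: cesaro_ge0.
  by case/andP: alpha01 => _; lra.
elim: i => [|i IH] k; first by rewrite expr0 coef1; case: (k == 0%N).
by rewrite exprS; apply: coefM_ge0 => // k'; exact: coef_sibuya_ge0.
Qed.

Lemma sibuyaE n : exists q : {poly R}, sibuya_poly n = q * 'X /\
   q`_0 = (sibuya_poly n)`_1.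
Proof.
have : root (sibuya_poly n) 0 by rewrite rootE horner_coef0 coef_sibuya0.
by move=> /factor_theorem[q]; rewrite subr0 => ->; exists q; rewrite coefMX.
Qed.

(** 1 - (1 - X)^alpha has no constant term, so its i-th power starts at X^i. *)
Lemma sib_small n i : (n < i)%N -> sib n i = 0.
Proof.
move=> ni; rewrite /sib; have [q [-> _]] := sibuyaE n.
by rewrite exprMn mulrA coefMXn ni.
Qed.

(** The diagonal weight is alpha^n, the linear coefficient of
    1 - (1 - X)^alpha being alpha. *)
Lemma sib_diag_neq0 n : sib n n != 0.
Proof.
case: n => [|n].
  by rewrite /sib expr0 mulr1 coef_binomial_poly // cesaro0 oner_neq0.
rewrite /sib; have [q [qE q0]] := sibuyaE n.+1.
rewrite qE exprMn mulrA coefMXn ltnn subnn.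
have c0 (p : {poly R}) : p`_0 = p.[0] by rewrite horner_coef0.
have c1 : (sibuya_poly n.+1)`_1 = alpha.
  by rewrite coefB coef1 coef_binomial_poly //= -[cesaro _ 1]mulr1 cesaroS cesaro0; ring.
rewrite c0 hornerM horner_exp -!c0 q0 c1 coef_binomial_poly // cesaro0 mul1r.
by rewrite expf_neq0 //; case/andP: alpha01 => a0 _; rewrite gt_eqF.
Qed.

(** Both sides are the coefficient of X^n in (1 - X)^(alpha - 1)
    (1 - c (1 - X)^alpha)^j, expanded in powers of (1 - X)^alpha on the left and
    of 1 - (1 - X)^alpha on the right. *)
Lemma sum_cesaro_sib (c : R) n j :
  \sum_(l < j.+1) 'C(j, l)%:R * (- c) ^+ l * cesaro (1 - alpha - alpha * l%:R) n =
  \sum_(i < j.+1) 'C(j, i)%:R * (1 - c) ^+ (j - i) * c ^+ i * sib n i.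
Proof.
set T := binomial_poly n (- alpha).
transitivity (binomial_poly n (1 - alpha) * (1 - c%:P * T) ^+ j)`_n.
  rewrite exprDn mulr_sumr coef_sum; apply: eq_bigr => i _.
  rewrite expr1n mul1r -[- (c%:P * T)]mulNr -polyCN exprMn.
  rewrite -polyC_exp [in RHS]mulrnAr coefMn [X in polyseq X]mulrCA coefCM.
  by rewrite coef_binomial_polyM // -[RHS]mulr_natl mulrA.
(* The expansion point moves from 1 to 1 - c. *)
rewrite [1 - c%:P * T](_ : _ = (1 - c)%:P + c%:P * sibuya_poly n); last first.
  by rewrite /sibuya_poly -/T polyCB; ring.
rewrite exprDn mulr_sumr coef_sum; apply: eq_bigr => i _.
rewrite exprMn -!polyC_exp mulrA mulrnAr coefMn -[RHS]mulrA -[LHS]mulr_natl -!mulrA.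
congr (_ * _); rewrite [X in polyseq X]mulrCA coefCM; congr (_ * _).
by rewrite [X in polyseq X]mulrCA coefCM.
Qed.

(** Summing the Cesaro generating series (1 - Y)^(- d) at
    Y = 1 - (1 - X)^alpha gives (1 - X)^(alpha - 1 - alpha d). Both sides are
    polynomial in d, so it is enough to treat d = - k, where the left side is a
    finite binomial expansion. *)
Lemma sum_sib_cesaro d n :
  \sum_(i < n.+1) sib n i * cesaro d i = cesaro (1 - alpha + alpha * d) n.
Proof.
pose p := \sum_(i < n.+1) sib n i *: cesaro_poly i.
pose q := cesaro_poly n \Po ((1 - alpha)%:P + alpha%:P * 'X).
suff pq : p = q.
  transitivity p.[d].
    rewrite horner_sum; apply: eq_bigr => i _.
    by rewrite hornerZ horner_cesaro_poly.
  by rewrite pq horner_comp horner_cesaro_poly !hornerE.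
apply: poly_eq_nat => k.
rewrite horner_comp horner_cesaro_poly !hornerE mulrN.
have S (g : nat -> R) : (\sum_(i < n.+1) sib n i * 'C(k, i)%:R * g i =
   \sum_(i < k.+1) sib n i * 'C(k, i)%:R * g i).
  apply: (@sum_ord_trunc (fun i => sib n i * 'C(k, i)%:R * g i)) => i ni.
    by rewrite sib_small // !mul0r.
  by rewrite bin_small // mulr0 mul0r.
transitivity (\sum_(i < k.+1) sib n i * 'C(k, i)%:R * (-1) ^+ i).
  rewrite -S horner_sum; apply: eq_bigr => i _.
  by rewrite hornerZ horner_cesaro_poly cesaro_Nnat -mulrA [_ * 'C(_,_)%:R]mulrC.
transitivity (cesaro (1 - alpha - alpha * k%:R) n); last first.
  by congr (cesaro _ _); ring.
have <- : (binomial_poly n (1 - alpha) * (1 - sibuya_poly n) ^+ k)`_n =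
    cesaro (1 - alpha - alpha * k%:R) n.
  by rewrite /sibuya_poly subKr coef_binomial_polyM.
rewrite exprDn mulr_sumr coef_sum; apply: eq_bigr => i _.
rewrite expr1n mul1r -[- sibuya_poly n]mulN1r exprMn.
have -> : (-1 : {poly R}) = (-1)%:P by rewrite polyCN.
rewrite -polyC_exp [in RHS]mulrnAr coefMn.
by rewrite [X in polyseq X]mulrCA coefCM -[RHS]mulr_natr /sib; ring.
Qed.

End sibuya.
End cesaro_numbers.

Section cesaro_bound.
Context {R : realType}.

(** Each step multiplies the Cesaro number by 1 - e / (m + 1), which is at
    most ((m + 2) / (m + 1))^(- e) because 1 - s <= e^(- s) and
    ln (1 + s) <= s. *)
Lemma cesaro_le_powR (e : R) m : 0 <= e <= 1 ->
  cesaro (1 - e) m <= m.+1%:R `^ (- e).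
Proof.
move=> /andP[e0 e1]; elim: m => [|m IH]; first by rewrite cesaro0 powR1.
have m1 : (0 : R) < m.+1%:R by rewrite ltr0n.
have m2 : (0 : R) < m.+2%:R by rewrite ltr0n.
rewrite -(ler_pM2r m1) cesaroS.
apply: (@le_trans _ _ ((1 - e + m%:R) * m.+1%:R `^ (- e))).
  by apply: ler_wpM2l IH; rewrite addr_ge0 // subr_ge0.
have -> : (1 - e + m%:R) = m.+1%:R * (1 - e / m.+1%:R) :> R.
  by rewrite mulrBr mulr1 mulrCA divff ?gt_eqF // -natr1; ring.
rewrite -mulrA [leRHS]mulrC; apply: ler_wpM2l; first exact: ltW.
rewrite mulrC.
rewrite /powR !gt_eqF //.
have : 1 - e / m.+1%:R <= expR (- (e / m.+1%:R)) by rewrite expR_ge1Dx.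
move=> h; apply: (le_trans (ler_wpM2l (expR_ge0 _) h)).
rewrite -expRD ler_expR -subr_ge0.
have : ln (m.+2%:R / m.+1%:R) <= (m.+1%:R)^-1 :> R.
  have -> : m.+2%:R / m.+1%:R = 1 + m.+1%:R^-1 :> R.
    by rewrite -[in LHS]natr1 mulrDl divff ?gt_eqF // div1r.
  by apply: le_ln1Dx; rewrite (lt_le_trans (ltrN10 R)) // invr_ge0 ltW.
rewrite ln_div ?posrE // -subr_ge0 => h2.
rewrite [leRHS](_ : _ = e * (m.+1%:R^-1 - (ln m.+2%:R - ln m.+1%:R))) ?mulr_ge0 //.
by ring.
Qed.

End cesaro_bound.

(** * Taylor coefficients of powers of 1 - z on a circle *)

Section polar.
Context {R : realType}.
Implicit Types (u v g : R -> R) (x a : R).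

Lemma expR_lmod u v s : 0 < u s -> expR (lmod u v s) ^+ 2 = u s ^+ 2 + v s ^+ 2.
Proof.
move=> us; rewrite -expRM_natl /lmod.
by rewrite mulrC divfK ?pnatr_eq0 // lnK // posrE sqrD_gt0.
Qed.

Lemma expR_lmod_cos u v s : 0 < u s -> expR (lmod u v s) * cos (larg u v s) = u s.
Proof.
move=> us; have D0 := sqrD_gt0 (v s) us.
have h : 0 < 1 + (v s / u s) ^+ 2 by rewrite ltr_wpDr ?sqr_ge0.
rewrite /larg cos_atan; apply/eqP.
rewrite -(@eqrXn2 _ 2) // ?mulr_ge0 ?expR_ge0 ?invr_ge0 ?sqrtr_ge0 ?ltW //.
rewrite exprMn expR_lmod // exprVn sqr_sqrtr ?ltW //.
have -> : 1 + (v s / u s) ^+ 2 = (u s ^+ 2 + v s ^+ 2) / u s ^+ 2.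
  by field; rewrite gt_eqF.
by apply/eqP; field; rewrite !gt_eqF.
Qed.

Lemma expR_lmod_sin u v s : 0 < u s -> expR (lmod u v s) * sin (larg u v s) = v s.
Proof.
move=> us; have D0 := sqrD_gt0 (v s) us.
have c0 : cos (larg u v s) != 0.
  by apply: contraTneq (us) => E; rewrite -(@expR_lmod_cos u v s us) E mulr0 ltxx.
have : tan (larg u v s) = v s / u s by rewrite /larg atanK.
rewrite /tan => /(congr1 (fun z => z * cos (larg u v s))); rewrite divfK // => ->.
by rewrite mulrCA expR_lmod_cos // divfK ?gt_eqF.
Qed.

End polar.

Section calculus.
Context {R : realType}.
Implicit Types (F f : R -> R).

Lemma Rintegral_has_deriv F f (a b : R) : a < b ->
  {in `[a, b], forall x, has_deriv F x (f x)} ->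
  {in `[a, b], forall x, {for x, continuous f}} ->
  \int[lebesgue_measure]_(x in `[a, b]) f x = F b - F a.
Proof.
move=> ab dF cf.
have cF x : x \in `[a, b] -> {for x, continuous F}.
  by move=> xab; apply: has_deriv_continuous (dF x xab).
have aab : a \in `[a, b] by rewrite in_itv /= lexx ltW.
have bab : b \in `[a, b] by rewrite in_itv /= lexx ltW.
rewrite /Rintegral (@continuous_FTC2 _ f F a b) //=.
- by apply: continuous_in_subspaceT => x; rewrite inE => /cf.
- split.
  + by move=> x xab; have [] := dF x (subset_itv_oo_cc xab).
  + exact: (cvg_at_right_filter (cF a aab)).
  + exact: (cvg_at_left_filter (cF b bab)).
- by move=> x xab; rewrite derive1E; have [_ ->] := dF x (subset_itv_oo_cc xab).
Qed.

Lemma continuous_integrable_itv f (a b : R) : continuous f ->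
  lebesgue_measure.-integrable `[a, b] (EFin \o f).
Proof.
move=> cf; apply: continuous_compact_integrable; first exact: segment_compact.
exact: continuous_subspaceT.
Qed.

End calculus.

Section circle.
Context {R : realType}.
Implicit Types (r t a k : R).

Let u r t : R := 1 - r * cos t.
Let v r t : R := - (r * sin t).

(** With z = r e^(i t) and u + i v = 1 - r e^(i t), this is the real part of
    (1 - z)^a e^(- i k t). *)
Definition circ_cos a k r t := pcos (u r) (v r) a (fun s => k * s) t.
Definition circ_sin a k r t := psin (u r) (v r) a (fun s => k * s) t.

Lemma circ_u_gt0 r t : `|r| < 1 -> 0 < u r t.
Proof.
move=> r1; rewrite subr_gt0; apply: le_lt_trans r1.
apply: (le_trans (ler_norm _)); rewrite normrM ler_piMr //.
by rewrite ler_norml cos_geN1 cos_le1.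
Qed.

Lemma circ_sqr r t : u r t ^+ 2 + v r t ^+ 2 = 1 - 2 * r * cos t + r ^+ 2.
Proof. by rewrite /u /v; ring: (cos2sin2 t). Qed.

Lemma circ_sqr_gt0 r t : `|r| < 1 -> 0 < u r t ^+ 2 + v r t ^+ 2.
Proof. by move=> r1; rewrite sqrD_gt0 // circ_u_gt0. Qed.

(** The real part of (1 - z)^a e^(- i k t) (e^(i t) - r), since
    (1 - z)^(a - 1) e^(i t) |1 - z|^2 = (1 - z)^a e^(i t) (1 - conj z). *)
Lemma circ_cosM a k r t : `|r| < 1 ->
  circ_cos (a - 1) (k - 1) r t * (u r t ^+ 2 + v r t ^+ 2) =
  (cos t - r) * circ_cos a k r t - sin t * circ_sin a k r t.
Proof.
move=> r1; have u0 := circ_u_gt0 t r1.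
rewrite -(expR_lmod (v r) u0) /circ_cos /circ_sin /pcos /psin.
set L := lmod _ _ _; set A := larg _ _ _.
have hc : expR L * cos A = u r t by exact: expR_lmod_cos.
have hs : expR L * sin A = v r t by exact: expR_lmod_sin.
have -> : (a - 1) * A - (k - 1) * t = (a * A - k * t) - (A - t) by ring.
have eL : expR ((a - 1) * L) * expR L = expR (a * L).
  by rewrite -expRD; congr expR; ring.
rewrite cosB cosB sinB; set C := cos (a * A - _); set S := sin (a * A - _).
have e1 : u r t * cos t + v r t * sin t = cos t - r.
  by rewrite /u /v; ring: (cos2sin2 t).
have e2 : v r t * cos t - u r t * sin t = - sin t by rewrite /u /v; ring.
transitivity (expR ((a - 1) * L) * expR L *
   (C * (expR L * cos A * cos t + expR L * sin A * sin t) +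
    S * (expR L * sin A * cos t - expR L * cos A * sin t))); first by ring.
by rewrite eL hc hs e1 e2; ring.
Qed.

Lemma has_deriv_circ_sin a k r t : `|r| < 1 ->
  has_deriv (circ_sin a k r) t
    (- (a * r * circ_cos (a - 1) (k - 1) r t) - k * circ_cos a k r t).
Proof.
move=> r1; have D0 := circ_sqr_gt0 t r1.
have hu : has_deriv (u r) t (r * sin t).
  apply: has_deriv_eq.
    apply: has_derivD; first exact: has_deriv_cst.
    apply: has_derivN; apply: has_derivM; first exact: has_deriv_cst.
    exact: is_derive_cos.
  by rewrite /=; ring.
have hv : has_deriv (v r) t (- (r * cos t)).
  apply: has_deriv_eq.
    apply: has_derivN; apply: has_derivM; first exact: has_deriv_cst.
    exact: is_derive_sin.
  by rewrite /=; ring.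
have hg : has_deriv (fun s => k * s) t k.
  apply: has_deriv_eq.
    apply: has_derivM; [exact: has_deriv_cst|exact: has_deriv_id].
  by rewrite /=; ring.
apply: has_deriv_eq (has_deriv_psin a hu hv hg (circ_u_gt0 t r1)) _.
have := circ_cosM a k t r1.
rewrite -/(circ_sin a k r t) -/(circ_cos a k r t).
set D := _ + _ in D0 *; move=> h.
have D1 : D != 0 by rewrite gt_eqF.
have -> : circ_cos (a - 1) (k - 1) r t =
  ((cos t - r) * circ_cos a k r t - sin t * circ_sin a k r t) / D.
  by rewrite -h mulfK.
have e1 : u r t * (r * sin t) + v r t * - (r * cos t) = r * sin t.
  by rewrite /u /v; ring.
have e2 : u r t * - (r * cos t) - v r t * (r * sin t) = - r * (cos t - r).
  by rewrite /u /v; ring: (cos2sin2 t).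
by rewrite e1 e2; field.
Qed.

Lemma has_deriv_circ_cos_r a r t : `|r| < 1 ->
  has_deriv (fun s => circ_cos a 0 s t) r (- (a * circ_cos (a - 1) (- 1) r t)).
Proof.
move=> r1; have D0 := circ_sqr_gt0 t r1.
have hu : has_deriv (u^~ t) r (- cos t).
  apply: has_deriv_eq.
    apply: has_derivD; first exact: has_deriv_cst.
    apply: has_derivN; apply: has_derivM; first exact: has_deriv_id.
    exact: has_deriv_cst.
  by rewrite /=; ring.
have hv : has_deriv (v^~ t) r (- sin t).
  apply: has_deriv_eq.
    apply: has_derivN; apply: has_derivM; first exact: has_deriv_id.
    exact: has_deriv_cst.
  by rewrite /=; ring.
have hg : has_deriv (fun s : R => 0 * t) r 0 by exact: has_deriv_cst.
apply: has_deriv_eq (has_deriv_pcos a hu hv hg (circ_u_gt0 t r1)) _.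
have := circ_cosM a 0 t r1; rewrite sub0r.
rewrite [pcos _ _ _ _ _](_ : _ = circ_cos a 0 r t) //.
rewrite [psin _ _ _ _ _](_ : _ = circ_sin a 0 r t) //.
set D := _ + _ in D0 *; move=> h.
have D1 : D != 0 by rewrite gt_eqF.
have -> : circ_cos (a - 1) (-1) r t =
  ((cos t - r) * circ_cos a 0 r t - sin t * circ_sin a 0 r t) / D.
  by rewrite -h mulfK.
have e1 : u r t * - cos t + v r t * - sin t = - (cos t - r).
  by rewrite /u /v; ring: (cos2sin2 t).
have e2 : u r t * - sin t - v r t * - cos t = - sin t.
  by rewrite /u /v; ring.
by rewrite e1 e2; field.
Qed.

Lemma circ_cos_continuous a k r : `|r| < 1 -> continuous (circ_cos a k r).
Proof.
move=> r1 t; have u0 := circ_u_gt0 t r1.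
have hc (c x : R) : has_deriv (fun s => c * s) x c.
  apply: has_deriv_eq.
    apply: has_derivM; [exact: has_deriv_cst|exact: has_deriv_id].
  by rewrite /=; ring.
apply: has_deriv_continuous (has_deriv_pcos a _ _ (hc k t) u0).
- apply: has_derivD; first exact: has_deriv_cst.
  apply: has_derivN; apply: has_derivM; first exact: has_deriv_cst.
  exact: is_derive_cos.
- apply: has_derivN; apply: has_derivM; first exact: has_deriv_cst.
  exact: is_derive_sin.
Qed.

Lemma circ_sin0 a k r : circ_sin a k r 0 = 0.
Proof. by rewrite /circ_sin /psin /larg /v /= sin0 !(mulr0, oppr0, mul0r) atan0 mulr0 addr0 sin0 mulr0. Qed.

Lemma sin2npi n : sin (n%:R * (2 * pi)) = 0 :> R.
Proof.
elim: n => [|n IH]; first by rewrite mul0r sin0.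
by rewrite -natr1 mulrDl mul1r sinD IH [2 * pi]mulr_natl sin2pi mul0r mulr0 addr0.
Qed.

Lemma circ_sin2pi a n r : circ_sin a n%:R r (2 * pi) = 0.
Proof.
rewrite /circ_sin /psin /larg /v /= [2 * pi]mulr_natl sin2pi !(mulr0, oppr0, mul0r) atan0.
by rewrite mulr0 sub0r sinN -mulr_natl sin2npi oppr0 mulr0.
Qed.

Let W a k r := \int[lebesgue_measure]_(t in `[0, 2 * pi]) circ_cos a k r t.

Let twopi_gt0 : 0 < 2 * pi :> R.
Proof. by rewrite mulr_gt0 ?pi_gt0. Qed.

(** The derivative in t of the periodic function Im ((1 - z)^a e^(- i n t))
    has zero mean. *)
Lemma circ_intM a n r : `|r| < 1 ->
  n%:R * W a n%:R r = - (a * r * W (a - 1) (n%:R - 1) r).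
Proof.
move=> r1.
have cc c a' k' : continuous (fun t => c * circ_cos a' k' r t).
  by move=> t; apply: cvgM; [exact: cvg_cst|exact: circ_cos_continuous].
have ci c a' k' : lebesgue_measure.-integrable `[0, 2 * pi]
    (EFin \o (fun t => c * circ_cos a' k' r t)).
  exact: continuous_integrable_itv.
have ci1 a' k' : lebesgue_measure.-integrable `[0, 2 * pi]
    (EFin \o circ_cos a' k' r).
  by apply: continuous_integrable_itv; exact: circ_cos_continuous.
have := @Rintegral_has_deriv _ (circ_sin a n%:R r)
  (fun t => - (a * r) * circ_cos (a - 1) (n%:R - 1) r t - n%:R * circ_cos a n%:R r t)
  _ _ twopi_gt0.
rewrite RintegralB // !RintegralZl // circ_sin0 circ_sin2pi subrr.
rewrite -/(W _ _ _) -/(W _ _ _) => h; apply/eqP; rewrite eq_sym -subr_eq0 -mulNr.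
apply/eqP; apply: h => [t _|t _].
  by apply: has_deriv_eq (has_deriv_circ_sin _ _ _ r1) _; ring.
by apply: cvgB; exact: cc.
Qed.

(** A bound uniform on |z| <= r0, needed to differentiate under the
    integral sign; it holds as |1 - z| lies between 1 - r0 and its inverse. *)
Lemma circ_cos_bound a k r r0 t : r0 < 1 -> `|r| <= r0 ->
  `|circ_cos a k r t| <= expR (`|a| * - ln (1 - r0)).
Proof.
move=> r01 rr0; have r1 : `|r| < 1 by exact: le_lt_trans r01.
have r00 : 0 <= r0 by exact: le_trans rr0.
have p0 : 0 < 1 - r0 by rewrite subr_gt0.
rewrite /circ_cos /pcos normrM (ger0_norm (expR_ge0 _)).
apply: (@le_trans _ _ (expR (a * lmod (u r) (v r) t) * 1)).
  by rewrite ler_wpM2l ?expR_ge0 // ler_norml cos_geN1 cos_le1.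
rewrite mulr1 ler_expR; apply: (le_trans (ler_norm _)); rewrite normrM.
apply: ler_wpM2l => //.
have D0 := circ_sqr_gt0 t r1.
have cb : `|r * cos t| <= r0.
  apply: le_trans rr0; rewrite normrM ler_piMr //.
  by rewrite ler_norml cos_geN1 cos_le1.
have [c1 c2] : - r0 <= r * cos t /\ r * cos t <= r0.
  by move: cb; rewrite ler_norml => /andP.
have rr : r ^+ 2 <= r0 ^+ 2 by rewrite -real_normK ?num_real // ler_sqr ?nnegrE.
have lo : (1 - r0) ^+ 2 <= u r t ^+ 2 + v r t ^+ 2.
  apply: (@le_trans _ _ (u r t ^+ 2)); last by rewrite lerDl sqr_ge0.
  rewrite ler_sqr ?nnegrE; first by rewrite lerD2l lerN2.
    exact: ltW.
  exact/ltW/circ_u_gt0.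
have hi : u r t ^+ 2 + v r t ^+ 2 <= (1 - r0)^-1 ^+ 2.
  apply: (@le_trans _ _ ((1 + r0) ^+ 2)); first by rewrite circ_sqr; nra.
  have i0 : 0 <= (1 - r0)^-1 by rewrite invr_ge0 ltW.
  rewrite ler_sqr ?nnegrE ?addr_ge0 //.
  by rewrite -[leRHS]mul1r ler_pdivlMr //; nra.
have e2 : - ln (1 - r0) = ln (((1 - r0)^-1) ^+ 2) / 2.
  by rewrite lnXn ?invr_gt0 // lnV ?posrE //; field.
have e1 : ln (1 - r0) = ln ((1 - r0) ^+ 2) / 2.
  by rewrite lnXn //; field.
have i2 : 0 < 2^-1 :> R by rewrite invr_gt0.
rewrite /lmod ler_norml opprK; apply/andP; split.
  by rewrite e1 ler_pM2r // ler_ln ?posrE ?exprn_gt0.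
by rewrite e2 ler_pM2r // ler_ln ?posrE ?exprn_gt0 ?invr_gt0.
Qed.

(** The mean value property: in r the derivative is, up to a factor, the
    integral of (1 - z)^(a - 1) e^(i t), which [circ_intM] with n = 0 shows to
    vanish, and the value at r = 0 is 2 pi. *)
Lemma circ_mean a r : 0 <= r < 1 -> W a 0 r = 2 * pi.
Proof.
move=> /andP[r_ge0 r1].
(* An open interval around r that stays inside the unit disc, on which the
   derivative is dominated. *)
pose q := (1 + r) / 2.
have qr : r < q by rewrite /q; lra.
have q1 : q < 1 by rewrite /q; lra.
have q0 : 0 < q by rewrite /q; lra.
pose B := expR (`|a - 1| * - ln (1 - q)).
have inq (x : R) : `](- q), q[%classic x -> `|x| <= q.
  by rewrite /= in_itv /= ler_norml => /andP[/ltW -> /ltW ->].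
have inq1 (x : R) : `](- q), q[%classic x -> `|x| < 1.
  by move=> /inq h; exact: le_lt_trans q1.
have D1 x t : `|x| < 1 -> partial1of2 (circ_cos a 0) x t = - (a * circ_cos (a - 1) (-1) x t).
  by move=> x1; rewrite partial1of2E; have [_ ->] := has_deriv_circ_cos_r a t x1.
have intf (x : R) : `](- q), q[%classic x ->
    lebesgue_measure.-integrable `[0, 2 * pi] (EFin \o circ_cos a 0 x).
  by move=> /inq1 x1; apply: continuous_integrable_itv; exact: circ_cos_continuous.
have derf (x t : R) : `](- q), q[%classic x -> `[0, 2 * pi]%classic t ->
    derivable ((circ_cos a 0)^~ t) x 1.
  by move=> /inq1 x1 _; have [] := has_deriv_circ_cos_r a t x1.
have intG : lebesgue_measure.-integrable `[0, 2 * pi : R] (EFin \o (fun=> `|a| * B)).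
  by apply: continuous_integrable_itv => t; exact: cvg_cst.
have G0 (t : R) : 0 <= `|a| * B by rewrite mulr_ge0 ?expR_ge0.
have Gub (x t : R) : `](- q), q[%classic x -> `[0, 2 * pi]%classic t ->
    `|partial1of2 (circ_cos a 0) x t| <= `|a| * B.
  move=> xq _; rewrite D1; last exact: inq1.
  by rewrite normrN normrM ler_wpM2l //; apply: circ_cos_bound => //; exact: inq.
have dW (x : R) : `](- q), q[%classic x -> derivable (W a 0) x 1 /\
    derive1 (W a 0) x = \int[lebesgue_measure]_(t in `[0, 2 * pi]) partial1of2 (circ_cos a 0) x t.
  move=> xq; split.
    exact: (derivable_under_integral _ xq intf derf G0 intG Gub).
  exact: (differentiation_under_integral _ xq intf derf G0 intG Gub).
have W0 : W a 0 0 = 2 * pi.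
  rewrite /W; under eq_Rintegral.
    move=> t _; rewrite /circ_cos /pcos /lmod /larg /u /v !mul0r oppr0 mul0r atan0.
    rewrite !(addr0, mulr0) expr1n expr0n addr0 ln1 mul0r mulr0 expR0 cos0 mulr1.
    over.
  have := @Rintegral_has_deriv _ id (fun=> 1) _ _ twopi_gt0 (fun x _ => @has_deriv_id R x).
  by rewrite subr0; apply=> t _; exact: cvg_cst.
have [->//|r0] := eqVneq r 0.
have {r0}r_gt0 : 0 < r by rewrite lt_neqAle eq_sym r0.
have sub (x : R) : x \in `[0, r] -> `](- q), q[%classic x.
  rewrite /= !in_itv /= => /andP[x0 xr].
  by rewrite (lt_le_trans _ x0) ?oppr_lt0 //= (le_lt_trans xr).
have [||x x0r] := @MVT _ (W a 0) (fun=> 0) 0 r r_gt0.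
- move=> x x0r.
  have /dW[dx dE] : `](- q), q[%classic x by apply: sub; exact: subset_itv_oo_cc x0r.
  apply: DeriveDef => //; rewrite -derive1E dE.
  have x_gt0 : 0 < x by move: x0r; rewrite in_itv => /andP[].
  have x1 : `|x| < 1 by apply: inq1; apply: sub; exact: subset_itv_oo_cc x0r.
  under eq_Rintegral do rewrite D1 // -mulNr.
  rewrite RintegralZl //; last first.
    by apply: continuous_integrable_itv; exact: circ_cos_continuous.
  have := circ_intM a 0 x1; rewrite mul0r sub0r => /esym/eqP.
  rewrite oppr_eq0 mulf_eq0 mulf_eq0 (gt_eqF x_gt0) orbF => /orP[|] /eqP.
    by move=> ->; rewrite oppr0 mul0r.
  by rewrite /W => ->; rewrite mulr0.
- by apply: derivable_within_continuous => x /sub /dW[].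
by rewrite W0 mul0r => /eqP; rewrite subr_eq0 => /eqP.
Qed.

(** The n-th Taylor coefficient of (1 - z)^a. By [circ_intM] it obeys the
    recursion in n and a that defines Cesaro numbers, starting from
    [circ_mean]. *)
Lemma circ_coef a n r : 0 <= r < 1 ->
  \int[lebesgue_measure]_(t in `[0, 2 * pi]) circ_cos a n%:R r t =
  2 * pi * r ^+ n * cesaro (- a) n.
Proof.
move=> r01; rewrite -/(W a n%:R r); elim: n a => [|n IH] a.
  by rewrite circ_mean // expr0 cesaro0 !mulr1.
have n0 : (n.+1%:R : R) != 0 by rewrite pnatr_eq0.
have rn1 : `|r| < 1 by case/andP: r01 => r0 r1; rewrite ger0_norm.
apply: (mulfI n0); rewrite circ_intM // -natr1 addrK IH.
have -> : cesaro (- a) n.+1 = - a / n.+1%:R * cesaro (- (a - 1)) n.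
  rewrite /cesaro big_ord_recl /= addr0 factS natrM.
  have -> : \prod_(i < n) (- a + (bump 0 i)%:R) = \prod_(i < n) (- (a - 1) + i%:R) :> R.
    by apply: eq_bigr => i _; rewrite /bump /= natrD; ring.
  have f0 : (n`!%:R : R) != 0 by rewrite pnatr_eq0 -lt0n fact_gt0.
  by field; rewrite f0 nat1r n0.
by rewrite exprS natr1; field.
Qed.

End circle.

(** * Values of the Wright function *)

Section wright_coefficients.
Context {R : realType}.
Implicit Types (r t a h : R) (w z : R[i]).
Local Open Scope complex_scope.
Lemma cisD (x y : R) : cis (x + y) = cis x * cis y :> R[i].
Proof. by rewrite /cis cosD sinD; simpc; rewrite addrC [X in _ +i* X]addrC. Qed.

Lemma cis0 : cis 0 = 1 :> R[i].
Proof. by rewrite /cis cos0 sin0. Qed.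

Lemma cisN (x : R) : cis (- x) = (cis x)^-1 :> R[i].
Proof.
have nz : cis x != 0.
  apply/eqP => E; have := cisD x (- x); rewrite subrr E mul0r cis0.
  by move/eqP; rewrite oner_eq0.
by apply: (mulfI nz); rewrite -cisD subrr cis0 divff.
Qed.

Lemma cisX (x : R) n : cis x ^+ n = cis (n%:R * x) :> R[i].
Proof.
elim: n => [|n IH]; first by rewrite expr0 mul0r cis0.
by rewrite exprS IH -cisD -natr1 mulrDl mul1r addrC.
Qed.

Lemma carg_right (x y : R) : 0 < x -> carg (x +i* y) = atan (y / x).
Proof.
move=> x0; rewrite /carg /cmod /=.
have D0 := sqrD_gt0 y x0.
have cE : x / Num.sqrt (x ^+ 2 + y ^+ 2) = cos (atan (y / x)).
  rewrite cos_atan.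
  have -> : 1 + (y / x) ^+ 2 = (x ^+ 2 + y ^+ 2) * x^-1 ^+ 2.
    by field; rewrite gt_eqF.
  rewrite sqrtrM ?ltW // sqrtr_sqr gtr0_norm ?invr_gt0 // invfM invrK.
  by rewrite mulrC.
rewrite cE; case: ifPn => [y0|].
  have a0 : 0 <= atan (y / x).
    by rewrite -(atan0 R); apply: le_atan; exact: divr_ge0 y0 (ltW x0).
  rewrite cosK // in_itv /= a0 /=; apply/ltW; apply: (lt_trans (atan_ltpi2 _)).
  by rewrite ltr_pdivrMr // ltr_pMr ?pi_gt0 // ltr1n.
rewrite -ltNge => y0.
have a0 : atan (y / x) <= 0.
  by rewrite -(atan0 R); apply: le_atan; rewrite pmulr_lle0 ?invr_gt0 // ltW.
rewrite cosKN ?opprK // a0 andbT; apply/ltW; apply: lt_trans (atan_gtNpi2 _).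
by rewrite ltrN2 ltr_pdivrMr // ltr_pMr ?pi_gt0 // ltr1n.
Qed.

Lemma cmod_right (u v : R -> R) t : 0 < u t ->
  cmod (u t +i* v t) = expR (lmod u v t).
Proof.
by move=> ut; rewrite /cmod /= -(expR_lmod v ut) sqrtr_sqr ger0_norm ?expR_ge0.
Qed.

(** On the circle 1 - z has positive real part, where the principal argument
    is an arctangent. *)
Lemma cpow_circle a h r t : 0 < h -> `|r| < 1 ->
  cpow ((1 - r%:C * cis t) / h%:C) a =
  (h `^ (- a))%:C *
  ((expR (a * lmod (fun t => 1 - r * cos t) (fun t => - (r * sin t)) t))%:C *
   cis (a * larg (fun t => 1 - r * cos t) (fun t => - (r * sin t)) t)).
Proof.
move=> h0 r1; set u := fun t => 1 - r * cos t; set v := fun t => - (r * sin t).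
have u0 : 0 < u t by exact: circ_u_gt0.
have -> : (1 - r%:C * cis t) / h%:C = (h^-1 * u t) +i* (h^-1 * v t).
  by rewrite -fmorphV /cis /u /v; simpc; congr (_ +i* _); ring.
have cm : cmod (h^-1 * u t +i* (h^-1 * v t)) = h^-1 * expR (lmod u v t).
  rewrite -cmod_right // /cmod /= !exprMn -mulrDr sqrtrM ?sqr_ge0 // sqrtr_sqr.
  by rewrite gtr0_norm // invr_gt0.
rewrite /cpow cm carg_right ?mulr_gt0 ?invr_gt0 //.
rewrite -mulf_div divff ?invr_eq0 ?gt_eqF // mul1r mulrA -rmorphM /=.
congr (_%:C * _); rewrite powRM ?invr_ge0 ?expR_ge0 ?ltW //.
rewrite -[in LHS](powR_inv1 (ltW h0)) -powRrM mulN1r; congr (_ * _).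
by rewrite /powR gt_eqF ?expR_gt0 // expRK.
Qed.

Lemma Re_sum I (s : seq I) (P : pred I) (F : I -> R[i]) :
  complex.Re (\sum_(i <- s | P i) F i) = \sum_(i <- s | P i) complex.Re (F i).
Proof. by elim/big_rec2: _ => // i x y _ <-; case: (F i) => a b; case: y. Qed.

Lemma Re_realM (x : R) (z : R[i]) : complex.Re (x%:C * z) = x * complex.Re z.
Proof. by case: z => a b; simpc. Qed.

Lemma Rintegral_sum (A : set R) n (F : nat -> R -> R) : measurable A ->
  (forall i, lebesgue_measure.-integrable A (EFin \o F i)) ->
  \int[lebesgue_measure]_(t in A) (\sum_(i < n) F i t) =
  \sum_(i < n) \int[lebesgue_measure]_(t in A) F i t.
Proof.
move=> mA iF; elim: n => [|n IH].
  by rewrite big_ord0; under eq_Rintegral do rewrite big_ord0; rewrite Rintegral_cst ?mul0r.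
rewrite big_ord_recr /= -IH -RintegralD //; last first.
  rewrite (_ : _ \o _ = (fun t => \sum_(i < n) (F i t)%:E)%E); last first.
    by apply/funext => t /=; rewrite sumEFin.
  by apply: integrable_sum => // i _; exact: iF.
by apply: eq_Rintegral => t _; rewrite big_ord_recr.
Qed.

(** Expanding the j-th power, the contour integral becomes a sum of Taylor
    coefficients of powers of 1 - z. *)
Lemma wrightE r alpha beta h n j : 0 < r < 1 -> 0 < h ->
  wright r alpha beta h n j =
  \sum_(l < j.+1) 'C(j, l)%:R * (- h) ^+ l * h `^ (- (alpha * l%:R - beta)) *
     cesaro (beta - alpha * l%:R) n.
Proof.
move=> /andP[r0 r1] h0; have rn1 : `|r| < 1 by rewrite gtr0_norm.
have h_neq0 : h != 0 by rewrite gt_eqF.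
pose e l := alpha * l%:R - beta.
pose kappa l := 'C(j, l)%:R * (- h) ^+ l * h `^ (- e l) : R.
pose L t := lmod (fun s => 1 - r * cos s) (fun s => - (r * sin s)) t.
pose A t := larg (fun s => 1 - r * cos s) (fun s => - (r * sin s)) t.
have E t :
  ((r%:C * cis t) ^+ n.+1)^-1 *
    ((1 - h%:C * cpow ((1 - r%:C * cis t) / h%:C) alpha) ^+ j /
      cpow ((1 - r%:C * cis t) / h%:C) beta) * ('i%C * r%:C * cis t) =
  'i%C * \sum_(l < j.+1) (kappa l * r ^- n)%:C *
    ((expR (e l * L t))%:C * cis (e l * A t - n%:R * t)).
  rewrite !cpow_circle // -/(L t) -/(A t).
  have cz : cis t != 0 :> R[i].
    apply/eqP => c0; have := cisD t (- t); rewrite c0 mul0r subrr cis0.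
    by move/eqP; rewrite oner_eq0.
  have rz : r%:C != 0 by rewrite fmorph_eq0 gt_eqF.
  have -> : ((r%:C * cis t) ^+ n.+1)^-1 = (r ^- n)%:C * cis (- (n%:R * t)) / (r%:C * cis t).
    rewrite exprSr invfM exprMn invfM cisX cisN fmorphV /= rmorphXn.
    by [].
  have -> (w : R[i]) : (r ^- n)%:C * cis (- (n%:R * t)) / (r%:C * cis t) * w *
     ('i%C * r%:C * cis t) = 'i%C * ((r ^- n)%:C * cis (- (n%:R * t)) * w).
    have zz : r%:C * cis t != 0 by rewrite mulf_neq0.
    move: ((r ^- n)%:C * cis (- (n%:R * t))) zz => a.
    rewrite -['i%C * _ * _]mulrA; move: (r%:C * cis t) => z zz.
    by rewrite mulrCA; congr (_ * _); rewrite mulrAC divfK.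
  congr (_ * _).
  rewrite exprDn mulr_suml mulr_sumr; apply: eq_bigr => l _.
  have e1 (p q y : R) : - (h%:C * (p%:C * (q%:C * cis y))) = (- h * p * q)%:C * cis y.
    by rewrite !rmorphM rmorphN /=; ring.
  have e2 (p q y : R) : (p%:C * (q%:C * cis y))^-1 = (p^-1 * q^-1)%:C * cis (- y).
    by rewrite !invfM cisN rmorphM /= !fmorphV mulrA.
  rewrite expr1n mul1r e1 e2 exprMn -rmorphXn /= !exprMn cisX.
  have -> : kappa l = 'C(j, l)%:R * (- h) ^+ l * (h `^ (- alpha) ^+ l * (h `^ (- beta))^-1).
    rewrite /kappa; congr (_ * _).
    rewrite -powR_mulrn ?powR_ge0 // -powRrM -powRN opprK -powRD; last by rewrite h_neq0 implybT.
    by congr (_ `^ _); rewrite /e; ring.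
  have -> : expR (e l * L t) = expR (alpha * L t) ^+ l * (expR (beta * L t))^-1.
    by rewrite -expRM_natl -expRN -expRD; congr expR; rewrite /e; ring.
  have -> : cis (e l * A t - n%:R * t) =
     cis (- (n%:R * t)) * (cis (l%:R * (alpha * A t)) * cis (- (beta * A t))).
    by rewrite -!cisD; congr cis; rewrite /e; ring.
  have e3 (w : R[i]) : w *+ 'C(j, l) = ('C(j, l)%:R)%:C * w.
    by rewrite rmorph_nat mulr_natl.
  by rewrite e3 !rmorphM /=; ring.
have Im_i (w : R[i]) : complex.Im ('i%C * w) = complex.Re w.
  by rewrite mulrC ImiRe.
have Re_pi (P Q : R) : complex.Re ((2 * pi%:C * 'i%C)^-1 * (P +i* Q)) = Q / (2 * pi).
  have -> : (2 * pi%:C * 'i%C)^-1 = ((2 * pi : R)^-1)%:C * - 'i%C :> R[i].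
    have i2 : 'i%C * - 'i%C = 1 :> R[i] by rewrite mulrN -expr2 sqr_i opprK.
    have i0 : 'i%C != 0 :> R[i] by apply: contra_eq_neq i2 => ->; rewrite mul0r eq_sym oner_neq0.
    apply: (mulfI (_ : 2 * pi%:C * 'i%C != 0 :> R[i])).
      rewrite !mulf_neq0 ?pnatr_eq0 // fmorph_eq0 gt_eqF //; exact: pi_gt0.
    rewrite divff ?mulf_neq0 ?pnatr_eq0 // ?fmorph_eq0 ?gt_eqF ?pi_gt0 //.
    rewrite mulrACA i2 mulr1 fmorphV rmorphM rmorph_nat /= divff //.
    by rewrite mulf_neq0 ?pnatr_eq0 // fmorph_eq0 gt_eqF // pi_gt0.
  by rewrite -mulrA Re_realM mulrC; congr (_ * _); simpc.
rewrite /wright /circle_integral /Cintegral Re_pi.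
under eq_Rintegral.
  move=> t _; rewrite E Im_i Re_sum.
  under eq_bigr do rewrite !Re_realM.
  over.
rewrite (@Rintegral_sum _ j.+1 (fun l t => kappa l * r ^- n * circ_cos (e l) n%:R r t)) //; last first.
  move=> l; apply: continuous_integrable_itv => t.
  apply: cvgM; [exact: cvg_cst|exact: circ_cos_continuous].
rewrite mulr_suml; apply: eq_bigr => l _.
rewrite RintegralZl //; last first.
  by apply: continuous_integrable_itv; exact: circ_cos_continuous.
rewrite circ_coef ?r1 ?ltW // /kappa /e opprB.
have := pi_gt0 R => pi0.
have rn0 : r ^+ n != 0 by rewrite expf_neq0 // gt_eqF.
have alg (x c q y : R) : 0 < x -> q != 0 -> c / q * (2 * x * q * y) / (2 * x) = c * y.
  by move=> x0 q0; field; rewrite q0 gt_eqF.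
exact: alg.
Qed.

(** The powers of h in [wrightE] combine into powers of the single parameter
    c = h^(1 - alpha), which makes [sum_cesaro_sib] applicable. *)
Lemma wright_sib r alpha h n j : 0 < r < 1 -> 0 < h -> 0 < alpha < 1 ->
  let c := h `^ (1 - alpha) in
  wright r alpha (1 - alpha) h n j =
  c * \sum_(i < j.+1) 'C(j, i)%:R * (1 - c) ^+ (j - i) * c ^+ i * sib alpha n i.
Proof.
move=> r01 h0 al01 c; rewrite wrightE // -sum_cesaro_sib // mulr_sumr.
apply: eq_bigr => l _.
have -> : h `^ (- (alpha * l%:R - (1 - alpha))) = c * (c ^+ l / h ^+ l).
  have h_neq0 : h != 0 by rewrite gt_eqF.
  rewrite /c -!powR_mulrn ?powR_ge0 ?ltW // -powRrM -powRN.
  by rewrite -!powRD ?h_neq0 ?implybT //; congr (_ `^ _); ring.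
rewrite (exprNn h) (exprNn c); have hl : h ^+ l != 0 by rewrite expf_neq0 // gt_eqF.
by field.
Qed.

End wright_coefficients.

(** * Gamma integrals *)

Section gamma_integrals.
Context {R : realType}.
Implicit Types (s H t x y : R).
Local Notation mu := (@lebesgue_measure R).

Definition gamma_fun s H t : R := t `^ s * expR (- (t / H)).

Lemma gamma_fun_ge0 s H t : 0 <= gamma_fun s H t.
Proof. by rewrite mulr_ge0 ?powR_ge0 ?expR_ge0. Qed.

Lemma measurable_gamma_fun s H (D : set R) : measurable_fun D (gamma_fun s H).
Proof.
apply: measurable_funTS; apply: measurable_funM; first exact: measurable_powR.
apply: measurableT_comp; first exact: measurable_expR.
apply: measurableT_comp; first exact: oppr_measurable.
exact: mulrr_measurable.
Qed.

Lemma has_deriv_gamma_fun s H t : 0 < t ->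
  has_deriv (gamma_fun s H) t (s * gamma_fun (s - 1) H t - H^-1 * gamma_fun s H t).
Proof.
move=> t0; apply: has_deriv_eq.
  apply: has_derivM; first exact: is_derive1_powR.
  apply: (@has_deriv_comp _ expR); first exact: is_derive_expR.
  apply: has_derivN; apply: has_derivM; [exact: has_deriv_id|exact: has_deriv_cst].
by rewrite /gamma_fun /=; ring.
Qed.

Lemma continuous_gamma_fun s H t : 0 < t -> {for t, continuous (gamma_fun s H)}.
Proof. by move=> t0; exact: has_deriv_continuous (has_deriv_gamma_fun s H t0). Qed.

Let itv_gt0 x y t : 0 < x -> t \in `[x, y] -> 0 < t.
Proof. by move=> x0; rewrite in_itv /= => /andP[xt _]; exact: lt_le_trans xt. Qed.

Lemma integrable_gamma_fun_itv s H x y : 0 < x ->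
  mu.-integrable `[x, y] (EFin \o gamma_fun s H).
Proof.
move=> x0; apply: continuous_compact_integrable; first exact: segment_compact.
apply: continuous_in_subspaceT => t; rewrite inE => /(itv_gt0 x0).
exact: continuous_gamma_fun.
Qed.

(** The integrated form of the derivative of t^s e^(- t/H). *)
Lemma gamma_fun_by_parts s H x y : 0 < x -> x < y ->
  s * \int[mu]_(t in `[x, y]) gamma_fun (s - 1) H t + gamma_fun s H x =
  gamma_fun s H y + H^-1 * \int[mu]_(t in `[x, y]) gamma_fun s H t.
Proof.
move=> x0 xy; have ig s' := integrable_gamma_fun_itv s' H y x0.
have igM c s' : mu.-integrable `[x, y] (EFin \o (fun t => c * gamma_fun s' H t)).
  exact: (integrableZl _ c (ig s')).
have := @Rintegral_has_deriv _ (gamma_fun s H)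
  (fun t => s * gamma_fun (s - 1) H t - H^-1 * gamma_fun s H t) _ _ xy.
rewrite RintegralB // !RintegralZl // => h.
have {}h := h (fun t tx => has_deriv_gamma_fun s H (itv_gt0 x0 tx)).
set I := _ * _ in h *; set J := _ * _ in h *.
have -> : gamma_fun s H y = I - J + gamma_fun s H x.
  rewrite h ?subrK // => t tx; have t0 := itv_gt0 x0 tx.
  apply: cvgB; (apply: cvgM; first exact: cvg_cst); exact: continuous_gamma_fun.
by ring.
Qed.

Let trunc n : set R := `[n.+2%:R^-1, n.+2%:R].

Let mtrunc n : measurable (trunc n).
Proof. exact: measurable_itv. Qed.

Let trunc_gt0 n : 0 < n.+2%:R^-1 :> R.
Proof. by rewrite invr_gt0. Qed.

Let trunc_lt n : n.+2%:R^-1 < n.+2%:R :> R.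
Proof.
apply: (@lt_trans _ _ 1); first by rewrite invf_lt1 // ltr1n.
by rewrite ltr1n.
Qed.

Let trunc_nd : {homo trunc : n m / (n <= m)%N >-> (n <= m)%O}.
Proof.
move=> n m nm; apply/subsetPset => t; rewrite /trunc /= !in_itv /= => /andP[h1 h2].
apply/andP; split; last by rewrite (le_trans h2) // ler_nat.
by apply: le_trans h1; rewrite lef_pV2 ?posrE // ler_nat.
Qed.

Let trunc_cup : \bigcup_n trunc n = `]0, +oo[%classic.
Proof.
apply/seteqP; split => t /=.
  by move=> [n _]; rewrite /trunc /= !in_itv /= andbT => /andP[h1 _]; exact: lt_le_trans h1.
rewrite in_itv /= andbT => t0.
pose k := (Num.trunc (t + t^-1)).
exists k => //; rewrite /trunc /= in_itv /=.
have h : t + t^-1 < k.+2%:R.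
  apply: (@lt_trans _ _ k.+1%:R); last by rewrite ltr_nat.
  by rewrite /k truncnS_gt.
have ti : 0 < t^-1 by rewrite invr_gt0.
apply/andP; split; last by lra.
by rewrite -[leRHS]invrK lef_pV2 ?posrE ?invr_gt0 //; lra.
Qed.

Definition gamma_int s H : \bar R :=
  (\int[mu]_(t in `]0%R, +oo[) (gamma_fun s H t)%:E)%E.

Let cvg_trunc s H :
  (\int[mu]_(t in trunc n) (gamma_fun s H t)%:E)%E @[n --> \oo] --> gamma_int s H.
Proof.
rewrite /gamma_int -trunc_cup; apply: ge0_nondecreasing_set_cvg_integral => //.
- by move=> n; apply/measurable_EFinP; exact: measurable_gamma_fun.
- by move=> n t _; rewrite lee_fin gamma_fun_ge0.
Qed.

Let cvg_gamma_fun0 s H : 0 < s -> 0 < H ->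
  gamma_fun s H (n.+2%:R^-1) @[n --> \oo] --> (0 : R).
Proof.
move=> s0 H0.
apply: (@squeeze_cvgr _ _ _ _ (fun=> 0) (fun n => (n.+2%:R^-1 : R) `^ s)).
- near=> n; rewrite gamma_fun_ge0 /=.
  rewrite ler_piMr ?powR_ge0 // -expR0 ler_expR oppr_le0 divr_ge0 //.
  exact: ltW.
- exact: cvg_cst.
- have /cvg_at_rightP h := powR_cvg0 s0.
  apply: (h (fun n : nat => n.+2%:R^-1)); split; first by move=> n.
  have := @cvg_harmonic R; rewrite -(@cvg_shiftS _ (harmonic : R^nat)).
  exact.
Unshelve. all: by end_near. Qed.

Lemma exprX_expRN_le (u : R) k : 0 <= u -> u ^+ k * expR (- u) <= k%:R ^+ k.
Proof.
move=> u0; rewrite expRN ler_pdivrMr ?expR_gt0 //.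
case: k => [|k]; first by rewrite !expr0 mul1r -expR0 ler_expR.
set v := u / k.+1%:R; have uE : u = k.+1%:R * v by rewrite mulrC divfK.
rewrite uE expRM_natl exprMn ler_pM2l ?exprn_gt0 //.
have v0 : 0 <= v by rewrite divr_ge0.
rewrite lerXn2r ?nnegrE ?expR_ge0 //.
by apply: le_trans (expR_ge1Dx _); rewrite lerDr.
Qed.

Lemma powR_le1D s u : 0 <= s <= 1 -> 0 <= u -> u `^ s <= 1 + u.
Proof.
move=> /andP[s0 s1] u0; have [u1|u1] := leP u 1.
  apply: (@le_trans _ _ 1); last by rewrite lerDl.
  by apply: (le_trans (ge0_ler_powR s0 _ _ u1)); rewrite ?nnegrE ?powR1.
apply: (@le_trans _ _ u); last by rewrite lerDr.
by apply: ler1_powR => //; exact: ltW.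
Qed.

Lemma gamma_fun_le s H t : 0 <= s <= 1 -> 0 < H -> 0 <= t -> gamma_fun s H t <= H `^ s.
Proof.
move=> s01 H0 t0; rewrite /gamma_fun.
have -> : t `^ s = H `^ s * (t / H) `^ s.
  by rewrite -powRM ?divr_ge0 ?(ltW H0) // mulrC divfK // gt_eqF.
have u0 : 0 <= t / H by rewrite divr_ge0 // ltW.
rewrite -mulrA ler_piMr ?powR_ge0 // expRN ler_pdivrMr ?expR_gt0 // mul1r.
by apply: (le_trans (powR_le1D s01 u0)); exact: expR_ge1Dx.
Qed.

Local Open Scope ereal_scope.

Lemma gamma_int_ge0 s H : 0 <= gamma_int s H.
Proof. by apply: integral_ge0 => t _; rewrite lee_fin gamma_fun_ge0. Qed.

Let trunc_int_fin s H n :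
  \int[mu]_(t in trunc n) (gamma_fun s H t)%:E =
  (\int[mu]_(t in trunc n) gamma_fun s H t)%R%:E.
Proof.
rewrite /Rintegral fineK //; apply: integrable_fin_num; first exact: mtrunc.
exact: integrable_gamma_fun_itv.
Qed.

Let trunc_le s H n :
  \int[mu]_(t in trunc n) (gamma_fun s H t)%:E <= gamma_int s H.
Proof.
apply: ge0_subset_integral.
- exact: mtrunc.
- exact: measurable_itv.
- by apply/measurable_EFinP; exact: measurable_gamma_fun.
- by move=> t _; rewrite lee_fin gamma_fun_ge0.
- by rewrite -trunc_cup; exact: bigcup_sup.
Qed.

Let cvg_limit_le (u : (\bar R)^nat) (e : R^nat) (l K : \bar R) :
  u @ \oo --> l -> e @ \oo --> (0%R : R) -> (forall n, u n <= K + (e n)%:E) -> l <= K.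
Proof.
move=> ul e0 uK.
have ke : K + (e n)%:E @[n --> \oo] --> K.
  have := @cvgeD _ _ _ _ (fun=> K) (fun n => (e n)%:E) K 0%R%:E.
  rewrite adde0; apply => //; first by rewrite fin_num_adde_defl.
  - exact: cvg_cst.
  - by apply: cvg_EFin => //; exact: nearW.
rewrite -(cvg_lim _ ul) // -(cvg_lim _ ke) //.
by apply: lee_lim; [apply: cvgP ul|apply: cvgP ke|exact: nearW].
Qed.

Lemma gamma_int_step s H : (0 < s)%R -> (0 < H)%R ->
  gamma_int s H <= (H * s)%:E * gamma_int (s - 1) H.
Proof.
move=> s0 H0; apply: (@cvg_limit_le _ (fun n => H * gamma_fun s H n.+2%:R^-1)%R (gamma_int s H) _ (@cvg_trunc s H)).
  by rewrite -[X in _ --> X](mulr0 H); apply: cvgM; [exact: cvg_cst|exact: cvg_gamma_fun0].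
move=> n; apply: (le_trans (y := (H * s)%:E * \int[mu]_(t in trunc n) (gamma_fun (s - 1) H t)%:E
    + (H * gamma_fun s H n.+2%:R^-1)%:E)).
  rewrite !trunc_int_fin -EFinM -EFinD lee_fin.
  have := gamma_fun_by_parts s H (trunc_gt0 n) (trunc_lt n).
  have := gamma_fun_ge0 s H n.+2%:R => g0 h.
  rewrite -mulrA -mulrDr h mulrDr mulVKf ?gt_eqF // lerDr.
  by rewrite mulr_ge0 // ltW.
apply: leeD => //; apply: lee_pmul => //.
- by rewrite lee_fin mulr_ge0 // ltW.
- by apply: integral_ge0 => t _; rewrite lee_fin gamma_fun_ge0.
Qed.

(** Integration by parts lowers the exponent to s - 1, possibly negative.
    The boundary term at infinity is bounded by H^s instead of being computed. *)
Lemma gamma_int_base s H : (0 < s <= 1)%R -> (0 < H)%R ->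
  s%:E * gamma_int (s - 1) H <= (H `^ s)%:E + H^-1%:E * gamma_int s H.
Proof.
move=> /andP[s0 s1] H0.
have hc : s%:E * \int[mu]_(t in trunc n) (gamma_fun (s - 1) H t)%:E @[n --> \oo] -->
    s%:E * gamma_int (s - 1) H.
  by apply: cvgeZl => //; exact: cvg_trunc.
apply: (@cvg_limit_le _ (fun=> 0%R) _ _ hc (cvg_cst _)) => n.
rewrite adde0; apply: (le_trans (y := (H `^ s)%:E +
   H^-1%:E * \int[mu]_(t in trunc n) (gamma_fun s H t)%:E)).
  rewrite !trunc_int_fin -!EFinM -EFinD lee_fin.
  have h := gamma_fun_by_parts s H (trunc_gt0 n) (trunc_lt n).
  rewrite -[X in (X <= _)%R](addrK (gamma_fun s H n.+2%:R^-1)) h lerBlDr.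
  rewrite ler_wpDr ?gamma_fun_ge0 // lerD2r gamma_fun_le // (ltW s0) s1 //.
apply: leeD => //; apply: lee_pmul => //.
- by rewrite lee_fin invr_ge0 ltW.
- by apply: integral_ge0 => t _; rewrite lee_fin gamma_fun_ge0.
Qed.

Let cvg_gamma_fun_infty k H : (0 < H)%R ->
  gamma_fun k%:R H (n.+2%:R) @[n --> \oo] --> (0%R : R).
Proof.
(* One more power of t than in the integrand gives decay like 1 / t. *)
move=> H0; pose C : R := (H ^+ k.+1 * k.+1%:R ^+ k.+1)%R.
apply: (@squeeze_cvgr _ _ _ _ (fun=> 0%R) (fun n => C * harmonic n.+1)%R).
- near=> n; rewrite gamma_fun_ge0 /= /harmonic ler_pdivlMr // /gamma_fun powR_mulrn //.
  have u0 : (0 <= n.+2%:R / H)%R by rewrite divr_ge0 // ltW.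
  have yE : n.+2%:R = (H * (n.+2%:R / H))%R :> R by rewrite mulrC divfK // gt_eqF.
  rewrite mulrAC -exprSr [X in (X ^+ _)%R]yE exprMn -mulrA /C.
  by rewrite ler_pM2l ?exprn_gt0 // exprX_expRN_le.
- exact: cvg_cst.
- rewrite -[X in _ --> X](mulr0 C); apply: cvgM; first exact: cvg_cst.
  by have := @cvg_harmonic R; rewrite -(@cvg_shiftS _ (harmonic : R^nat)).
Unshelve. all: by end_near. Qed.

Lemma gamma_int0 H : (0 < H)%R -> gamma_int 0 H = H%:E.
Proof.
move=> H0.
have E n : (\int[mu]_(t in trunc n) gamma_fun 0 H t)%R =
   (H * (gamma_fun 0 H n.+2%:R^-1 - gamma_fun 0 H n.+2%:R))%R.
  have := gamma_fun_by_parts 0 H (trunc_gt0 n) (trunc_lt n).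
  by rewrite mul0r add0r => ->; rewrite addrAC subrr add0r mulVKf ?gt_eqF.
apply/eqP; rewrite eq_le; apply/andP; split.
  apply: (@cvg_limit_le _ (fun=> 0%R) (gamma_int 0 H) _ (@cvg_trunc 0 H) (cvg_cst _)) => n.
  rewrite adde0 trunc_int_fin lee_fin E -[leRHS]mulr1 ler_pM2l //.
  rewrite lerBlDr ler_wpDr ?gamma_fun_ge0 // /gamma_fun powRr0 mul1r.
  by rewrite -expR0 ler_expR oppr_le0 divr_ge0 ?invr_ge0 ?ltW.
have hc : (H * gamma_fun 0 H n.+2%:R^-1)%:E @[n --> \oo] --> H%:E.
  apply: cvg_EFin; first exact: nearW.
  rewrite -[X in _ --> X]mulr1; apply: cvgM; first exact: cvg_cst.
  rewrite -[X in _ --> X]expR0; have -> : gamma_fun 0 H = (fun t => expR (- (t / H))).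
    by apply/funext => t; rewrite /gamma_fun powRr0 mul1r.
  apply: (@cvg_comp _ _ _ (fun n : nat => - (n.+2%:R^-1 / H))%R expR _ _ _ _
    (@continuous_expR R 0%R)).
  suff : (- (n.+2%:R^-1 / H))%R @[n --> \oo] --> (0%R : R) by [].
  rewrite -[X in _ --> X]oppr0; apply: cvgN; rewrite -[X in _ --> X](mul0r (H^-1)%R).
  apply: cvgM; last exact: cvg_cst.
  by have := @cvg_harmonic R; rewrite -(@cvg_shiftS _ (harmonic : R^nat)).
have hy : (H * gamma_fun 0 H n.+2%:R)%R @[n --> \oo] --> (0%R : R).
  by rewrite -[X in _ --> X](mulr0 H); apply: cvgM; [exact: cvg_cst|exact: (@cvg_gamma_fun_infty 0)].
apply: (cvg_limit_le hc hy) => n; apply: le_trans (leeD (trunc_le 0 H n) (lexx _)).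
by rewrite trunc_int_fin E -EFinD lee_fin mulrBr subrK.
Qed.

Lemma gamma_int_nat k H : (0 < H)%R -> gamma_int k%:R H = (k`!%:R * H ^+ k.+1)%:E.
Proof.
move=> H0; elim: k => [|k IH]; first by rewrite gamma_int0 // mul1r expr1.
have k1 : (k.+1%:R - 1 = k%:R :> R)%R by rewrite -natr1 addrK.
have -> : ((k.+1)`!%:R * H ^+ k.+2 = (H * k.+1%:R) * (k`!%:R * H ^+ k.+1))%R.
  by rewrite factS natrM (exprS H k.+1); ring.
rewrite EFinM -IH; apply/eqP; rewrite eq_le; apply/andP; split.
  by have := @gamma_int_step k.+1%:R H (ltr0Sn _ _) H0; rewrite k1.
have hc : (H * k.+1%:R)%:E * \int[mu]_(t in trunc n) (gamma_fun k%:R H t)%:E @[n --> \oo] -->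
    (H * k.+1%:R)%:E * gamma_int k%:R H.
  by apply: cvgeZl => //; exact: cvg_trunc.
have hy : (H * gamma_fun k.+1%:R H n.+2%:R)%R @[n --> \oo] --> (0%R : R).
  rewrite -[X in _ --> X](mulr0 H); apply: cvgM; [exact: cvg_cst|].
  exact: cvg_gamma_fun_infty.
apply: (cvg_limit_le hc hy) => n; apply: le_trans (leeD (trunc_le k.+1%:R H n) (lexx _)).
rewrite !trunc_int_fin -EFinM -EFinD lee_fin.
have := gamma_fun_by_parts k.+1%:R H (trunc_gt0 n) (trunc_lt n).
rewrite k1 => /(congr1 (fun z => H * z)%R).
rewrite mulrDr [in RHS]mulrDr mulVKf ?gt_eqF // => h.
by rewrite addrC -h -mulrA lerDl mulr_ge0 ?gamma_fun_ge0 // ltW.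
Qed.

Lemma gamma_fun_split s H t : (0 <= s <= 1)%R -> (0 < H)%R -> (0 <= t)%R ->
  (gamma_fun s H t <= H `^ s * (gamma_fun 0 H t + H^-1 * gamma_fun 1 H t))%R.
Proof.
move=> s01 H0 t0; rewrite /gamma_fun powRr0 powRr1 //.
have u0 : (0 <= t / H)%R by rewrite divr_ge0 // ltW.
have -> : (t `^ s = H `^ s * (t / H) `^ s)%R.
  by rewrite -powRM ?(ltW H0) // mulrC divfK // gt_eqF.
rewrite [leRHS](_ : _ = H `^ s * ((1 + t / H) * expR (- (t / H))))%R; last by ring.
rewrite -mulrA ler_wpM2l ?powR_ge0 // ler_wpM2r ?expR_ge0 //.
exact: powR_le1D.
Qed.

(** Integration by parts reduces the exponent - a to 1 - a, which lies
    between 0 and 1, so that t^(1 - a) is bounded by a linear function of t. *)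
Lemma gamma_int_frac a H : (0 <= a < 1)%R -> (0 < H)%R ->
  gamma_int (- a) H <= (3 / (1 - a) * H `^ (1 - a))%:E.
Proof.
move=> /andP[a0 a1] H0; have s0 : (0 < 1 - a)%R by rewrite subr_gt0.
have s1 : (1 - a <= 1)%R by rewrite gerBl.
have J1 : gamma_int (1 - a) H <= (H `^ (1 - a) * (2 * H))%:E.
  apply: (le_trans (y := \int[mu]_(t in `]0%R, +oo[)
      ((H `^ (1 - a))%:E * ((gamma_fun 0 H t)%:E + H^-1%:E * (gamma_fun 1 H t)%:E)))).
    apply: ge0_le_integral => //.
    - by move=> t _; rewrite lee_fin gamma_fun_ge0.
    - by apply/measurable_EFinP; exact: measurable_gamma_fun.
    - apply/measurable_EFinP; apply: measurable_funM => //.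
      apply: measurable_funD; first exact: measurable_gamma_fun.
      by apply: measurable_funM => //; exact: measurable_gamma_fun.
    - move=> t; rewrite /= in_itv /= andbT => t0.
      suff : (gamma_fun (1 - a) H t)%:E <=
        (H `^ (1 - a) * (gamma_fun 0 H t + H^-1 * gamma_fun 1 H t))%:E by [].
      by rewrite lee_fin; apply: gamma_fun_split => //; rewrite ?(ltW s0) // ltW.
  have m0 (D : set (measurableTypeR R)) s : measurable_fun D (fun t => (gamma_fun s H t)%:E).
    by apply/measurable_EFinP; exact: measurable_gamma_fun.
  have g0 s t : 0 <= (gamma_fun s H t)%:E by rewrite lee_fin gamma_fun_ge0.
  have Hi : (0 <= H^-1)%R by rewrite invr_ge0 ltW.
  rewrite ge0_integralZl_EFin ?powR_ge0 //; last 2 first.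
  - by move=> t _; rewrite adde_ge0 // mule_ge0 // lee_fin.
  - apply: emeasurable_funD => //; apply: emeasurable_funM => //.
  rewrite ge0_integralD //; last 2 first.
  - by move=> t _; rewrite mule_ge0 // lee_fin.
  - by apply: emeasurable_funM.
  rewrite ge0_integralZl_EFin // -/(gamma_int 0 H) -/(gamma_int 1 H).
  have -> : gamma_int 1 H = (H ^+ 2)%:E.
    by have := gamma_int_nat 1 H0; rewrite mul1r.
  rewrite gamma_int0 //.
  suff : (H `^ (1 - a) * (H + H^-1 * H ^+ 2))%:E <= (H `^ (1 - a) * (2 * H))%:E by [].
  have H1 : (H != 0)%R by rewrite gt_eqF.
  rewrite lee_fin; by rewrite [leRHS](_ : _ = H `^ (1 - a) * (H + H^-1 * H ^+ 2))%R //; field.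
have h := @gamma_int_base (1 - a) H _ H0.
have {}h : (1 - a)%:E * gamma_int (- a) H <= (H `^ (1 - a) * 3)%:E.
  have := h; rewrite s0 s1 addrAC subrr add0r => /(_ isT) h2.
  apply: (le_trans h2).
  apply: (le_trans (leeD (lexx _) (lee_pmul _ _ (lexx _) J1))).
  - by rewrite lee_fin invr_ge0 ltW.
  - exact: gamma_int_ge0.
  have H1 : (H != 0)%R by rewrite gt_eqF.
  suff : (H `^ (1 - a) + H^-1 * (H `^ (1 - a) * (2 * H)))%:E <=
     (H `^ (1 - a) * 3)%:E by [].
  by rewrite lee_fin [leRHS](_ : _ = H `^ (1 - a) + H^-1 * (H `^ (1 - a) * (2 * H)))%R //; field.
have -> : (3 / (1 - a) * H `^ (1 - a) = (1 - a)^-1 * (H `^ (1 - a) * 3))%R by ring.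
rewrite EFinM -(@lee_pmul2l _ (1 - a)%:E) ?lte_fin //.
apply: (le_trans h).
have e : ((1 - a) * ((1 - a)^-1 * (H `^ (1 - a) * 3)) = H `^ (1 - a) * 3)%R.
  by rewrite mulVKf // gt_eqF.
by rewrite -[X in X%:E <= _]e; exact: lexx.
Qed.

(** Raising the exponent by one multiplies the integral by H (i + 1 - a) at
    most, and the Cesaro number of order 1 - a at i obeys the same recursion up
    to the factorial. *)
Lemma gamma_int_le a H i : (0 <= a < 1)%R -> (0 < H)%R ->
  gamma_int (i%:R - a) H <=
  (3 / (1 - a) * H `^ (- a) * (H ^+ i.+1 * i`!%:R) * cesaro (1 - a) i)%:E.
Proof.
move=> a01 H0; have [a0 a1] := andP a01; elim: i => [|i IH].
  rewrite sub0r; apply: (le_trans (gamma_int_frac a01 H0)).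
  rewrite lee_fin fact0 cesaro0 expr1 !mulr1.
  have -> : (H `^ (1 - a) = H * H `^ (- a))%R.
    by rewrite powRD ?(gt_eqF H0) ?implybT // powRr1 // ltW.
  by rewrite le_eqVlt; apply/orP; left; apply/eqP; ring.
have E : (i.+1%:R - a - 1 = i%:R - a)%R by rewrite -natr1; ring.
have s0 : (0 < i.+1%:R - a)%R by rewrite subr_gt0 (lt_le_trans a1) // ler1n.
apply: (le_trans (gamma_int_step s0 H0)); rewrite E.
apply: (le_trans (lee_pmul _ _ (lexx _) IH)).
- by rewrite lee_fin mulr_ge0 // ltW.
- exact: gamma_int_ge0.
rewrite -EFinM lee_fin factS natrM.
have h := cesaroS (1 - a) i.
rewrite [leRHS](_ : _ = 3 / (1 - a) * H `^ (- a) * (H ^+ i.+2 * i`!%:R) *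
   (cesaro (1 - a) i.+1 * i.+1%:R))%R; last by ring.
rewrite h (exprS H i.+1) -natr1 le_eqVlt; apply/orP; left; apply/eqP; ring.
Qed.

End gamma_integrals.

(** * Changing the scale of Gamma averages *)

Section gamma_transform.
Context {R : realType}.
Implicit Types (h c B t : R) (g : R -> R).
Local Notation mu := (@lebesgue_measure R).

(** The average of g against the Gamma density of shape j + 1 and scale h;
    for the heat kernel this is the discrete Gaussian kernel of index j + 1. *)
Definition gamma_avg h (j : nat) g : R :=
  (h ^+ j.+1 * j`!%:R)^-1 * \int[mu]_(t in `]0, +oo[) (expR (- (t / h)) * t ^+ j * g t).

(** The class of time profiles to which Gamma averages are applied; the heat
    kernel at a fixed x <> 0 belongs to it, though not at x = 0. *)
Definition bounded_pos B g : Prop :=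
  measurable_fun setT g /\ forall t, 0 < t -> `|g t| <= B.

Lemma gamma_funX j h t : 0 < t -> gamma_fun j%:R h t = expR (- (t / h)) * t ^+ j.
Proof. by move=> t0; rewrite /gamma_fun powR_mulrn ?ltW // mulrC. Qed.

Lemma integrable_gamma_fun_nat j h : 0 < h -> mu.-integrable `]0, +oo[ (EFin \o gamma_fun j%:R h).
Proof.
move=> h0; apply/integrableP; split.
  by apply/measurable_EFinP; exact: measurable_gamma_fun.
under eq_integral do rewrite /= ger0_norm ?gamma_fun_ge0 //.
by rewrite -/(gamma_int _ _) gamma_int_nat // ltry.
Qed.

Lemma integrable_gamma_avg B g j h : 0 < h -> bounded_pos B g ->
  mu.-integrable `]0, +oo[ (EFin \o (fun t => expR (- (t / h)) * t ^+ j * g t)).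
Proof.
move=> h0 [mg gB].
have mf : measurable_fun setT (fun t => gamma_fun j%:R h t * g t).
  by apply: measurable_funM => //; exact: measurable_gamma_fun.
apply: (@eq_integrable _ _ _ mu _ _ (EFin \o (fun t => gamma_fun j%:R h t * g t))) => //.
  by move=> t; rewrite inE /= in_itv /= andbT => t0; rewrite gamma_funX.
apply: (@le_integrable _ _ _ mu _ _ _ (EFin \o (fun t => B * gamma_fun j%:R h t))) => //.
- by apply/measurable_EFinP; apply: measurable_funTS.
- move=> t; rewrite /= in_itv /= andbT => t0; rewrite lee_fin normrM mulrC.
  rewrite (normrM B). apply: ler_pM => //.
  by apply: (le_trans (gB t t0)); exact: ler_norm.
- exact: (integrableZl _ B (integrable_gamma_fun_nat j h0)).
Qed.

(** Times e^(- t/h), the partial sums of the densities whose averages are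
    summed in [series_gamma_avg]. *)
Definition exp_partial i c h (M : nat) t : R :=
  \sum_(j < M) 'C(j, i)%:R * (1 - c) ^+ (j - i) * c ^+ i.+1 * (h ^+ j.+1 * j`!%:R)^-1 * t ^+ j.

Lemma exp_partialE i c h M t : h != 0 ->
  exp_partial i c h M t =
  (c / h) ^+ i.+1 / i`!%:R * t ^+ i * series (exp_coeff ((1 - c) * t / h)) (M - i)%N.
Proof.
move=> h0; elim: M => [|M IH].
  by rewrite /exp_partial big_ord0 sub0n seriesEnat /= big_geq // mulr0.
rewrite /exp_partial big_ord_recr /= -/(exp_partial i c h M t) IH.
have [Mi|iM] := ltnP M i.
  rewrite bin_small // !mul0r addr0.
  by move: (Mi) (ltnW Mi); rewrite -!subn_eq0 => /eqP -> /eqP ->.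
rewrite subSn // !seriesEnat /= big_nat_recr //= mulrDr; congr (_ + _).
rewrite /exp_coeff /=.
set m := (M - i)%N; have -> : M = (i + m)%N by rewrite /m subnKC.
have f0 k : (k`!%:R : R) != 0 by rewrite pnatr_eq0 -lt0n fact_gt0.
have bE : 'C(i + m, i)%:R = (i + m)`!%:R / (i`!%:R * m`!%:R) :> R.
  apply: (canRL (mulfK _)); first by rewrite mulf_neq0.
  by rewrite -!natrM -[in RHS](@bin_fact (i + m) i) ?leq_addr // addKn mulnA.
rewrite bE !expr_div_n !exprMn -addnS !exprD.
have hi : h ^+ i != 0 by rewrite expf_neq0.
have hm : h ^+ m != 0 by rewrite expf_neq0.
rewrite !exprS; field.
by rewrite h0 hi hm !f0.
Qed.

Lemma series_exp_coeff_le (y : R) m : `|series (exp_coeff y) m| <= expR `|y|.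
Proof.
apply: (@le_trans _ _ (series (exp_coeff `|y|) m)).
  rewrite !seriesEnat /=; apply: (le_trans (ler_norm_sum _ _ _)).
  apply: ler_sum => k _; rewrite /exp_coeff /= normrM normrX normfV.
  by rewrite (ger0_norm (ler0n _ _)).
apply: nondecreasing_cvgn_le; last exact: is_cvg_series_exp_coeff.
by apply: nondecreasing_series => k _ _; exact: exp_coeff_ge0.
Qed.

Lemma cvg_exp_partial i c h t : h != 0 ->
  exp_partial i c h M t @[M --> \oo] -->
  (c / h) ^+ i.+1 / i`!%:R * t ^+ i * expR ((1 - c) * t / h).
Proof.
move=> h0; under eq_fun do rewrite exp_partialE //.
apply: cvgM; first exact: cvg_cst.
rewrite -(cvg_shiftn i) /=; under eq_fun do rewrite addnK.
exact: is_cvg_series_exp_coeff.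
Qed.

Lemma exp_partial_le i c h M t : 0 < h -> 0 < c -> 0 < t ->
  `|exp_partial i c h M t| <=
  (c / h) ^+ i.+1 / i`!%:R * t ^+ i * expR (`|1 - c| * t / h).
Proof.
move=> h0 c0 t0; rewrite exp_partialE ?gt_eqF // normrM ger0_norm; last first.
  by rewrite !mulr_ge0 ?exprn_ge0 ?divr_ge0 ?invr_ge0 // ltW.
apply: ler_wpM2l.
  by rewrite !mulr_ge0 ?exprn_ge0 ?divr_ge0 ?invr_ge0 // ltW.
apply: (le_trans (series_exp_coeff_le _ _)); rewrite ler_expR !normrM normfV.
by rewrite (gtr0_norm t0) (gtr0_norm h0).
Qed.

(** At the level of densities the series is an exponential series: the Gamma
    density of scale h times e^((1 - c) t / h) is, up to a constant, the one of
    scale h / c. The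
    exchange with the integral is dominated by e^(|1 - c| t / h - t / h), which
    decays exactly when 0 < c < 2. *)
Lemma series_gamma_avg B i c h g : 0 < h -> 0 < c < 2 -> bounded_pos B g ->
  series (fun j => 'C(j, i)%:R * (1 - c) ^+ (j - i) * c ^+ i.+1 * gamma_avg h j g) @ \oo -->
  gamma_avg (h / c) i g.
Proof.
move=> h0 /andP[c0 c2] gB; have [mg gle] := gB; have h_neq0 : h != 0 by rewrite gt_eqF.
have B0 : 0 <= B by exact: le_trans (gle 1 ltr01).
have e0 : 0 < 1 - `|1 - c| by rewrite subr_gt0 ltr_norml; apply/andP; split; lra.
pose K := (c / h) ^+ i.+1 / i`!%:R.
have K0 : 0 <= K by rewrite !mulr_ge0 ?exprn_ge0 ?divr_ge0 ?invr_ge0 // ltW.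
have SE M : series (fun j => 'C(j, i)%:R * (1 - c) ^+ (j - i) * c ^+ i.+1 * gamma_avg h j g) M =
    \int[mu]_(t in `]0, +oo[) (expR (- (t / h)) * exp_partial i c h M t * g t).
  have -> : \int[mu]_(t in `]0, +oo[) (expR (- (t / h)) * exp_partial i c h M t * g t) =
    \int[mu]_(t in `]0, +oo[) (\sum_(j < M) 'C(j, i)%:R * (1 - c) ^+ (j - i) * c ^+ i.+1 *
       (h ^+ j.+1 * j`!%:R)^-1 * (expR (- (t / h)) * t ^+ j * g t)).
    apply: eq_Rintegral => t _; rewrite /exp_partial mulr_sumr mulr_suml.
    by apply: eq_bigr => j _; ring.
  rewrite (@Rintegral_sum _ _ M (fun j t => 'C(j, i)%:R * (1 - c) ^+ (j - i) * c ^+ i.+1 *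
       (h ^+ j.+1 * j`!%:R)^-1 * (expR (- (t / h)) * t ^+ j * g t))) //; last first.
    by move=> j; exact: (integrableZl _ _ (integrable_gamma_avg j h0 gB)).
  rewrite seriesEord /=; apply: eq_bigr => j _.
  by rewrite RintegralZl //; [rewrite /gamma_avg mulrA|exact: integrable_gamma_avg gB].
rewrite (_ : series _ = (fun M => \int[mu]_(t in `]0, +oo[)
   (expR (- (t / h)) * exp_partial i c h M t * g t))); last exact/funext.
have limE : gamma_avg (h / c) i g = fine (\int[mu]_(t in `]0%R, +oo[)
    (expR (- (t / h)) * (K * t ^+ i * expR ((1 - c) * t / h)) * g t)%:E)%E.
  rewrite /gamma_avg -RintegralZl //; last first.
    by apply: integrable_gamma_avg gB; rewrite divr_gt0.
  congr fine; apply: eq_integral => t _; congr (_%:E).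
  have -> : (expR (- (t / (h / c))) = expR (- (t / h)) * expR ((1 - c) * t / h))%R.
    by rewrite -expRD; congr expR; field; rewrite h_neq0 gt_eqF.
  rewrite /K !expr_div_n; field.
  by rewrite !expf_neq0 ?(gt_eqF c0) // pnatr_eq0 -lt0n fact_gt0.
have limI : mu.-integrable `]0%R, +oo[
    (fun t => (expR (- (t / h)) * (K * t ^+ i * expR ((1 - c) * t / h)) * g t)%:E).
  apply: eq_integrable (integrableZl _ K (integrable_gamma_avg i (divr_gt0 h0 c0) gB)) => //.
  move=> t _ /=; rewrite -EFinM; congr (_%:E).
  have -> : (expR (- (t / (h / c))) = expR (- (t / h)) * expR ((1 - c) * t / h))%R.
    by rewrite -expRD; congr expR; field; rewrite h_neq0 gt_eqF.
  by ring.
have mE M : measurable_fun setT (exp_partial i c h M).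
  by apply: measurable_sum => j; apply: measurable_funM => //; exact: exprn_measurable.
have mexp (H : R) : measurable_fun setT (fun t : R => expR (- (t / H))).
  apply: measurableT_comp; first exact: measurable_expR.
  apply: measurableT_comp; first exact: oppr_measurable.
  exact: mulrr_measurable.
rewrite limE; apply: fine_cvg; rewrite fineK; last exact: integrable_fin_num.
apply: (@dominated_cvg _ _ _ mu `]0%R, +oo[ _ _ _
   (fun t => (B * K * gamma_fun i%:R (h / (1 - `|1 - c|)) t)%:E)) => //.
- move=> M; apply/measurable_EFinP; apply: measurable_funTS.
  by apply: measurable_funM => //; apply: measurable_funM; [exact: mexp|exact: mE].
- move=> t; rewrite /= in_itv /= andbT => t0.
  apply: cvg_EFin; first exact: nearW.
  apply: cvgM; last exact: cvg_cst.
  by apply: cvgM; [exact: cvg_cst|exact: cvg_exp_partial].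
- exact: (integrableZl _ (B * K) (integrable_gamma_fun_nat i (divr_gt0 h0 e0))).
- move=> M t; rewrite /= in_itv /= andbT => t0; rewrite lee_fin.
  rewrite !normrM (ger0_norm (expR_ge0 _)).
  apply: (@le_trans _ _ (expR (- (t / h)) * (K * t ^+ i * expR (`|1 - c| * t / h)) * B)).
    apply: ler_pM => //; last exact: gle.
    by apply: ler_wpM2l; [exact: expR_ge0|exact: exp_partial_le].
  rewrite gamma_funX //.
  have -> : (expR (- (t / (h / (1 - `|1 - c|)))) = expR (- (t / h)) * expR (`|1 - c| * t / h))%R.
    by rewrite -expRD; congr expR; field; rewrite h_neq0 gt_eqF.
  by rewrite le_eqVlt; apply/orP; left; apply/eqP; ring.
Qed.

Lemma cvg_sum_ord n (u : nat -> nat -> R) (l : nat -> R) :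
  (forall i, u i @ \oo --> l i) ->
  \sum_(i < n) u i M @[M --> \oo] --> \sum_(i < n) l i.
Proof.
move=> ul; elim: n => [|n IH].
  by under eq_fun do rewrite big_ord0; rewrite big_ord0; exact: cvg_cst.
under eq_fun do rewrite big_ord_recr /=.
by rewrite big_ord_recr /=; apply: cvgD.
Qed.

(** The inner sum over i is finite, so the series over j is a finite
    combination of the series summed by [series_gamma_avg]. *)
Lemma series_wright_gamma_avg B alpha r h n g : 0 < r < 1 -> 0 < h -> 0 < alpha < 1 ->
  h `^ (1 - alpha) < 2 -> bounded_pos B g ->
  series (fun j => wright r alpha (1 - alpha) h n j * gamma_avg h j g) @ \oo -->
  \sum_(i < n.+1) sib alpha n i * gamma_avg (h `^ alpha) i g.
Proof.
move=> r01 h0 al01 c2 gB; set c := h `^ (1 - alpha) in c2 *.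
have c0 : 0 < c by rewrite powR_gt0.
have hc : h / c = h `^ alpha.
  apply: (canLR (mulfK _)); first by rewrite gt_eqF.
  by rewrite -powRD ?(gt_eqF h0) ?implybT // addrC subrK powRr1 // ltW.
pose a i j := 'C(j, i)%:R * (1 - c) ^+ (j - i) * c ^+ i.+1 : R.
have E j : wright r alpha (1 - alpha) h n j = \sum_(i < n.+1) sib alpha n i * a i j.
  rewrite wright_sib // -/c mulr_sumr.
  rewrite -(@sum_ord_trunc _ (fun i => sib alpha n i * a i j) j n); last 2 first.
  - by move=> i ji; rewrite /a bin_small // !mul0r mulr0.
  - by move=> i ni; rewrite sib_small // mul0r.
  by apply: eq_bigr => i _; rewrite /a exprS; ring.
have -> : series (fun j => wright r alpha (1 - alpha) h n j * gamma_avg h j g) =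
   (fun M => \sum_(i < n.+1) sib alpha n i * series (fun j => a i j * gamma_avg h j g) M).
  apply/funext => M; rewrite seriesEnat /=.
  under eq_bigr do rewrite E mulr_suml.
  rewrite exchange_big /=; apply: eq_bigr => i _; rewrite mulr_sumr.
  by apply: eq_bigr => j _; rewrite -[LHS]mulrA.
apply: (@cvg_sum_ord n.+1 (fun i M => sib alpha n i * series (fun j => a i j * gamma_avg h j g) M)
  (fun i => sib alpha n i * gamma_avg (h `^ alpha) i g)) => i.
apply: cvgM; first exact: cvg_cst.
have c02 : 0 < c < 2 by rewrite c0.
by rewrite -hc; exact: (@series_gamma_avg B i c h g h0 c02 gB).
Qed.

End gamma_transform.

(** * Divergence of the defining series for large mesh size *)

Section divergence.
Context {R : realType}.
Local Notation mu := (@lebesgue_measure R).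

(** The inverse is s (s^2)^(-1), the inner inverse being a real power of a
    nonnegative number. *)
Lemma measurable_invr (D : set R) : measurable_fun D (@GRing.inv R).
Proof.
apply: measurable_funTS.
rewrite (_ : GRing.inv = fun x : R => x * (x ^+ 2) `^ (-1)); last first.
  apply/funext => x; rewrite powR_inv1 ?sqr_ge0 //.
  have [->|x0] := eqVneq x 0; first by rewrite invr0 mul0r.
  by rewrite exprS expr1 invfM mulVKf.
apply: measurable_funM => //.
apply: (measurableT_comp (measurable_powR _)); exact: exprn_measurable.
Qed.

(** With q = c / (1 - c), a Wright value is c (1 - c)^j times a polynomial in
    j of degree n, and |1 - c| >= 1. Its leading coefficient is nonzero, so by
    induction on n the products of g j with polynomials in j of every degree tend
    to 0. *)
Lemma cvg_wright_bin (alpha r h : R) (g : nat -> R) :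
  0 < r < 1 -> 0 < h -> 0 < alpha < 1 -> 2 <= h `^ (1 - alpha) ->
  (forall n, wright r alpha (1 - alpha) h n j * g j @[j --> \oo] --> (0 : R)) ->
  forall n, 'C(j, n)%:R * g j @[j --> \oo] --> (0 : R).
Proof.
move=> r01 h0 al01 c2 hg; set c := h `^ (1 - alpha) in c2.
have c0 : 0 < c by rewrite powR_gt0.
have c1 : 1 - c != 0 by rewrite subr_eq0 lt_eqF // (lt_le_trans _ c2) // ltr1n.
pose q := c / (1 - c).
have q0 : q != 0 by rewrite mulf_neq0 ?invr_eq0 // gt_eqF.
pose P n j := \sum_(i < n.+1) 'C(j, i)%:R * q ^+ i * sib alpha n i.
have E n j : wright r alpha (1 - alpha) h n j = c * (1 - c) ^+ j * P n j.
  rewrite wright_sib // -/c -mulrA; congr (_ * _); rewrite mulr_sumr.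
  rewrite (@sum_ord_trunc _ (fun i => 'C(j, i)%:R * (1 - c) ^+ (j - i) * c ^+ i * sib alpha n i) j n).
  - apply: eq_bigr => i _; have [ij|ji] := leqP i j; last first.
      by rewrite bin_small // !(mul0r, mulr0).
    have -> : (1 - c) ^+ j = (1 - c) ^+ (j - i) * (1 - c) ^+ i by rewrite -exprD subnK.
    by rewrite /q expr_div_n; field; rewrite expf_neq0.
  - by move=> i ji; rewrite bin_small // !mul0r.
  - by move=> i ni; rewrite sib_small // mulr0.
have Pg n : P n j * g j @[j --> \oo] --> (0 : R).
  have h1 : `|wright r alpha (1 - alpha) h n j * g j| @[j --> \oo] --> (0 : R).
    by apply/norm_cvg0P; exact: hg.
  apply/norm_cvg0P.
  have h2 : c^-1 * `|wright r alpha (1 - alpha) h n j * g j| @[j --> \oo] --> (0 : R).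
    by rewrite -[X in _ --> X](mulr0 c^-1); apply: cvgM => //; exact: cvg_cst.
  apply: (@squeeze_cvgr _ _ _ _ (fun=> 0) _ _ _ _ (cvg_cst _) h2).
  near=> j; rewrite normr_ge0 /= E !normrM (gtr0_norm c0) -!mulrA mulKf ?gt_eqF //.
  rewrite ler_peMl ?mulr_ge0 // normrX exprn_ege1 // ler_normr opprB; apply/orP; right; lra.
elim/ltn_ind => n IH.
have nz : q ^+ n * sib alpha n n != 0 by rewrite mulf_neq0 ?expf_neq0 // sib_diag_neq0.
have -> : (fun j => 'C(j, n)%:R * g j) = (fun j => (q ^+ n * sib alpha n n)^-1 *
   (P n j * g j - \sum_(i < n) (q ^+ i * sib alpha n i) * ('C(j, i)%:R * g j))).
  apply/funext => j; apply: (mulfI nz); rewrite mulVKf // /P big_ord_recr /= mulrDl mulr_suml.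
  rewrite [X in _ = X - _]addrC -addrA -sumrB big1 ?addr0; last by move=> i _; ring.
  by ring.
rewrite -[X in _ --> X](mulr0 (q ^+ n * sib alpha n n)^-1).
apply: cvgM; first exact: cvg_cst.
rewrite -[X in _ --> X](subr0 0); apply: cvgB; first exact: Pg.
pose u (i j : nat) : R := if (i < n)%N then (q ^+ i * sib alpha n i) * ('C(j, i)%:R * g j) else 0.
have uE j : \sum_(i < n) (q ^+ i * sib alpha n i) * ('C(j, i)%:R * g j) = \sum_(i < n) u i j.
  by apply: eq_bigr => i _; rewrite /u ltn_ord.
under eq_fun do rewrite uE.
have := @cvg_sum_ord _ n u (fun=> 0); rewrite big1 // => hu; apply: hu => i; rewrite /u.
have [lin|_] := boolP (i < n)%N; last exact: cvg_cst.
rewrite -[X in _ --> X](mulr0 (q ^+ i * sib alpha n i)).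
by apply: cvgM; [exact: cvg_cst|exact: IH].
Unshelve. all: by end_near. Qed.

End divergence.

Section gauss_in_time.
Context {R : realType} {N : nat}.
Implicit Types (x : N.-tuple R) (t h : R).
Local Notation mu := (@lebesgue_measure R).

Lemma gauss_kernel_ge0 t x : 0 <= gauss_kernel t x.
Proof. by rewrite mulr_ge0 ?powR_ge0 ?expR_ge0. Qed.

Lemma measurable_gauss_kernel_time x : measurable_fun setT (gauss_kernel^~ x).
Proof.
apply: measurable_funM.
  apply: (measurableT_comp (measurable_powR _)); exact: mulrl_measurable.
apply: (measurableT_comp (@measurable_expR R)).
apply: (measurableT_comp (@oppr_measurable R setT)).
apply: measurable_funM => //.
apply: (measurableT_comp (@measurable_invr R setT)); exact: mulrl_measurable.
Qed.

Lemma fourpi_ge1 : 1 <= 4 * pi :> R.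
Proof. by have := pi_ge2 R; lra. Qed.

(** Away from the origin the exponential factor beats the blow-up of
    t^(- N/2) as t tends to 0. *)
Lemma bounded_gauss_kernel x : 0 < enorm x -> exists B, bounded_pos B (gauss_kernel^~ x).
Proof.
move=> x0; pose a := enorm x ^+ 2 / 4.
have a0 : 0 < a by rewrite divr_gt0 // exprn_gt0.
exists (1 + (a ^+ N)^-1 * N%:R ^+ N); split; first exact: measurable_gauss_kernel_time.
move=> t t0; rewrite ger0_norm ?gauss_kernel_ge0 // /gauss_kernel.
have -> : enorm x ^+ 2 / (4 * t) = a / t by rewrite /a invfM mulrA.
have at0 : 0 < a / t by rewrite divr_gt0.
have e1 : expR (- (a / t)) <= 1 by rewrite -expR0 ler_expR oppr_le0 ltW.
have p0 : 0 < 4 * pi * t :> R by rewrite !mulr_gt0 ?pi_gt0.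
have C0 : 0 <= (a ^+ N)^-1 * N%:R ^+ N :> R.
  by rewrite mulr_ge0 ?invr_ge0 ?exprn_ge0 // ltW.
have N2 : 0 <= N%:R / 2 :> R by rewrite divr_ge0.
have [p1|p1] := leP 1 (4 * pi * t).
  apply: (@le_trans _ _ (1 * 1)); last by rewrite mulr1 lerDl.
  apply: ler_pM; rewrite ?powR_ge0 ?expR_ge0 //.
  by rewrite -[leRHS](powRr0 (4 * pi * t)); apply: ler_powR; rewrite // oppr_le0.
apply: (@le_trans _ _ ((a ^+ N)^-1 * N%:R ^+ N)); last by rewrite lerDr.
apply: (@le_trans _ _ ((t ^+ N)^-1 * expR (- (a / t)))).
  rewrite ler_wpM2r ?expR_ge0 //.
  apply: (@le_trans _ _ ((4 * pi * t) `^ (- N%:R))).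
    apply: ger_powR; first by rewrite p0 ltW.
    by rewrite lerN2 ler_pdivrMr // ler_peMr // ler1n.
  rewrite powR_invn ?(ltW p0) // lef_pV2 ?posrE ?exprn_gt0 //.
  have tle : t <= 4 * pi * t by rewrite ler_peMl ?fourpi_ge1 // ltW.
  by rewrite lerXn2r ?nnegrE // ltW.
rewrite ler_pdivlMl ?exprn_gt0 // mulrA -expr_div_n.
by apply: exprX_expRN_le; exact: ltW.
Qed.

(** A lower bound by integer powers of t, whose Gamma averages are explicit.
    It is trivial for t <= |x|^2 / 4, where the left side is nonpositive; beyond,
    t >= 1, so that t^(- N) <= t^(- N/2). *)
Lemma gauss_kernel_ge x t : 1 <= enorm x ^+ 2 / 4 -> 0 < t ->
  ((4 * pi) ^+ N)^-1 * ((t ^+ N)^-1 - enorm x ^+ 2 / 4 * (t ^+ N.+1)^-1) <= gauss_kernel t x.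
Proof.
set a := enorm x ^+ 2 / 4 => a1 t0; rewrite /gauss_kernel.
have -> : enorm x ^+ 2 / (4 * t) = a / t by rewrite /a invfM mulrA.
have t_neq0 : t != 0 by rewrite gt_eqF.
have -> : (t ^+ N)^-1 - a * (t ^+ N.+1)^-1 = (t ^+ N)^-1 * (1 - a / t).
  by rewrite exprS invfM; ring.
have q0 : 0 < 4 * pi :> R by rewrite (lt_le_trans ltr01) // fourpi_ge1.
have p0 : 0 < 4 * pi * t :> R by rewrite mulr_gt0.
rewrite mulrA -invfM -exprMn.
have [ta|ta] := leP t a.
  apply: (@le_trans _ _ 0); last by rewrite mulr_ge0 ?powR_ge0 ?expR_ge0.
  rewrite mulr_ge0_le0 ?invr_ge0 ?exprn_ge0 ?(ltW p0) //.
  by rewrite subr_le0 ler_pdivlMr // mul1r.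
have t1 : 1 <= t by rewrite (le_trans a1) // ltW.
apply: ler_pM.
- by rewrite invr_ge0 exprn_ge0 // ltW.
- by rewrite subr_ge0 ler_pdivrMr // mul1r ltW.
- rewrite -powR_invn ?(ltW p0) //; apply: ler_powR.
    by rewrite -[leLHS]mulr1; apply: ler_pM => //; exact: fourpi_ge1.
  by rewrite lerN2 ler_pdivrMr // ler_peMr // ler1n.
- exact: expR_ge1Dx.
Qed.

Lemma enorm_const (s : R) : enorm [tuple s | i < N] ^+ 2 = N%:R * s ^+ 2.
Proof.
rewrite sqr_sqrtr; last by apply: sumr_ge0 => i _; exact: sqr_ge0.
under eq_bigr do rewrite tnth_mktuple.
by rewrite sumr_const card_ord mulr_natl.
Qed.

(** The binomial coefficient compensates the decay j^(- N) of the averaged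
    lower bound [gauss_kernel_ge] with a factor j to spare. *)
Lemma gamma_avg_gauss_ge h x m : 0 < h -> 1 <= enorm x ^+ 2 / 4 ->
  ((4 * pi) ^+ N)^-1 * (h ^+ N.+1 * (N.+1)`!%:R)^-1 * (m.+1%:R * h - enorm x ^+ 2 / 4) <=
  'C(m + N.+1, N.+1)%:R * gamma_avg h (m + N.+1) (gauss_kernel^~ x).
Proof.
move=> h0 a1; set a := enorm x ^+ 2 / 4 in a1 *.
have x0 : 0 < enorm x.
  rewrite lt_neqAle sqrtr_ge0 andbT; apply: contraTneq a1 => E.
  by rewrite /a -E expr0n mul0r -ltNge.
have [B gB] := bounded_gauss_kernel x0.
set g := gauss_kernel^~ x in gB *.
set C := ((4 * pi) ^+ N)^-1; set j := (m + N.+1)%N.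
have C0 : 0 <= C by rewrite invr_ge0 exprn_ge0 // (le_trans ler01) // fourpi_ge1.
have h_neq0 : h != 0 by rewrite gt_eqF.
pose F t := C * (gamma_fun m.+1%:R h t - a * gamma_fun m%:R h t).
have iG k : mu.-integrable `]0, +oo[ (EFin \o gamma_fun k%:R h).
  exact: integrable_gamma_fun_nat.
have iZ : mu.-integrable `]0, +oo[ (EFin \o (fun t => a * gamma_fun m%:R h t)).
  exact: (integrableZl _ a (iG m)).
have iB : mu.-integrable `]0, +oo[
    (EFin \o (fun t => gamma_fun m.+1%:R h t - a * gamma_fun m%:R h t)).
  exact: (integrableB _ (iG m.+1) iZ).
have iF : mu.-integrable `]0, +oo[ (EFin \o F) by exact: (integrableZl _ C iB).
have le1 : \int[mu]_(t in `]0, +oo[) F t <=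
   \int[mu]_(t in `]0, +oo[) (expR (- (t / h)) * t ^+ j * g t).
  apply: le_Rintegral => //; first exact: integrable_gamma_avg gB.
  move=> t; rewrite /= in_itv /= andbT => t0.
  have t_neq0 : t != 0 by rewrite gt_eqF.
  rewrite /F !gamma_funX //.
  have -> : C * (expR (- (t / h)) * t ^+ m.+1 - a * (expR (- (t / h)) * t ^+ m)) =
    expR (- (t / h)) * t ^+ j * (C * ((t ^+ N)^-1 - a * (t ^+ N.+1)^-1)).
    have -> : t ^+ j = t ^+ m * t ^+ N * t by rewrite /j exprD exprSr mulrA.
    by rewrite !exprSr; field; rewrite t_neq0 expf_neq0.
  by rewrite ler_wpM2l ?mulr_ge0 ?expR_ge0 ?exprn_ge0 ?(ltW t0) //; exact: gauss_kernel_ge.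
have FE : \int[mu]_(t in `]0, +oo[) F t = C * (m`!%:R * h ^+ m.+1 * (m.+1%:R * h - a)).
  have GE k : \int[mu]_(t in `]0, +oo[) gamma_fun k%:R h t = k`!%:R * h ^+ k.+1.
    by rewrite /Rintegral -/(gamma_int _ _) gamma_int_nat.
  by rewrite RintegralZl // RintegralB // RintegralZl // !GE factS natrM !exprS; ring.
rewrite /gamma_avg -/j.
have f0 k : (k`!%:R : R) != 0 by rewrite pnatr_eq0 -lt0n fact_gt0.
have bE : 'C(j, N.+1)%:R = j`!%:R / ((N.+1)`!%:R * m`!%:R) :> R.
  apply: (canRL (mulfK _)); first by rewrite mulf_neq0.
  by rewrite -!natrM -[in RHS](@bin_fact j N.+1) ?leq_addl // /j addnK mulnA.
apply: (@le_trans _ _ ('C(j, N.+1)%:R * ((h ^+ j.+1 * j`!%:R)^-1 * \int[mu]_(t in `]0, +oo[) F t))).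
  rewrite FE bE le_eqVlt; apply/orP; left; apply/eqP.
  have -> : h ^+ j.+1 = h ^+ m.+1 * h ^+ N.+1 by rewrite -exprD /j addSn.
  by field; rewrite !f0 !expf_neq0.
apply: ler_wpM2l => //; apply: ler_wpM2l => //.
by rewrite invr_ge0 mulr_ge0 // exprn_ge0 // ltW.
Qed.

End gauss_in_time.

(** * The fundamental solution as a mixture of Gamma averages *)

Section fundamental_solution.
Context {R : realType} {N : nat}.

(** For c >= 2, convergence at the point x would make the terms tend to 0, hence
    by [cvg_wright_bin] also the averages times binomial coefficients of any
    degree, against [gamma_avg_gauss_ge]. *)
Lemma fundamental_solution_powR_lt2 (r alpha h : R) (G : nat -> N.-tuple R -> R) :
  (0 < N)%N -> 0 < r < 1 -> 0 < h -> 0 < alpha < 1 ->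
  is_fundamental_solution r alpha h G -> h `^ (1 - alpha) < 2.
Proof.
move=> N0 r01 h0 al01 FG; rewrite ltNge; apply/negP => c2.
(* The point (2, ..., 2) has |x|^2 / 4 = N >= 1, as [gamma_avg_gauss_ge]
   requires. *)
pose x : N.-tuple R := [tuple 2 | i < N].
have xE : enorm x ^+ 2 / 4 = N%:R by rewrite enorm_const; field.
have N1 : 1 <= N%:R :> R by rewrite ler1n.
have x0 : 0 < enorm x.
  rewrite lt_neqAle sqrtr_ge0 andbT; apply: contraTneq N1 => E.
  by rewrite -xE -E expr0n mul0r -ltNge.
pose g j := gamma_avg h j (gauss_kernel^~ x).
have hg n : wright r alpha (1 - alpha) h n j * g j @[j --> \oo] --> (0 : R).
  apply: cvg_series_cvg_0; apply/cvg_ex; exists (G n.+1 x).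
  exact: (FG n.+1 x).
have hN : 'C(j, N.+1)%:R * g j @[j --> \oo] --> (0 : R).
  exact: (cvg_wright_bin r01 h0 al01 c2 hg).
have {}hN : 'C(m + N.+1, N.+1)%:R * g (m + N.+1)%N @[m --> \oo] --> (0 : R).
  by have := hN; rewrite -(cvg_shiftn N.+1).
pose K : R := ((4 * pi) ^+ N)^-1 * (h ^+ N.+1 * (N.+1)`!%:R)^-1.
have K0 : 0 < K.
  rewrite mulr_gt0 ?invr_gt0 ?exprn_gt0 ?mulr_gt0 ?exprn_gt0 ?ltr0n ?fact_gt0 //.
  exact: pi_gt0.
have : \forall m \near \oo, 'C(m + N.+1, N.+1)%:R * g (m + N.+1)%N < K.
  exact: (cvgr_lt _ hN).
move=> [m0 _ hm].
pose m := maxn m0 (Num.trunc ((N%:R + 1) / h)).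
have := hm m (leq_maxl _ _); apply/negP; rewrite -leNgt.
apply: le_trans (gamma_avg_gauss_ge m h0 _); rewrite xE //.
rewrite -/K -[leLHS]mulr1 ler_pM2l // lerBrDl -ler_pdivrMr //.
have := truncnS_gt ((N%:R + 1) / h) => /ltW h1; apply: (le_trans h1).
by rewrite ler_nat ltnS leq_maxr.
Qed.

(** A finite sum with nonnegative weights, from which all estimates are
    drawn. *)
Lemma fundamental_solutionE (r alpha h : R) (G : nat -> N.-tuple R -> R) :
  (0 < N)%N -> 0 < r < 1 -> 0 < h -> 0 < alpha < 1 ->
  is_fundamental_solution r alpha h G ->
  forall n x, 0 < enorm x ->
  G n.+1 x = \sum_(i < n.+1) sib alpha n i * gamma_avg (h `^ alpha) i (gauss_kernel^~ x).
Proof.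
move=> N0 r01 h0 al01 FG n x x0.
have c2 := fundamental_solution_powR_lt2 N0 r01 h0 al01 FG.
have [B gB] := bounded_gauss_kernel x0.
have h1 := FG n.+1 x (ltn0Sn _) x0.
apply: (cvg_unique _ h1) => //.
exact: (series_wright_gamma_avg r01 h0 al01 c2 gB).
Qed.

End fundamental_solution.

(** * Negative moments of the mixing density *)

Section mixing_density.
Context {R : realType}.
Variable alpha : R.
Hypothesis alpha01 : 0 < alpha < 1.
Implicit Types (H h t a : R).
Local Notation mu := (@lebesgue_measure R).

Definition mix_density H n t : R :=
  \sum_(i < n.+1) sib alpha n i * (H ^+ i.+1 * i`!%:R)^-1 * (expR (- (t / H)) * t ^+ i).

Lemma mix_density_ge0 H n t : 0 < H -> 0 <= t -> 0 <= mix_density H n t.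
Proof.
move=> H0 t0; apply: sumr_ge0 => i _.
by rewrite !mulr_ge0 ?sib_ge0 ?invr_ge0 ?mulr_ge0 ?exprn_ge0 ?expR_ge0 ?(ltW H0).
Qed.

Lemma measurable_mix_density H n (D : set R) : measurable_fun D (mix_density H n).
Proof.
apply: measurable_funTS; apply: measurable_sum => i; apply: measurable_funM => //.
apply: measurable_funM; last exact: exprn_measurable.
apply: (measurableT_comp (@measurable_expR R)).
apply: (measurableT_comp (@oppr_measurable R setT)).
exact: mulrr_measurable.
Qed.

Let mix_densityM H n (g : R -> R) t : mix_density H n t * g t =
  \sum_(i < n.+1) sib alpha n i * (H ^+ i.+1 * i`!%:R)^-1 * (expR (- (t / H)) * t ^+ i * g t).
Proof. by rewrite mulr_suml; apply: eq_bigr => i _; rewrite -!mulrA. Qed.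

Lemma integrable_mix_density B H n g : 0 < H -> bounded_pos B g ->
  mu.-integrable `]0, +oo[ (EFin \o (fun t => mix_density H n t * g t)).
Proof.
move=> H0 gB.
rewrite (_ : _ \o _ = (fun t => \sum_(i < n.+1)
   (sib alpha n i * (H ^+ i.+1 * i`!%:R)^-1 * (expR (- (t / H)) * t ^+ i * g t))%:E)%E); last first.
  by apply/funext => t; rewrite /= mix_densityM sumEFin.
apply: integrable_sum => // i _.
exact: (integrableZl _ _ (integrable_gamma_avg i H0 gB)).
Qed.

Lemma sum_sib_gamma_avg B H n g : 0 < H -> bounded_pos B g ->
  \sum_(i < n.+1) sib alpha n i * gamma_avg H i g =
  \int[mu]_(t in `]0, +oo[) (mix_density H n t * g t).
Proof.
move=> H0 gB; under eq_Rintegral do rewrite mix_densityM.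
rewrite (@Rintegral_sum _ _ n.+1 (fun i t => sib alpha n i * (H ^+ i.+1 * i`!%:R)^-1 *
    (expR (- (t / H)) * t ^+ i * g t))) //; last first.
  by move=> i; exact: (integrableZl _ _ (integrable_gamma_avg i H0 gB)).
apply: eq_bigr => i _; rewrite RintegralZl //; last exact: integrable_gamma_avg gB.
by rewrite /gamma_avg mulrA.
Qed.

Local Open Scope ereal_scope.

(** The Cesaro numbers of [gamma_int_le] are summed by [sum_sib_cesaro] with
    d = 1 - a. *)
Lemma mix_density_moment H n a : (0 <= a < 1)%R -> (0 < H)%R ->
  \int[mu]_(t in `]0%R, +oo[) (mix_density H n t * t `^ (- a))%:E <=
  (3 / (1 - a) * H `^ (- a) * cesaro (1 - alpha * a) n)%:E.
Proof.
move=> a01 H0; pose w i := (sib alpha n i * (H ^+ i.+1 * i`!%:R)^-1)%R.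
have w0 i : (0 <= w i)%R.
  by rewrite !mulr_ge0 ?sib_ge0 ?invr_ge0 ?mulr_ge0 ?exprn_ge0 ?(ltW H0).
have -> : \int[mu]_(t in `]0%R, +oo[) (mix_density H n t * t `^ (- a))%:E =
  \int[mu]_(t in `]0%R, +oo[) \sum_(i <- index_enum 'I_n.+1) ((w i)%:E * (gamma_fun (i%:R - a) H t)%:E).
  apply: eq_integral => t; rewrite inE /= in_itv /= andbT => t0.
  rewrite (mix_densityM H n (fun s => s `^ (- a))%R t) -sumEFin; apply: eq_bigr => i _; rewrite -EFinM; congr (_%:E).
  by rewrite /gamma_fun powRD ?(gt_eqF t0) ?implybT // powR_mulrn ?(ltW t0) // /w; ring.
have mg s (D : set (measurableTypeR R)) : measurable_fun D (fun t => (gamma_fun s H t)%:E).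
  by apply/measurable_EFinP; exact: measurable_gamma_fun.
have g0 s t : 0 <= (gamma_fun s H t)%:E by rewrite lee_fin gamma_fun_ge0.
rewrite ge0_integral_sum //; last 2 first.
- by move=> i; apply: emeasurable_funM.
- by move=> i t _; rewrite mule_ge0 // lee_fin.
apply: (@le_trans _ _ (\sum_(i < n.+1) (w i * (3 / (1 - a) * H `^ (- a) *
    (H ^+ i.+1 * i`!%:R) * cesaro (1 - a) i))%:E)).
  apply: lee_sum => i _; rewrite ge0_integralZl_EFin // [leRHS]EFinM.
  by apply: lee_wpmul2l; [rewrite lee_fin|exact: gamma_int_le].
rewrite sumEFin lee_fin.
have -> : (1 - alpha * a = 1 - alpha + alpha * (1 - a))%R by ring.
rewrite -(sum_sib_cesaro alpha) mulr_sumr; apply: ler_sum => i _; rewrite /w.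
have f0 : (i`!%:R : R) != 0%R by rewrite pnatr_eq0 -lt0n fact_gt0.
have Hi : (H ^+ i.+1 != 0)%R by rewrite expf_neq0 // gt_eqF.
rewrite le_eqVlt; apply/orP; left; apply/eqP; field.
have a1 : (1 - a != 0)%R by case/andP: a01 => _ a1; rewrite subr_eq0 gt_eqF.
by rewrite f0 Hi a1.
Qed.

(** The powers of h and of n combine into a power of the elapsed time
    (n + 1) h, so the constant does not depend on h. *)
Lemma mix_density_moment_le h n a : (0 <= a < 1)%R -> (0 < h)%R ->
  \int[mu]_(t in `]0%R, +oo[) (mix_density (h `^ alpha) n t * t `^ (- a))%:E <=
  (3 / (1 - a) * (n.+1%:R * h) `^ (- (alpha * a)))%:E.
Proof.
move=> a01 h0; have [a0 a1] := andP a01; have [al0 al1] := andP alpha01.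
have H0 : (0 < h `^ alpha)%R by rewrite powR_gt0.
apply: (le_trans (mix_density_moment n a01 H0)); rewrite lee_fin.
have -> : ((h `^ alpha) `^ (- a) = h `^ (- (alpha * a)))%R.
  by rewrite -powRrM mulrN.
have d0 : (0 <= 3 / (1 - a) * h `^ (- (alpha * a)))%R.
  by rewrite !mulr_ge0 ?powR_ge0 // invr_ge0 subr_ge0 ltW.
rewrite (powRM _ (ler0n _ _) (ltW h0)) [(n.+1%:R `^ _ * _)%R]mulrC [leRHS]mulrA.
apply: ler_wpM2l => //; apply: cesaro_le_powR; rewrite mulr_ge0 ?(ltW al0) //=.
by rewrite -[leRHS]mulr1 ler_pM // ltW.
Qed.

End mixing_density.

(** * Differences of shifted heat kernels *)

Section euclid.
Context {R : realType} {N : nat}.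
Implicit Types x y : N.-tuple R.

Lemma enorm_ge0 x : 0 <= enorm x.
Proof. exact: sqrtr_ge0. Qed.

Lemma enorm_sqr x : enorm x ^+ 2 = \sum_(i < N) tnth x i ^+ 2.
Proof. by rewrite sqr_sqrtr // sumr_ge0 // => i _; exact: sqr_ge0. Qed.

(** From the nonnegative sum of squares of |y|^2 x - (x . y) y. *)
Lemma cauchy_schwarz x y :
  `|\sum_(i < N) tnth x i * tnth y i| <= enorm x * enorm y.
Proof.
set B := \sum_(i < N) _.
have [y0|y_gt0] := leP (enorm y) 0.
  have : \sum_(i < N) tnth y i ^+ 2 = 0.
    by rewrite -enorm_sqr; apply/eqP; rewrite sqrf_eq0 eq_le y0 enorm_ge0.
  move/eqP; rewrite psumr_eq0; last by move=> i _; exact: sqr_ge0.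
  move=> /allP h; have -> : B = 0.
    apply: big1 => i _; have := h i (mem_index_enum _).
    by rewrite sqrf_eq0 => /eqP ->; rewrite mulr0.
  by rewrite normr0 mulr_ge0 ?enorm_ge0.
have C0 : 0 < enorm y ^+ 2 by rewrite exprn_gt0.
rewrite -(@ler_pXn2r _ 2) ?nnegrE ?mulr_ge0 ?enorm_ge0 ?normr_ge0 //.
rewrite real_normK ?num_real // exprMn -(ler_pM2r C0).
have : 0 <= \sum_(i < N) (enorm y ^+ 2 * tnth x i - B * tnth y i) ^+ 2.
  by apply: sumr_ge0 => i _; exact: sqr_ge0.
have key (b e : R) : \sum_(i < N) (e * tnth x i - b * tnth y i) ^+ 2 =
   e * e * (\sum_(i < N) tnth x i ^+ 2)
   - 2 * e * b * (\sum_(i < N) tnth x i * tnth y i)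
   + b ^+ 2 * (\sum_(i < N) tnth y i ^+ 2).
  by rewrite !mulr_sumr -sumrB -big_split /=; apply: eq_bigr => i _; ring.
rewrite key -!enorm_sqr -/B => h.
rewrite -subr_ge0; apply: le_trans h _; rewrite le_eqVlt; apply/orP; left; apply/eqP; ring.
Qed.

Lemma enorm_sub x y : `|enorm (tuple_sub x y) - enorm x| <= enorm y.
Proof.
have sE : enorm (tuple_sub x y) ^+ 2 =
    enorm x ^+ 2 - 2 * (\sum_(i < N) tnth x i * tnth y i) + enorm y ^+ 2.
  rewrite !enorm_sqr mulr_sumr -sumrB -big_split /=; apply: eq_bigr => i _.
  by rewrite tnth_mktuple; ring.
have := cauchy_schwarz x y; rewrite ler_norml => /andP[c1 c2].
have x0 := enorm_ge0 x; have y0 := enorm_ge0 y; have s0 := enorm_ge0 (tuple_sub x y).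
have up : enorm (tuple_sub x y) <= enorm x + enorm y.
  by rewrite -(@ler_pXn2r _ 2) ?nnegrE ?addr_ge0 // sE; nra.
have lo : enorm x - enorm y <= enorm (tuple_sub x y).
  have [xy|xy] := leP (enorm x) (enorm y); first by rewrite (le_trans _ s0) // subr_le0.
  have d0 : 0 <= enorm x - enorm y by rewrite subr_ge0 ltW.
  by rewrite -(@ler_pXn2r _ 2) ?nnegrE // sE; nra.
by rewrite ler_norml; apply/andP; split; lra.
Qed.

End euclid.

Section gauss_difference.
Context {R : realType}.

(** By the mean value theorem, as s e^(- s^2 / 2) <= 1: half of the
    exponent absorbs the factor s. *)
Lemma expR_sqr_diff (a b : R) : 0 <= a -> 0 <= b ->
  `|expR (- a ^+ 2) - expR (- b ^+ 2)| <=
  Num.min 1 (2 * `|a - b|) * (expR (- (a ^+ 2 / 2)) + expR (- (b ^+ 2 / 2))).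
Proof.
wlog ab : a b / a <= b => [hw a0 b0|a0 b0].
  have [/hw|/ltW/hw] := leP a b; first exact.
  by move=> h; rewrite distrC (distrC a) [X in _ <= _ * X]addrC; exact: h.
(* This settles the first term of the minimum. *)
have half (s : R) : expR (- s ^+ 2) <= expR (- (s ^+ 2 / 2)).
  by rewrite ler_expR lerN2 ler_pdivrMr // ler_peMr ?sqr_ge0 // ler1n.
have le1 : expR (- b ^+ 2) <= expR (- a ^+ 2).
  by rewrite ler_expR lerN2 ler_sqr ?nnegrE.
rewrite ger0_norm ?subr_ge0 //.
have E0 (s : R) : 0 < expR s by exact: expR_gt0.
rewrite minEle; case: ifP => _.
  rewrite mul1r; have := half a; have := E0 (- (b ^+ 2 / 2)); have := E0 (- b ^+ 2); lra.
move: ab; rewrite le_eqVlt => /predU1P[<-|ab].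
  by rewrite !subrr normr0 mulr0 mul0r.
have dE (s : R) : has_deriv (fun s => expR (- s ^+ 2)) s (expR (- s ^+ 2) * - (2 * s)).
  apply: has_deriv_eq.
    apply: (@has_deriv_comp _ expR); first exact: is_derive_expR.
    by apply: has_derivN; apply: has_deriv_sqr; exact: has_deriv_id.
  by rewrite mulr1.
have [c|c] := @MVT _ _ _ _ _ ab (fun s _ => dE s).
  by apply: continuous_subspaceT => s; exact: has_deriv_continuous (dE s).
rewrite in_itv /= => /andP[ac cb] h.
have c0 : 0 <= c by rewrite ltW // (le_lt_trans a0).
have -> : expR (- a ^+ 2) - expR (- b ^+ 2) = 2 * (b - a) * (c * expR (- c ^+ 2)).
  by rewrite -opprB h; ring.
rewrite (distrC a) (ger0_norm (_ : 0 <= b - a)) ?subr_ge0 ?(ltW ab) //.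
apply: ler_wpM2l; first by rewrite mulr_ge0 // subr_ge0 ltW.
apply: (@le_trans _ _ (expR (- (a ^+ 2 / 2)))); last by rewrite lerDl ltW.
have -> : - c ^+ 2 = - (c ^+ 2 / 2) + - (c ^+ 2 / 2) by lra.
rewrite expRD mulrA.
have h1 : c * expR (- (c ^+ 2 / 2)) <= 1.
  rewrite expRN ler_pdivrMr // mul1r.
  by apply: le_trans (expR_ge1Dx _); have := sqr_ge0 (c - 1); nra.
have h2 : expR (- (c ^+ 2 / 2)) <= expR (- (a ^+ 2 / 2)).
  rewrite ler_expR lerN2 ler_pM2r ?invr_gt0 // ler_sqr ?nnegrE //; exact: ltW.
apply: (le_trans _ h2); rewrite ler_piMl //; exact: ltW.
Qed.

Context {N : nat}.
Implicit Types x y : N.-tuple R.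

(** The heat kernel with half the exponent; up to a constant it is the heat
    kernel at time 2 t. *)
Definition wide_gauss (t : R) x : R :=
  (4 * pi * t) `^ (- (N%:R / 2)) * expR (- (enorm x ^+ 2 / (8 * t))).

(** A bound for the relative variation of a heat kernel at time t under a shift by y,
    where sqrt t is the length scale. *)
Definition shift_modulus (t : R) y : R := Num.min 1 (enorm y / Num.sqrt t).

Lemma wide_gauss_ge0 t x : 0 <= wide_gauss t x.
Proof. by rewrite mulr_ge0 ?powR_ge0 ?expR_ge0. Qed.

Lemma shift_modulus_ge0 t y : 0 <= shift_modulus t y.
Proof. by rewrite le_min ler01 divr_ge0 ?enorm_ge0 ?sqrtr_ge0. Qed.

Lemma gauss_kernel_diff t x y : 0 < t ->
  `|gauss_kernel t (tuple_sub x y) - gauss_kernel t x| <=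
  shift_modulus t y * (wide_gauss t (tuple_sub x y) + wide_gauss t x).
Proof.
move=> t0; rewrite /gauss_kernel /wide_gauss -mulrBr -mulrDr normrM.
rewrite (ger0_norm (powR_ge0 _ _)) mulrCA; apply: ler_wpM2l; first exact: powR_ge0.
set s := Num.sqrt t; have s0 : 0 < s by rewrite sqrtr_gt0.
have tE : t = s ^+ 2 by rewrite sqr_sqrtr // ltW.
have E4 (z : N.-tuple R) : enorm z ^+ 2 / (4 * t) = (enorm z / (2 * s)) ^+ 2 :> R.
  by rewrite tE; field; rewrite gt_eqF.
have E8 (z : N.-tuple R) : enorm z ^+ 2 / (8 * t) = (enorm z / (2 * s)) ^+ 2 / 2 :> R.
  by rewrite tE; field; rewrite gt_eqF.
have p0 (z : N.-tuple R) : 0 <= enorm z / (2 * s) :> R.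
  by rewrite divr_ge0 ?enorm_ge0 // mulr_ge0 // ltW.
rewrite !E4 !E8; apply: (le_trans (expR_sqr_diff (p0 _) (p0 _))).
apply: ler_wpM2r; first by rewrite addr_ge0 ?expR_ge0.
rewrite /shift_modulus -/s -mulrBl normrM (@gtr0_norm _ (2 * s)^-1); last first.
  by rewrite invr_gt0 mulr_gt0.
have -> : 2 * (`|enorm (tuple_sub x y) - enorm x| * (2 * s)^-1) =
  `|enorm (tuple_sub x y) - enorm x| / s by field; rewrite gt_eqF.
rewrite le_min ge_min lexx /= ge_min; apply/orP; right.
by rewrite ler_pM2r ?invr_gt0 // enorm_sub.
Qed.

End gauss_difference.

(** * Gaussian integrals on R^N *)

Section tuple_measurability.
Context {R : realType} {N : nat}.

Lemma measurable_enorm : measurable_fun setT (@enorm R N).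
Proof.
apply: (@measurableT_comp _ _ _ _ _ _ (@Num.sqrt R) _ (fun x : N.-tuple R => \sum_(i < N) tnth x i ^+ 2)).
  by apply: continuous_measurable_fun; exact: sqrt_continuous.
apply: measurable_sum => i; apply: measurable_funX; exact: measurable_tnth.
Qed.

Lemma measurable_tuple_sub :
  measurable_fun setT (fun z : N.-tuple R * N.-tuple R => tuple_sub z.1 z.2).
Proof.
apply/measurable_fun_tnthP => i.
rewrite (_ : _ \o _ = fun z : N.-tuple R * N.-tuple R => tnth z.1 i - tnth z.2 i); last first.
  by apply/funext => z /=; rewrite tnth_mktuple.
apply: measurable_funB.
  by apply: (measurableT_comp (measurable_tnth i)); exact: measurable_fst.
by apply: (measurableT_comp (measurable_tnth i)); exact: measurable_snd.
Qed.

Context d (T : measurableType d).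
Implicit Types (s : T -> R) (v w : T -> N.-tuple R).

Lemma measurable_enorm_comp v : measurable_fun setT v -> measurable_fun setT (fun z => enorm (v z)).
Proof. by move=> mv; exact: (measurableT_comp measurable_enorm mv). Qed.

Lemma measurable_tuple_sub_comp v w : measurable_fun setT v -> measurable_fun setT w ->
  measurable_fun setT (fun z => tuple_sub (v z) (w z)).
Proof.
move=> mv mw.
exact: (measurableT_comp measurable_tuple_sub (measurable_fun_pair mv mw)).
Qed.

Lemma measurable_inv_comp s : measurable_fun setT s -> measurable_fun setT (fun z => (s z)^-1).
Proof. by move=> ms; exact: (measurableT_comp (@measurable_invr R setT) ms). Qed.

Lemma measurable_powR_comp s (p : R) : measurable_fun setT s -> measurable_fun setT (fun z => s z `^ p).
Proof. by move=> ms; exact: (measurableT_comp (measurable_powR p) ms). Qed.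

Let measurable_gauss_comp (c : R) s v : measurable_fun setT s -> measurable_fun setT v ->
  measurable_fun setT (fun z => (4 * pi * s z) `^ (- (N%:R / 2)) *
     expR (- (enorm (v z) ^+ 2 / (c * s z)))).
Proof.
move=> ms mv; apply: measurable_funM.
  by apply: measurable_powR_comp; exact: measurable_funM.
apply: (measurableT_comp (@measurable_expR R)).
apply: (measurableT_comp (@oppr_measurable R setT)).
apply: measurable_funM.
  by apply: measurable_funX; exact: measurable_enorm_comp.
by apply: measurable_inv_comp; exact: measurable_funM.
Qed.

Lemma measurable_gauss_kernel s v : measurable_fun setT s -> measurable_fun setT v ->
  measurable_fun setT (fun z => gauss_kernel (s z) (v z)).
Proof. exact: measurable_gauss_comp. Qed.

Lemma measurable_wide_gauss s v : measurable_fun setT s -> measurable_fun setT v ->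
  measurable_fun setT (fun z => wide_gauss (s z) (v z)).
Proof. exact: measurable_gauss_comp. Qed.

Lemma measurable_shift_modulus s v : measurable_fun setT s -> measurable_fun setT v ->
  measurable_fun setT (fun z => shift_modulus (s z) (v z)).
Proof.
move=> ms mv; apply: measurable_minr => //.
apply: measurable_funM; first exact: measurable_enorm_comp.
apply: measurable_inv_comp; apply: measurableT_comp ms.
by apply: continuous_measurable_fun; exact: sqrt_continuous.
Qed.

End tuple_measurability.

Section gauss_integrals.
Context {R : realType}.
Local Notation mu := (@lebesgue_measure R).
Local Open Scope ereal_scope.

Lemma integral_gauss1 (c y : R) : (0 < c)%R ->
  \int[mu]_s (expR (- (c * (s - y) ^+ 2)))%:E = (Num.sqrt (pi / c))%:E.
Proof.
move=> c0; pose sg : R := Num.sqrt (2 * c)^-1.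
have c2 : (0 < (2 * c)^-1)%R by rewrite invr_gt0 mulr_gt0.
have sg0 : (0 < sg)%R by rewrite sqrtr_gt0.
have sgE : (sg ^+ 2 = (2 * c)^-1)%R by rewrite sqr_sqrtr // ltW.
have sgn0 : sg != 0%R by rewrite gt_eqF.
have p0 := normal_peak_gt0 sgn0.
have E s : (expR (- (c * (s - y) ^+ 2)) = (normal_peak sg)^-1 * normal_pdf y sg s)%R.
  rewrite (normal_pdfE y sgn0) mulKf ?gt_eqF // /normal_fun sgE.
  by congr expR; field; rewrite gt_eqF.
under eq_integral do rewrite E EFinM.
rewrite ge0_integralZl_EFin //; last 3 first.
- by move=> s _; rewrite lee_fin normal_pdf_ge0.
- by apply/measurable_EFinP; exact: measurable_normal_pdf.
- by rewrite invr_ge0 ltW.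
rewrite integral_normal_pdf mule1 /normal_peak invrK sgE; congr (Num.sqrt _)%:E.
by field; rewrite gt_eqF.
Qed.

(** Tonelli's theorem, one coordinate at a time. *)
Lemma integral_tuple_prod N (k : 'I_N -> R -> R) :
  (forall i, measurable_fun setT (k i)) -> (forall i s, (0 <= k i s)%R) ->
  \int[lebesgueN N]_x (\prod_(i < N) k i (tnth x i))%:E =
  \prod_(i < N) \int[mu]_s (k i s)%:E.
Proof.
elim: N k => [|N IH] k mk k0.
  rewrite big_ord0 /=; under eq_integral do rewrite big_ord0.
  by rewrite integral_dirac // diracT mul1e.
have mP (I : finType) M (e : I -> 'I_M) (kk : I -> R -> R) : (forall i, measurable_fun setT (kk i)) ->
    measurable_fun setT (fun x : M.-tuple R => \prod_i kk i (tnth x (e i)))%R.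
  move=> mkk; apply: measurable_prod => i _.
  by apply: (measurableT_comp (mkk i)); exact: measurable_tnth.
rewrite big_ord_recl /= /cons_measure.
rewrite ge0_integral_pushforward //; last 3 first.
- exact: measurable_cons_pair.
- by apply/measurable_EFinP; exact: mP.
- by move=> x _; rewrite lee_fin prodr_ge0.
rewrite preimage_setT.
rewrite (_ : _ \o _ = fun z : R * N.-tuple R =>
    ((k ord0 z.1)%:E * (\prod_(i < N) k (lift ord0 i) (tnth z.2 i))%R%:E)); last first.
  apply/funext => z /=; rewrite big_ord_recl -EFinM; congr (_ * _)%:E.
  by apply: eq_bigr => i _; rewrite tnthS.
rewrite fubini_tonelli1 /fubini_F //=; last 2 first.
- apply: emeasurable_funM.
    by apply/measurable_EFinP; exact: (measurableT_comp (mk ord0) measurable_fst).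
  apply/measurable_EFinP.
  exact: (measurableT_comp (mP _ _ id _ (fun i => mk (lift ord0 i))) measurable_snd).
- by move=> z; rewrite mule_ge0 ?lee_fin ?prodr_ge0.
transitivity (\int[mu]_a ((k ord0 a)%:E * \prod_(i < N) \int[mu]_s (k (lift ord0 i) s)%:E)).
  apply: eq_integral => a _ /=; rewrite -IH // ge0_integralZl_EFin //.
  - by move=> v _; rewrite lee_fin prodr_ge0.
  - by apply/measurable_EFinP; exact: (mP _ _ id _ (fun i => mk (lift ord0 i))).
rewrite ge0_integralZr //.
- by apply/measurable_EFinP; exact: mk.
- by move=> a _; rewrite lee_fin.
- by apply: prode_ge0 => i _; apply: integral_ge0 => s _; rewrite lee_fin.
Qed.

Lemma integral_gaussN N (c : R) (y : N.-tuple R) : (0 < c)%R ->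
  \int[lebesgueN N]_x (expR (- (c * enorm (tuple_sub x y) ^+ 2)))%:E =
  (Num.sqrt (pi / c) ^+ N)%:E.
Proof.
move=> c0; pose k i s := expR (- (c * (s - tnth y i) ^+ 2)).
transitivity (\int[lebesgueN N]_x (\prod_(i < N) k i (tnth x i))%:E).
  apply: eq_integral => x _; rewrite /k -expR_sum enorm_sqr mulr_sumr -sumrN.
  by congr (expR _)%:E; apply: eq_bigr => i _; rewrite tnth_mktuple.
rewrite integral_tuple_prod; last 2 first.
- move=> i; apply: (measurableT_comp (@measurable_expR R)).
  apply: (measurableT_comp (@oppr_measurable R setT)).
  by apply: measurable_funM => //; apply: measurable_funX; exact: measurable_funB.
- by move=> i s; exact: expR_ge0.
rewrite (eq_bigr (fun=> (Num.sqrt (pi / c))%:E)); last by move=> i _; exact: integral_gauss1.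
by rewrite prodEFin big_const_ord iter_mulr_1.
Qed.

Section scaled_power.
Variables (N : nat) (p : R).
Hypothesis p_ge1 : (1 <= p)%R.

(** The exponent for which t ^ heat_rate times a Gaussian at time t has an L^p
    norm independent of t. *)
Definition heat_rate : R := (N%:R / 2 * (1 - p^-1))%R.

Definition heat_const : R :=
  ((4 * pi) `^ (- (N%:R / 2) * p) * (pi * 8 / p) `^ (N%:R / 2))%R.

Lemma integral_wide_gauss_powR (t : R) (y : N.-tuple R) : (0 < t)%R ->
  \int[lebesgueN N]_x ((t `^ heat_rate * wide_gauss t (tuple_sub x y)) `^ p)%:E =
  heat_const%:E.
Proof.
move=> t0; have p0 : (0 < p)%R by exact: lt_le_trans p_ge1.
(* The p-th power of the Gaussian is again a Gaussian. *)
pose c : R := (p / (8 * t))%R.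
have c0 : (0 < c)%R by rewrite divr_gt0 // mulr_gt0.
pose A : R := (t `^ (heat_rate * p) * (4 * pi * t) `^ (- (N%:R / 2) * p))%R.
transitivity (\int[lebesgueN N]_x (A%:E * (expR (- (c * enorm (tuple_sub x y) ^+ 2)))%:E)).
  apply: eq_integral => x _; rewrite -EFinM /wide_gauss; congr EFin.
  have wide_ge0 := wide_gauss_ge0 t (tuple_sub x y).
  rewrite powRM ?powR_ge0 // powRM ?powR_ge0 ?expR_ge0 // -!powRrM mulrA -/A.
  by rewrite -expRM; congr (_ * expR _)%R; rewrite /c; field; rewrite gt_eqF.
rewrite ge0_integralZl_EFin //; last 2 first.
- apply/measurable_EFinP; apply: (measurableT_comp (@measurable_expR R)).
  apply: (measurableT_comp (@oppr_measurable R setT)).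
  apply: measurable_funM => //; apply: measurable_funX; apply: measurable_enorm_comp.
  by apply: measurable_tuple_sub_comp => //; exact: measurable_cst.
- by rewrite mulr_ge0 ?powR_ge0.
rewrite integral_gaussN // -EFinM; congr EFin.
have pi0 := pi_gt0 R; have d0 : (0 <= pi * 8 / p :> R)%R by rewrite divr_ge0 ?mulr_ge0 ?(ltW p0) ?(ltW pi0).
rewrite -powR12_sqrt; last by rewrite divr_ge0 ?(ltW c0) ?(ltW pi0).
rewrite -powR_mulrn ?powR_ge0 // -powRrM.
have -> : (pi / c = pi * 8 / p * t)%R by rewrite /c; field; rewrite !gt_eqF.
rewrite /A /heat_const (powRM _ _ (ltW t0)) ?mulr_ge0 ?(ltW pi0) //.
rewrite (powRM _ d0 (ltW t0)).
have -> : (2^-1 * N%:R = N%:R / 2 :> R)%R by rewrite mulrC.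
set a := ((4 * pi) `^ _)%R; set b := ((pi * 8 / p) `^ _)%R.
have T : (t `^ (heat_rate * p) * t `^ (- (N%:R / 2) * p) * t `^ (N%:R / 2) = 1 :> R)%R.
  have tn0 : t != 0%R by rewrite gt_eqF.
  rewrite -!powRD; try by rewrite tn0 implybT.
  rewrite (_ : (_ + _)%R = 0%R) ?powRr0 //.
  by rewrite /heat_rate; field; rewrite gt_eqF.
by rewrite -[RHS]mulr1 -[X in (_ = _ * X)%R]T; ring.
Qed.

Lemma powR_add_le (a b : R) : (0 <= a)%R -> (0 <= b)%R ->
  ((a + b) `^ p <= 2 `^ p * (a `^ p + b `^ p))%R.
Proof.
move=> a0 b0; have p0 : (0 <= p)%R by exact: le_trans p_ge1.
wlog ab : a b a0 b0 / (a <= b)%R => [hw|].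
  by have [/hw|/ltW/hw] := leP a b; [exact|rewrite (addrC b) (addrC (b `^ p)%R); exact].
apply: (@le_trans _ _ ((2 * b) `^ p)%R).
  by apply: ge0_ler_powR; rewrite ?nnegrE ?addr_ge0 ?mulr_ge0 //; lra.
rewrite powRM //; apply: ler_wpM2l; first exact: powR_ge0.
by rewrite lerDr powR_ge0.
Qed.

(** The factor t ^ heat_rate is what is borrowed from the mixing density to
    make the L^p norm in x uniform in t. *)
Definition shift_weight (t : R) (y x : N.-tuple R) : R :=
  (t `^ heat_rate * (wide_gauss t (tuple_sub x y) + wide_gauss t x))%R.

Lemma integral_shift_weight_powR_le (t : R) (y : N.-tuple R) : (0 < t)%R ->
  \int[lebesgueN N]_x ((shift_weight t y x) `^ p)%:E <=
  (2 `^ p * (heat_const + heat_const))%:E.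
Proof.
move=> t0; have p0 : (0 < p)%R by exact: lt_le_trans p_ge1.
(* The unshifted term is the case of a zero shift. *)
pose z : N.-tuple R := [tuple 0%R | i < N].
have z0 x : tuple_sub x z = x.
  by apply: eq_from_tnth => i; rewrite !tnth_mktuple subr0.
pose F (v x : N.-tuple R) : R := ((t `^ heat_rate * wide_gauss t (tuple_sub x v)) `^ p)%R.
have mF v : measurable_fun setT (fun x => (F v x)%:E).
  apply/measurable_EFinP; apply: measurable_powR_comp; apply: measurable_funM => //.
  apply: measurable_wide_gauss => //.
  by apply: measurable_tuple_sub_comp => //; exact: measurable_cst.
have iF v : \int[lebesgueN N]_x (F v x)%:E = heat_const%:E.
  exact: integral_wide_gauss_powR.
have F0 v x : 0 <= (F v x)%:E by rewrite lee_fin powR_ge0.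
apply: (@le_trans _ _ (\int[lebesgueN N]_x ((2 `^ p)%:E * ((F y x)%:E + (F z x)%:E)))).
  apply: ge0_le_integral => //.
  - by move=> x _; rewrite lee_fin powR_ge0.
  - apply/measurable_EFinP; apply: measurable_powR_comp; apply: measurable_funM => //.
    apply: measurable_funD; apply: measurable_wide_gauss => //.
    by apply: measurable_tuple_sub_comp => //; exact: measurable_cst.
  - by apply: emeasurable_funM => //; exact: emeasurable_funD.
  - move=> x _; rewrite -EFinD -EFinM lee_fin /shift_weight mulrDr /F z0.
    by apply: powR_add_le; rewrite mulr_ge0 ?powR_ge0 ?wide_gauss_ge0.
rewrite ge0_integralZl_EFin ?powR_ge0 //; last 2 first.
- by move=> x _; rewrite adde_ge0.
- exact: emeasurable_funD.
rewrite ge0_integralD // EFinM; apply: lee_wpmul2l; first by rewrite lee_fin powR_ge0.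
rewrite EFinD; apply: leeD; rewrite le_eqVlt; apply/orP; left; apply/eqP; exact: iF.
Qed.
End scaled_power.

End gauss_integrals.

(** * Minkowski's integral inequality *)

Section integral_minkowski.
Local Open Scope ereal_scope.
Context d1 d2 (Z : measurableType d1) (X : measurableType d2) (R : realType).
Variables (p : R) (p_ge1 : (1 <= p)%R).

Let p_gt0 : (0 < p)%R. Proof. exact: lt_le_trans p_ge1. Qed.

(** Hoelder's inequality for a^(1/p) g and a^(1 - 1/p): Jensen's inequality
    for the unnormalised weight a. *)
Lemma poweR_integral_le (nu : {measure set Z -> \bar R}) (a g : Z -> R) :
  measurable_fun setT a -> measurable_fun setT g ->
  (forall z, (0 <= a z)%R) -> (forall z, (0 <= g z)%R) ->
  (\int[nu]_z (a z * g z)%:E) `^ p <=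
  (\int[nu]_z (a z)%:E) `^ (p - 1) * \int[nu]_z (a z * g z `^ p)%:E.
Proof.
move=> ma mg a0 g0.
have I0 (k : Z -> R) : (forall z, (0 <= k z)%R) -> 0 <= \int[nu]_z (k z)%:E.
  by move=> k0; apply: integral_ge0 => z _; rewrite lee_fin.
move: (p_ge1); rewrite le_eqVlt => /predU1P[<-|p1].
  rewrite subrr poweRe0 mul1e poweRe1 ?I0 //; last by move=> z; rewrite mulr_ge0.
  rewrite le_eqVlt; apply/orP; left; apply/eqP; apply: eq_integral => z _.
  by rewrite powRr1.
have p10 : (0 < p - 1)%R by rewrite subr_gt0.
(* The exponent conjugate to p. *)
pose q : R := (p / (p - 1))%R.
have q0 : (0 < q)%R by rewrite divr_gt0.
have pq : (p^-1 + q^-1 = 1)%R by rewrite /q; field; rewrite !gt_eqF.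
pose f1 z : R := (a z `^ p^-1 * g z)%R; pose f2 z : R := (a z `^ q^-1)%R.
have mf2 : measurable_fun setT f2 by exact: (measurableT_comp (measurable_powR _) ma).
have mf1 : measurable_fun setT f1.
  by apply: measurable_funM => //; exact: (measurableT_comp (measurable_powR _) ma).
have := hoelder nu mf1 mf2 p_gt0 q0 pq.
have N1 : 'N[nu]_1[EFin \o (f1 \* f2)%R] = \int[nu]_z (a z * g z)%:E.
  rewrite Lnorm.unlock invr1 poweRe1; last first.
    by apply: integral_ge0 => z _; exact: poweR_ge0.
  apply: eq_integral => z _ /=.
  rewrite ger0_norm; last by rewrite !mulr_ge0 ?powR_ge0.
  rewrite powRr1; last by rewrite !mulr_ge0 ?powR_ge0.
  rewrite /f1 /f2 mulrAC -powRD ?pq ?powRr1 //.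
  by rewrite oner_eq0.
have Np : 'N[nu]_p%:E[EFin \o f1] = (\int[nu]_z (a z * g z `^ p)%:E) `^ p^-1.
  rewrite Lnorm.unlock; congr (_ `^ _); apply: eq_integral => z _ /=.
  rewrite ger0_norm; last by rewrite mulr_ge0 ?powR_ge0.
  by rewrite powRM ?powR_ge0 // -powRrM mulVf ?gt_eqF // powRr1.
have Nq : 'N[nu]_q%:E[EFin \o f2] = (\int[nu]_z (a z)%:E) `^ q^-1.
  rewrite Lnorm.unlock; congr (_ `^ _); apply: eq_integral => z _ /=.
  rewrite ger0_norm; last by rewrite powR_ge0.
  by rewrite -powRrM mulVf ?gt_eqF // powRr1.
rewrite N1 Np Nq => H.
have I1 := I0 _ a0.
have I2 : 0 <= \int[nu]_z (a z * g z)%:E by apply: I0 => z; rewrite mulr_ge0.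
have I3 : 0 <= \int[nu]_z (a z * g z `^ p)%:E.
  by apply: I0 => z; rewrite mulr_ge0 ?powR_ge0.
apply: (@le_trans _ _ (((\int[nu]_z (a z * g z `^ p)%:E) `^ p^-1 *
    (\int[nu]_z (a z)%:E) `^ q^-1) `^ p)).
  apply: gt0_ler_poweR => //; first exact: ltW.
    by rewrite in_itv /= leey I2.
  by rewrite in_itv /= leey mule_ge0 ?poweR_ge0.
rewrite poweRM ?poweR_ge0 // -!poweRrM mulVf ?gt_eqF // poweRe1 // muleC.
by rewrite (_ : q^-1 * p = p - 1)%R // /q; field; rewrite !gt_eqF.
Qed.

(** Minkowski's integral inequality in the form used here: the L^p norm of an
    average of functions g z with weights a z is at most the total weight times
    the largest L^p norm. It is [poweR_integral_le] integrated in x by Tonelli's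
    theorem. *)
Lemma integral_poweR_le (nu : {sigma_finite_measure set Z -> \bar R})
    (m : {sigma_finite_measure set X -> \bar R})
    (a : Z -> R) (g : Z -> X -> R) (A D : R) :
  measurable_fun setT a -> measurable_fun setT (fun zx : Z * X => g zx.1 zx.2) ->
  (forall z, (0 <= a z)%R) -> (forall z x, (0 <= g z x)%R) ->
  (0 <= A)%R -> (0 <= D)%R ->
  \int[nu]_z (a z)%:E <= A%:E ->
  (forall z, a z != 0%R -> \int[m]_x (g z x `^ p)%:E <= D%:E) ->
  \int[m]_x ((\int[nu]_z (a z * g z x)%:E) `^ p) <= (A `^ p * D)%:E.
Proof.
move=> ma mg a0 g0 A0 D0 aA gD.
pose F (k : Z -> X -> R) (zx : Z * X) := (a zx.1 * k zx.1 zx.2)%:E.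
pose gp z x : R := (g z x `^ p)%R.
have gp0 z x : (0 <= gp z x)%R by exact: powR_ge0.
have mF (k : Z -> X -> R) : measurable_fun setT (fun zx : Z * X => k zx.1 zx.2) ->
    measurable_fun setT (F k).
  move=> mk; apply/measurable_EFinP; apply: measurable_funM => //.
  exact: (measurableT_comp ma measurable_fst).
have F0 (k : Z -> X -> R) : (forall z x, (0 <= k z x)%R) -> forall zx, 0 <= F k zx.
  by move=> k0 zx; rewrite lee_fin mulr_ge0.
have mgp : measurable_fun setT (fun zx : Z * X => gp zx.1 zx.2).
  exact: (measurableT_comp (measurable_powR p) mg).
have mG : measurable_fun setT (fun x => \int[nu]_z (a z * g z x)%:E).
  exact: (@measurable_fun_fubini_tonelli_G _ _ _ _ _ nu _ (mF _ mg) (F0 _ g0)).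
have mGp : measurable_fun setT (fun x => \int[nu]_z (a z * gp z x)%:E).
  exact: (@measurable_fun_fubini_tonelli_G _ _ _ _ _ nu _ (mF _ mgp) (F0 _ gp0)).
have I0 (k : Z -> R) : (forall z, (0 <= k z)%R) -> 0 <= \int[nu]_z (k z)%:E.
  by move=> k0; apply: integral_ge0 => z _; rewrite lee_fin.
have IG0 x : 0 <= \int[nu]_z (a z * gp z x)%:E by apply: I0 => z; rewrite mulr_ge0.
apply: (@le_trans _ _ (\int[m]_x ((A `^ (p - 1))%:E * \int[nu]_z (a z * gp z x)%:E))).
  apply: ge0_le_integral => //.
  - by move=> x _; exact: poweR_ge0.
  - exact: (measurableT_comp (measurable_poweR p) mG).
  - by apply: emeasurable_funM.
  - move=> x _; apply: le_trans (poweR_integral_le nu ma _ a0 (fun z => g0 z x)) _.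
      exact: (measurableT_comp mg (pair2_measurable x)).
    apply: lee_wpmul2r; first exact: IG0.
    rewrite -poweR_EFin; apply: gt0_ler_poweR => //; first by rewrite subr_ge0.
      by rewrite in_itv /= leey I0.
    by rewrite in_itv /= leey andbT lee_fin.
rewrite ge0_integralZl_EFin ?powR_ge0 //.
have -> : \int[m]_x \int[nu]_z (a z * gp z x)%:E = \int[nu]_z \int[m]_x (a z * gp z x)%:E.
  exact: (esym (@fubini_tonelli _ _ _ _ _ nu m _ (mF _ mgp) (F0 _ gp0))).
have mI : measurable_fun setT (fun z => \int[m]_x (a z * gp z x)%:E).
  exact: (@measurable_fun_fubini_tonelli_F _ _ _ _ _ m _ (mF _ mgp) (F0 _ gp0)).
apply: (@le_trans _ _ ((A `^ (p - 1))%:E * \int[nu]_z (D%:E * (a z)%:E))).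
  apply: lee_wpmul2l; first by rewrite lee_fin powR_ge0.
  apply: ge0_le_integral => //.
  - by move=> z _; apply: integral_ge0 => x _; rewrite lee_fin mulr_ge0.
  - by apply: emeasurable_funM => //; exact/measurable_EFinP.
  - move=> z _; have [->|az] := eqVneq (a z) 0%R.
      by under eq_integral do rewrite mul0r; rewrite integral0 mule0.
    under eq_integral do rewrite EFinM.
    rewrite ge0_integralZl_EFin //.
    + by rewrite muleC; apply: lee_wpmul2r; [rewrite lee_fin|exact: gD].
    + by move=> x _; rewrite lee_fin.
    + apply/measurable_EFinP.
      exact: (measurableT_comp mgp (pair1_measurable z)).
rewrite ge0_integralZl_EFin //; [|by move=> z _; rewrite lee_fin|exact/measurable_EFinP].
have -> : (A `^ p * D)%:E = (A `^ (p - 1))%:E * (D%:E * A%:E).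
  rewrite -!EFinM; congr EFin; rewrite mulrCA [RHS]mulrC; congr (_ * _)%R.
  rewrite -[X in (_ = _ * X)%R](powRr1 A0) -powRD ?subrK //.
  by rewrite (gt_eqF p_gt0).
apply: lee_wpmul2l; first by rewrite lee_fin powR_ge0.
by apply: lee_wpmul2l; rewrite ?lee_fin.
Qed.

End integral_minkowski.

(** * Mixing heat kernels in time *)

Section origin_null.
Context {R : realType} {N : nat}.
Hypothesis N_gt0 : (0 < N)%N.
Implicit Types x y : N.-tuple R.

Lemma enorm_eq0 x : enorm x = 0 -> forall i, tnth x i = 0.
Proof.
move=> x0 i; have : \sum_(i < N) tnth x i ^+ 2 = 0 by rewrite -enorm_sqr x0 expr0n.
move/eqP; rewrite psumr_eq0; last by move=> j _; exact: sqr_ge0.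
by move=> /allP/(_ i (mem_index_enum _)); rewrite sqrf_eq0 => /eqP.
Qed.

(** A point is a box with sides of measure 0, and there is at least one
    side. *)
Lemma ae_enorm_sub_gt0 x : {ae lebesgueN N, forall y, 0 < enorm (tuple_sub x y)}.
Proof.
pose A (i : 'I_N) : set R := [set tnth x i].
have mA i : measurable (A i) by exact: measurable_set1.
exists [set y : N.-tuple R | forall i, A i (tnth y i)]; split.
- rewrite (_ : [set y | _] = \bigcap_(i in [set: 'I_N]) ((@tnth _ R)^~ i @^-1` A i)).
    apply: fin_bigcap_measurable => // i _.
    by rewrite -[X in measurable X]setTI; exact: measurable_tnth.
  by apply/seteqP; split => v Hv i; [move=> _; exact: Hv|exact: (Hv i I)].
- rewrite (lebesgueN_box mA) (bigD1 (Ordinal N_gt0)) //= /A lebesgue_measure_set1.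
  by rewrite mul0e.
- move=> y /= /negP; rewrite -leNgt => h i; rewrite /A /=.
  have /enorm_eq0/(_ i) : enorm (tuple_sub x y) = 0.
    by apply/eqP; rewrite eq_le h enorm_ge0.
  by rewrite tnth_mktuple => /subr0_eq.
Qed.

Lemma ae_enorm_gt0 : {ae lebesgueN N, forall x, 0 < enorm x}.
Proof.
pose z : N.-tuple R := [tuple 0 | i < N].
apply: filterS (ae_enorm_sub_gt0 z) => x; rewrite /= /enorm.
congr (0 < Num.sqrt _); apply: eq_bigr => i _.
by rewrite !tnth_mktuple sub0r sqrrN.
Qed.

(** The value at the origin changes a function on a measurable singleton
    only. *)
Lemma measurable_off_origin (G K : N.-tuple R -> R) :
  measurable_fun setT K -> (forall x, 0 < enorm x -> G x = K x) ->
  measurable_fun setT G.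
Proof.
move=> mK GK; pose z : N.-tuple R := [tuple 0 | i < N].
pose O := [set x : N.-tuple R | enorm x = 0].
have mO : measurable O.
  rewrite -[X in measurable X]setTI.
  exact: (@measurable_enorm R N measurableT [set 0] (measurable_set1 (0 : R))).
rewrite (_ : G = fun x => K x + (G z - K z) * \1_O x).
  by apply: measurable_funD => //; apply: measurable_funM.
apply/funext => x; rewrite indicE; have := enorm_ge0 x.
rewrite le_eqVlt => /predU1P[x0|x0].
  rewrite mem_set // mulr1.
  have -> : x = z.
    by apply: eq_from_tnth => i; rewrite tnth_mktuple enorm_eq0.
  by ring.
rewrite memNset ?mulr0 ?addr0 ?GK //.
by move=> h; move: x0; rewrite h ltxx.
Qed.

End origin_null.

Section time_density.
Context {R : realType}.
Variables (alpha h : R) (n : nat).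
Hypotheses (alpha01 : 0 < alpha < 1) (h_gt0 : 0 < h).
Local Notation mu := (@lebesgue_measure R).
Local Notation mix := (mix_density alpha (h `^ alpha) n).

(** Extended by 0 to negative times, so as to be integrated over the whole
    line in products of measures. *)
Definition time_density (t : R) : R := mix t * \1_`]0, +oo[ t.

Let H_gt0 : 0 < h `^ alpha. Proof. exact: powR_gt0. Qed.

Lemma time_densityE t : 0 < t -> time_density t = mix t.
Proof. by move=> t0; rewrite /time_density indicE mem_set ?mulr1 //= in_itv /= t0. Qed.

Lemma time_density_eq0 t : t <= 0 -> time_density t = 0.
Proof.
move=> t0; rewrite /time_density indicE memNset ?mulr0 //=.
by rewrite in_itv /= andbT ltNge t0.
Qed.

Lemma time_density_ge0 t : 0 <= time_density t.
Proof.
by have [/time_density_eq0->|t0] := leP t 0 => //; rewrite time_densityE // mix_density_ge0 // ltW.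
Qed.

Lemma measurable_time_density : measurable_fun setT time_density.
Proof. by apply: measurable_funM => //; exact: measurable_mix_density. Qed.

Let time_density_restrict (g : R -> R) :
  (fun t => (time_density t * g t)%:E) = (fun t => (mix t * g t)%:E) \_ `]0, +oo[.
Proof.
apply/funext => t; rewrite patchE; case: ifPn => [|/negP] t0.
  by move: t0; rewrite inE /= in_itv /= andbT => t0; rewrite time_densityE.
rewrite time_density_eq0 ?mul0r // leNgt; apply/negP => t1; apply: t0.
by rewrite inE /= in_itv /= t1.
Qed.

Lemma integral_time_density (g : R -> R) :
  (\int[mu]_t (time_density t * g t)%:E =
   \int[mu]_(t in `]0%R, +oo[) (mix t * g t)%:E)%E.
Proof. by rewrite [RHS]integral_mkcond time_density_restrict. Qed.

Lemma integrable_time_density B g : bounded_pos B g ->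
  mu.-integrable setT (fun t => (time_density t * g t)%:E).
Proof.
move=> gB; rewrite time_density_restrict; rewrite -integrable_mkcond //.
exact: (integrable_mix_density alpha n H_gt0 gB).
Qed.

Lemma time_density_moment_le (a : R) : 0 <= a < 1 ->
  (\int[mu]_t (time_density t * t `^ (- a))%:E <=
   (3 / (1 - a) * (n.+1%:R * h) `^ (- (alpha * a)))%:E)%E.
Proof. by move=> a01; rewrite integral_time_density; exact: mix_density_moment_le. Qed.

End time_density.

Section spacetime.
Context {R : realType} {N : nat}.

(** A named copy of the product measure that carries its sigma-finiteness,
    obtained by transporting that of the Lebesgue measure in one more
    dimension. *)
Definition spacetime_measure : set (measurableTypeR R * N.-tuple R)%type -> \bar R :=
  (@lebesgue_measure R \x lebesgueN N)%E.

HB.instance Definition _ := Measure.on spacetime_measure.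

Let spacetime_sigma_finite : sigma_finite setT spacetime_measure.
Proof.
have [F TF Foo] := sigma_finiteT (@lebesgueN R N.+1).
exists (fun k => @cons_pair R N @^-1` F k).
  by rewrite -preimage_bigcup -TF preimage_setT.
move=> k; have [mF Fk] := Foo k; split => //.
by rewrite -[X in measurable X]setTI; exact: measurable_cons_pair.
Qed.

HB.instance Definition _ := Measure_isSigmaFinite.Build _ _ _ spacetime_measure
  spacetime_sigma_finite.

End spacetime.
Arguments spacetime_measure {R} N.

Section averaged_difference.
Context {R : realType} {N : nat}.
Variables (r alpha h : R) (G : nat -> N.-tuple R -> R) (n : nat).
Hypotheses (N_gt0 : (0 < N)%N) (r01 : 0 < r < 1) (h_gt0 : 0 < h) (alpha01 : 0 < alpha < 1).
Hypothesis GP : is_fundamental_solution r alpha h G.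
Local Notation mu := (@lebesgue_measure R).
Local Notation lebN := (@lebesgueN R N).
Local Notation rho := (time_density alpha h n).
Implicit Types x y : N.-tuple R.

Let H_gt0 : 0 < h `^ alpha. Proof. exact: powR_gt0. Qed.

Lemma integrable_mixed_gauss x : 0 < enorm x ->
  mu.-integrable setT (fun t => (rho t * gauss_kernel t x)%:E).
Proof.
by move=> x0; have [B gB] := bounded_gauss_kernel x0; exact: integrable_time_density gB.
Qed.

Lemma fundamental_solution_mixed x : 0 < enorm x ->
  G n.+1 x = fine (\int[mu]_t (rho t * gauss_kernel t x)%:E).
Proof.
move=> x0; have [B gB] := bounded_gauss_kernel x0.
rewrite (fundamental_solutionE N_gt0 r01 h_gt0 alpha01 GP n x0).
by rewrite (sum_sib_gamma_avg alpha n H_gt0 gB) integral_time_density.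
Qed.

(** The representation holds for x <> 0 only; the value at the origin is
    arbitrary. *)
Lemma measurable_fundamental_solution : measurable_fun setT (G n.+1).
Proof.
pose F (z : R * N.-tuple R) := (rho z.1 * gauss_kernel z.1 z.2)%:E.
apply: (@measurable_off_origin _ _ _ (fun x => fine (\int[mu]_t F (t, x)))); last first.
  exact: fundamental_solution_mixed.
have mF : measurable_fun setT F.
  apply/measurable_EFinP; apply: measurable_funM.
    by apply: (measurableT_comp (measurable_time_density _ _ _)); exact: measurable_fst.
  by apply: measurable_gauss_kernel; [exact: measurable_fst|exact: measurable_snd].
have F0 z : (0 <= F z)%E.
  by rewrite lee_fin mulr_ge0 ?gauss_kernel_ge0 // time_density_ge0.
apply: measurableT_comp; first exact: fine_measurable.
exact: (@measurable_fun_fubini_tonelli_G _ _ _ _ _ mu _ mF F0).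
Qed.

Definition mixed_difference x y : \bar R :=
  (\int[mu]_t (rho t * (shift_modulus t y *
     (wide_gauss t (tuple_sub x y) + wide_gauss t x)))%:E)%E.

Lemma mixed_difference_ge0 x y : (0 <= mixed_difference x y)%E.
Proof.
apply: integral_ge0 => t _; rewrite lee_fin mulr_ge0 ?time_density_ge0 //.
by rewrite mulr_ge0 ?shift_modulus_ge0 ?addr_ge0 ?wide_gauss_ge0.
Qed.

Lemma measurable_mixed_difference x : measurable_fun setT (mixed_difference x).
Proof.
pose F (z : R * N.-tuple R) := (rho z.1 * (shift_modulus z.1 z.2 *
     (wide_gauss z.1 (tuple_sub x z.2) + wide_gauss z.1 x)))%:E.
have mF : measurable_fun setT F.
  apply/measurable_EFinP; apply: measurable_funM.
    by apply: (measurableT_comp (measurable_time_density _ _ _)); exact: measurable_fst.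
  apply: measurable_funM.
    by apply: measurable_shift_modulus; [exact: measurable_fst|exact: measurable_snd].
  apply: measurable_funD; apply: measurable_wide_gauss => //; try exact: measurable_fst.
  by apply: measurable_tuple_sub_comp; [exact: measurable_cst|exact: measurable_snd].
have F0 z : (0 <= F z)%E.
  rewrite lee_fin mulr_ge0 ?time_density_ge0 //.
  by rewrite mulr_ge0 ?shift_modulus_ge0 ?addr_ge0 ?wide_gauss_ge0.
exact: (@measurable_fun_fubini_tonelli_G _ _ _ _ _ mu _ mF F0).
Qed.

(** Both points are away from the origin, where the two averages converge and
    can be subtracted under the integral sign. *)
Lemma fundamental_solution_diff x y : 0 < enorm x -> 0 < enorm (tuple_sub x y) ->
  (`|G n.+1 (tuple_sub x y) - G n.+1 x|%:E <= mixed_difference x y)%E.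
Proof.
move=> x0 xy0; have i1 := integrable_mixed_gauss x0; have i2 := integrable_mixed_gauss xy0.
rewrite !fundamental_solution_mixed //.
rewrite -fineB ?integrable_fin_num // -integralB //.
have iB := integrableB measurableT i2 i1.
rewrite -abse_EFin fineK ?integrable_fin_num //.
apply: (le_trans (le_abse_integral _ _ _)) => //; first by case/integrableP : iB.
have md : measurable_fun setT (fun t => (rho t * (shift_modulus t y *
     (wide_gauss t (tuple_sub x y) + wide_gauss t x)))%:E).
  apply/measurable_EFinP; apply: measurable_funM; first exact: measurable_time_density.
  apply: measurable_funM; first by apply: measurable_shift_modulus.
  by apply: measurable_funD; apply: measurable_wide_gauss.
apply: ge0_le_integral => //.
- by apply: measurableT_comp => //; case/integrableP : iB.
- move=> t _ /=; rewrite lee_fin -mulrBr normrM ger0_norm ?time_density_ge0 //.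
  have [t0|t0] := leP t 0; first by rewrite time_density_eq0 // !mul0r.
  by apply: ler_wpM2l; [exact: time_density_ge0|exact: gauss_kernel_diff].
Qed.

End averaged_difference.

(** * The L^p bound *)

Section minkowski_bound.
Context {R : realType} {N : nat}.
Variables (r alpha h p : R) (G : nat -> N.-tuple R -> R) (n : nat).
Hypotheses (N_gt0 : (0 < N)%N) (r01 : 0 < r < 1) (h_gt0 : 0 < h) (alpha01 : 0 < alpha < 1).
Hypothesis p_ge1 : 1 <= p.
Hypothesis GP : is_fundamental_solution r alpha h G.
Variables (f : N.-tuple R -> R) (f_L1 : (lebesgueN N).-integrable setT (EFin \o f)).
Local Notation mu := (@lebesgue_measure R).
Local Notation lebN := (@lebesgueN R N).
Local Notation rho := (time_density alpha h n).
Local Notation gam := (heat_rate N p).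
Implicit Types x y : N.-tuple R.

Let measurable_f : measurable_fun setT f.
Proof. by apply/measurable_EFinP; case/integrableP : f_L1. Qed.

(** The weight of the pair (t, y) in Minkowski's inequality; the last factor
    undoes that of [shift_weight]. *)
Definition pair_weight (z : R * N.-tuple R) : R :=
  rho z.1 * (`|f z.2| * shift_modulus z.1 z.2) * z.1 `^ (- gam).

Lemma pair_weight_ge0 z : 0 <= pair_weight z.
Proof.
apply: mulr_ge0; last exact: powR_ge0; apply: mulr_ge0; first exact: time_density_ge0.
by rewrite mulr_ge0 ?shift_modulus_ge0.
Qed.

Lemma measurable_pair_weight : measurable_fun setT pair_weight.
Proof.
have mf2 : measurable_fun setT (fun z : R * N.-tuple R => `|f z.2|).
  apply: (measurableT_comp (@normr_measurable R setT)).
  exact: (measurableT_comp measurable_f measurable_snd).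
apply: measurable_funM; last first.
  by apply: measurable_powR_comp; exact: measurable_fst.
apply: measurable_funM.
  by apply: (measurableT_comp (measurable_time_density _ _ _)); exact: measurable_fst.
apply: measurable_funM => //.
by apply: measurable_shift_modulus; [exact: measurable_fst|exact: measurable_snd].
Qed.

Lemma measurable_shift_weight :
  measurable_fun setT (fun zx : (R * N.-tuple R) * N.-tuple R =>
    shift_weight p zx.1.1 zx.1.2 zx.2).
Proof.
have m1 : measurable_fun setT (fun zx : (R * N.-tuple R) * N.-tuple R => zx.1.1).
  exact: (measurableT_comp measurable_fst measurable_fst).
have m2 : measurable_fun setT (fun zx : (R * N.-tuple R) * N.-tuple R => zx.1.2).
  exact: (measurableT_comp measurable_snd measurable_fst).
have m3 : measurable_fun setT (fun zx : (R * N.-tuple R) * N.-tuple R => zx.2).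
  exact: measurable_snd.
apply: measurable_funM; first exact: measurable_powR_comp.
apply: measurable_funD; apply: measurable_wide_gauss => //.
exact: measurable_tuple_sub_comp.
Qed.

Lemma shift_weight_ge0 t y x : 0 <= shift_weight p t y x.
Proof. by rewrite mulr_ge0 ?powR_ge0 ?addr_ge0 ?wide_gauss_ge0. Qed.

Definition kernel_majorant x : \bar R :=
  (\int[spacetime_measure N]_z (pair_weight z * shift_weight p z.1 z.2 x)%:E)%E.

Let measurable_integrand : measurable_fun setT
  (fun zx : (R * N.-tuple R) * N.-tuple R =>
    (pair_weight zx.1 * shift_weight p zx.1.1 zx.1.2 zx.2)%:E).
Proof.
apply/measurable_EFinP; apply: measurable_funM; last exact: measurable_shift_weight.
by apply: (measurableT_comp measurable_pair_weight); exact: measurable_fst.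
Qed.

Let integrand_ge0 (zx : (R * N.-tuple R) * N.-tuple R) :
  (0 <= (pair_weight zx.1 * shift_weight p zx.1.1 zx.1.2 zx.2)%:E)%E.
Proof. by rewrite lee_fin mulr_ge0 ?pair_weight_ge0 ?shift_weight_ge0. Qed.

Lemma measurable_kernel_majorant : measurable_fun setT kernel_majorant.
Proof.
exact: (@measurable_fun_fubini_tonelli_G _ _ _ _ _ (spacetime_measure N) _
  measurable_integrand integrand_ge0).
Qed.

(** Integrating over t first. *)
Lemma kernel_majorantE x :
  kernel_majorant x = (\int[lebN]_y (`|f y|%:E * mixed_difference alpha h n x y))%E.
Proof.
pose F z := (pair_weight z * shift_weight p z.1 z.2 x)%:E.
have mF : measurable_fun setT F.
  exact: (measurableT_comp measurable_integrand (pair2_measurable x)).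
have F0 z : (0 <= F z)%E by exact: (integrand_ge0 (z, x)).
rewrite /kernel_majorant /spacetime_measure.
rewrite (@fubini_tonelli2 _ _ _ _ _ mu lebN F mF F0) /fubini_G.
apply: eq_integral => y _.
rewrite /mixed_difference -ge0_integralZl_EFin //; last 2 first.
- move=> t _; rewrite lee_fin mulr_ge0 ?time_density_ge0 //.
  by rewrite mulr_ge0 ?shift_modulus_ge0 ?addr_ge0 ?wide_gauss_ge0.
- apply/measurable_EFinP; apply: measurable_funM; first exact: measurable_time_density.
  apply: measurable_funM; first exact: measurable_shift_modulus.
  by apply: measurable_funD; exact: measurable_wide_gauss.
apply: eq_integral => t _; rewrite /F /pair_weight /= -EFinM; congr EFin.
have [t0|t0] := leP t 0; first by rewrite time_density_eq0 // !(mul0r, mulr0).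
have T : t `^ (- gam) * t `^ gam = 1.
  by rewrite -powRD ?addNr ?powRr0 // (gt_eqF t0) implybT.
rewrite /shift_weight -[RHS]mulr1 -[X in _ = _ * X]T; ring.
Qed.

(** The defect is the integral in y of (G(x - y) - G(x)) f(y), bounded by
    [fundamental_solution_diff] for almost every y. When the majorant is finite at
    x this integrand is integrable, which justifies splitting the convolution;
    otherwise there is nothing to prove. *)
Lemma convolution_defect_le x : 0 < enorm x ->
  (`|convol (G n.+1) f x - (\int[lebN]_y f y) * G n.+1 x|%:E <= kernel_majorant x)%E.
Proof.
move=> x0; rewrite kernel_majorantE.
set S := fun y => (`|f y|%:E * mixed_difference alpha h n x y)%E.
have S0 y : (0 <= S y)%E by rewrite mule_ge0 // mixed_difference_ge0.
have mS : measurable_fun setT S.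
  apply: emeasurable_funM; last exact: measurable_mixed_difference.
  by apply/measurable_EFinP; exact: (measurableT_comp (@normr_measurable R setT) measurable_f).
have mG := measurable_fundamental_solution n N_gt0 r01 h_gt0 alpha01 GP.
pose d y := (G n.+1 (tuple_sub x y) - G n.+1 x) * f y.
have md : measurable_fun setT d.
  apply: measurable_funM => //; apply: measurable_funB => //.
  apply: (measurableT_comp mG).
  by apply: measurable_tuple_sub_comp => //; exact: measurable_cst.
have dS : (\int[lebN]_y `|(d y)%:E| <= \int[lebN]_y S y)%E.
  apply: ae_ge0_le_integral => //.
  - by apply: measurableT_comp => //; exact/measurable_EFinP.
  - apply: filterS (ae_enorm_sub_gt0 N_gt0 x) => y xy _.
    rewrite abse_EFin /d normrM mulrC EFinM; apply: lee_wpmul2l; first by rewrite lee_fin.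
    exact: (fundamental_solution_diff n N_gt0 r01 h_gt0 alpha01 GP x0 xy).
(* An infinite majorant leaves nothing to prove. *)
have [Soo|Soo] := eqVneq (\int[lebN]_y S y)%E +oo%E; first by rewrite Soo leey.
have di : lebN.-integrable setT (EFin \o d).
  apply/integrableP; split; first exact/measurable_EFinP.
  by apply: (le_lt_trans dS); rewrite ltey.
have fi : lebN.-integrable setT (EFin \o (fun y => G n.+1 x * f y)).
  exact: (integrableZl measurableT _ f_L1).
have -> : convol (G n.+1) f x - (\int[lebN]_y f y) * G n.+1 x = \int[lebN]_y d y.
  rewrite mulrC -RintegralZl //.
  have -> : convol (G n.+1) f x = \int[lebN]_y (d y + G n.+1 x * f y).
    by apply: eq_Rintegral => y _; rewrite /d; ring.
  by rewrite RintegralD // addrK.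
rewrite -abse_EFin /Rintegral fineK ?integrable_fin_num //.
by apply: (le_trans (le_abse_integral _ _ _)) dS => //; exact/measurable_EFinP.
Qed.

(** This interpolates between the mass of |f| and s times its first moment, and
    so serves both parts of the theorem. *)
Definition truncated_moment (s : R) : \bar R :=
  (\int[lebN]_y (`|f y| * Num.min 1 (enorm y * s))%:E)%E.

Let measurable_truncated s :
  measurable_fun setT (fun y => (`|f y| * Num.min 1 (enorm y * s))%:E).
Proof.
apply/measurable_EFinP; apply: measurable_funM.
  exact: (measurableT_comp (@normr_measurable R setT) measurable_f).
apply: measurable_minr => //; apply: measurable_funM => //; exact: measurable_enorm.
Qed.

Local Notation T := (n.+1%:R * h).

(** The two terms of the minimum come from the moments of orders - g and
    - (g + 1/2), for g the heat rate; the second needs g < 1/2. *)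
Lemma time_density_shift_le y : gam < 2^-1 ->
  (\int[mu]_t (rho t * (shift_modulus t y * t `^ (- gam)))%:E <=
   (3 / (2^-1 - gam) * T `^ (- (alpha * gam)) *
      Num.min 1 (enorm y * T `^ (- (alpha / 2))))%:E)%E.
Proof.
move=> gam_lt; have gam0 : 0 <= gam.
  by rewrite /heat_rate mulr_ge0 ?divr_ge0 // subr_ge0 invf_le1 // (lt_le_trans ltr01).
have T0 : 0 < T by rewrite mulr_gt0.
have mt (a : R) : measurable_fun setT (fun t => (rho t * t `^ (- a))%:E).
  apply/measurable_EFinP; apply: measurable_funM; first exact: measurable_time_density.
  exact: measurable_powR.
have ml : measurable_fun setT (fun t => (rho t * (shift_modulus t y * t `^ (- gam)))%:E).
  apply/measurable_EFinP; apply: measurable_funM; first exact: measurable_time_density.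
  apply: measurable_funM; last exact: measurable_powR.
  exact: measurable_shift_modulus.
have l0 t : (0 <= (rho t * (shift_modulus t y * t `^ (- gam)))%:E)%E.
  rewrite lee_fin; apply: mulr_ge0; first exact: time_density_ge0.
  by rewrite mulr_ge0 ?shift_modulus_ge0 ?powR_ge0.
have r0 (a t : R) : (0 <= (rho t * t `^ (- a))%:E)%E.
  by rewrite lee_fin; apply: mulr_ge0; [exact: time_density_ge0|exact: powR_ge0].
have A0 (a : R) : 0 <= T `^ a by exact: powR_ge0.
rewrite minr_pMr; last by rewrite mulr_ge0 ?divr_ge0 // subr_ge0 ltW.
rewrite EFin_min le_min; apply/andP; split.
  apply: (@le_trans _ _ (\int[mu]_t (rho t * t `^ (- gam))%:E)%E).
    apply: ge0_le_integral => //; first exact: (mt gam).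
    move=> t _; rewrite lee_fin.
    apply: ler_wpM2l; first exact: time_density_ge0.
    rewrite ler_piMl ?powR_ge0 // /shift_modulus.
    by rewrite ge_min lexx.
  have g1 : 0 <= gam < 1 by rewrite gam0 (lt_trans gam_lt) // invf_lt1 ?ltr1n.
  apply: le_trans (time_density_moment_le n alpha01 h_gt0 g1) _.
  rewrite lee_fin mulr1; apply: ler_wpM2r => //.
  apply: ler_wpM2l => //; rewrite lef_pV2 ?posrE ?subr_gt0 //; last by case/andP: g1.
  lra.
pose b : R := gam + 2^-1.
apply: (@le_trans _ _ (\int[mu]_t ((enorm y)%:E * (rho t * t `^ (- b))%:E))%E).
  apply: ge0_le_integral => //.
  - by apply: emeasurable_funM => //; exact: (mt b).
  - move=> t _; rewrite -EFinM lee_fin.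
    have [t0|t0] := leP t 0; first by rewrite time_density_eq0 // !(mul0r, mulr0).
    rewrite [leRHS]mulrCA; apply: ler_wpM2l; first exact: time_density_ge0.
    have -> : t `^ (- b) = t `^ (- 2^-1) * t `^ (- gam).
      by rewrite -powRD ?(gt_eqF t0) ?implybT // /b opprD addrC.
    rewrite mulrA; apply: ler_wpM2r; first exact: powR_ge0.
    by rewrite powRN powR12_sqrt ?(ltW t0) // /shift_modulus ge_min lexx orbT.
rewrite ge0_integralZl_EFin ?enorm_ge0 //; last exact: (mt b).
have b1 : 0 <= b < 1 by rewrite /b; apply/andP; split; lra.
apply: le_trans (lee_wpmul2l _ (time_density_moment_le n alpha01 h_gt0 b1)) _.
  by rewrite lee_fin enorm_ge0.
rewrite -EFinM lee_fin le_eqVlt; apply/orP; left; apply/eqP.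
have -> : T `^ (- (alpha * b)) = T `^ (- (alpha * gam)) * T `^ (- (alpha / 2)).
  by rewrite -powRD ?(gt_eqF T0) ?implybT // /b; congr (_ `^ _); ring.
have -> : 1 - b = 2^-1 - gam by rewrite /b; lra.
ring.
Qed.

Lemma integral_pair_weight_le : gam < 2^-1 ->
  (\int[spacetime_measure N]_z (pair_weight z)%:E <=
   (3 / (2^-1 - gam) * T `^ (- (alpha * gam)))%:E *
     truncated_moment (T `^ (- (alpha / 2))))%E.
Proof.
move=> gam_lt; set c := 3 / _ * _; set s := T `^ (- (alpha / 2)).
have c0 : 0 <= c by rewrite mulr_ge0 ?powR_ge0 ?divr_ge0 // subr_ge0 ltW.
pose F z := (pair_weight z)%:E.
have mF : measurable_fun setT F by apply/measurable_EFinP; exact: measurable_pair_weight.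
have F0 z : (0 <= F z)%E by rewrite lee_fin pair_weight_ge0.
rewrite /spacetime_measure (@fubini_tonelli2 _ _ _ _ _ mu lebN F mF F0).
have s0 : 0 <= s by exact: powR_ge0.
have m0 y : 0 <= `|f y| * Num.min 1 (enorm y * s).
  by rewrite mulr_ge0 // le_min ler01 mulr_ge0 ?enorm_ge0.
rewrite /truncated_moment -ge0_integralZl_EFin //; last by move=> y _; rewrite lee_fin.
apply: ge0_le_integral => //.
- by move=> y _; apply: integral_ge0 => t _; exact: F0.
- exact: (@measurable_fun_fubini_tonelli_G _ _ _ _ _ mu _ mF F0).
- by apply: emeasurable_funM.
move=> y _; rewrite /fubini_G.
have -> : (\int[mu]_t F (t, y) =
    \int[mu]_t (`|f y|%:E * (rho t * (shift_modulus t y * t `^ (- gam)))%:E))%E.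
  by apply: eq_integral => t _; rewrite -EFinM /F /pair_weight /=; congr EFin; ring.
rewrite ge0_integralZl_EFin //; last 2 first.
- move=> t _.
  rewrite lee_fin; apply: mulr_ge0; first exact: time_density_ge0.
  by rewrite mulr_ge0 ?shift_modulus_ge0 ?powR_ge0.
- apply/measurable_EFinP; apply: measurable_funM; first exact: measurable_time_density.
  apply: measurable_funM; last exact: measurable_powR.
  exact: measurable_shift_modulus.
apply: le_trans (lee_wpmul2l _ (time_density_shift_le y gam_lt)) _; first by rewrite lee_fin.
by rewrite -!EFinM lee_fin -/c -/s mulrCA.
Qed.

Lemma truncated_moment_fin_num s : 0 <= s -> truncated_moment s \is a fin_num.
Proof.
move=> s0; rewrite ge0_fin_numE; last first.
  apply: integral_ge0 => y _; rewrite lee_fin mulr_ge0 // le_min ler01.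
  by rewrite mulr_ge0 ?enorm_ge0.
have /integrableP[_] := f_L1; apply: le_lt_trans; apply: ge0_le_integral => //.
- move=> y _; rewrite lee_fin mulr_ge0 // le_min ler01.
  by rewrite mulr_ge0 ?enorm_ge0.
- by apply: measurableT_comp => //; exact/measurable_EFinP.
- by move=> y _; rewrite abse_EFin lee_fin ler_piMr // ge_min lexx.
Qed.

Definition defect_const : R :=
  3 / (2^-1 - gam) * (2 `^ p * (heat_const N p + heat_const N p)) `^ p^-1.

(** The moment bound contributes the power of time that the weight in front
    of the norm cancels, leaving the truncated moment at the scale
    ((n + 1) h)^(- alpha/2). *)
Lemma Lnorm_defect_le (u : N.-tuple R -> R) : gam < 2^-1 ->
  measurable_fun setT u -> (forall x, u x = convol (G n.+1) f x) ->
  ((T `^ (alpha * gam))%:E *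
    'N[lebN]_(p%:E)[(fun x => (u x - (\int[lebN]_y f y) * G n.+1 x)%:E)] <=
   defect_const%:E * truncated_moment (T `^ (- (alpha / 2))))%E.
Proof.
move=> gam_lt mu_ uE; have p0 : 0 < p by exact: lt_le_trans p_ge1.
have T0 : 0 < T by rewrite mulr_gt0.
pose s := T `^ (- (alpha / 2)); have s0 : 0 <= s by exact: powR_ge0.
pose E := fine (truncated_moment s).
have EE : truncated_moment s = E%:E by rewrite fineK // truncated_moment_fin_num.
have E0 : 0 <= E.
  apply: fine_ge0; apply: integral_ge0 => y _; rewrite lee_fin mulr_ge0 // le_min ler01.
  by rewrite mulr_ge0 ?enorm_ge0.
pose A := 3 / (2^-1 - gam) * T `^ (- (alpha * gam)) * E.
have A0 : 0 <= A.
  by rewrite /A !mulr_ge0 ?powR_ge0 // invr_ge0 subr_ge0 ltW.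
pose D := 2 `^ p * (heat_const N p + heat_const N p).
have D0 : 0 <= D.
  by rewrite mulr_ge0 ?powR_ge0 // addr_ge0 // mulr_ge0 ?powR_ge0.
pose v x := u x - (\int[lebN]_y f y) * G n.+1 x.
have mv : measurable_fun setT v.
  apply: measurable_funB => //; apply: measurable_funM => //.
  exact: (measurable_fundamental_solution n N_gt0 r01 h_gt0 alpha01 GP).
have key : (\int[lebN]_x ((`|v x|%:E) `^ p) <= (A `^ p * D)%:E)%E.
  apply: (@le_trans _ _ (\int[lebN]_x (kernel_majorant x `^ p))%E).
    apply: ae_ge0_le_integral => //.
    - by move=> x _; exact: poweR_ge0.
    - apply: (measurableT_comp (measurable_poweR p)); apply/measurable_EFinP.
      exact: (measurableT_comp (@normr_measurable R setT) mv).
    - by move=> x _; exact: poweR_ge0.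
    - exact: (measurableT_comp (measurable_poweR p) measurable_kernel_majorant).
    - apply: filterS (ae_enorm_gt0 N_gt0) => x x0 _.
      have K0 : (0 <= kernel_majorant x)%E.
        by apply: integral_ge0 => z _; exact: (integrand_ge0 (z, x)).
      apply: gt0_ler_poweR; rewrite ?(ltW p0) ?in_itv /= ?leey ?andbT ?lee_fin //.
      by rewrite /v uE; exact: convolution_defect_le.
  apply: (@integral_poweR_le _ _ _ _ R p p_ge1 (spacetime_measure N) lebN pair_weight
    (fun z x => shift_weight p z.1 z.2 x) A D measurable_pair_weight
    measurable_shift_weight) => //.
  - exact: pair_weight_ge0.
  - by move=> z x; exact: shift_weight_ge0.
  - by apply: le_trans (integral_pair_weight_le gam_lt) _; rewrite EE -EFinM.
  - move=> -[t y]; rewrite /pair_weight /=.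
    have [t0|t0 _] := leP t 0; first by rewrite time_density_eq0 // !mul0r eqxx.
    exact: integral_shift_weight_powR_le.
have nB : ('N[lebN]_(p%:E)[(fun x => (v x)%:E)] <= (A * D `^ p^-1)%:E)%E.
  rewrite Lnorm.unlock /=.
  apply: (@le_trans _ _ ((A `^ p * D)%:E `^ p^-1)%E).
    apply: gt0_ler_poweR; rewrite ?invr_ge0 ?(ltW p0) ?in_itv /= ?leey ?andbT //.
      by apply: integral_ge0 => x _; rewrite lee_fin powR_ge0.
    by rewrite lee_fin mulr_ge0 ?powR_ge0.
  by rewrite poweR_EFin powRM ?powR_ge0 // -powRrM divff ?gt_eqF // powRr1.
apply: le_trans (lee_wpmul2l _ nB) _; first by rewrite lee_fin powR_ge0.
rewrite -/s EE -!EFinM lee_fin le_eqVlt; apply/orP; left; apply/eqP.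
have P : T `^ (alpha * gam) * T `^ (- (alpha * gam)) = 1.
  by rewrite -powRD ?subrr ?powRr0 // (gt_eqF T0) implybT.
rewrite /A /defect_const -/D -[RHS]mulr1 -[X in _ = _ * X]P; ring.
Qed.

End minkowski_bound.
Arguments defect_const {R} N p.

(** * Asymptotics of the solution *)

Section limits.
Context {R : realType} {N : nat}.
Variables (f : N.-tuple R -> R) (f_L1 : (lebesgueN N).-integrable setT (EFin \o f)).
Local Notation lebN := (@lebesgueN R N).

Lemma cvg_powRN (b h : R) : 0 < b -> 0 < h ->
  (fun n => (n.+1%:R * h) `^ (- b)) @ \oo --> (0 : R).
Proof.
move=> b0 h0; apply/cvgr0Pnorm_lt => e e0.
near=> n; rewrite ger0_norm ?powR_ge0 //.
(* The time at which the power equals e. *)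
pose k := e `^ (- b^-1); have k0 : 0 < k by exact: powR_gt0.
have kE : k `^ (- b) = e by rewrite /k -powRrM mulrNN mulVf ?gt_eqF // powRr1 // ltW.
have kn : k < n.+1%:R * h.
  rewrite -ltr_pdivrMr // (@lt_trans _ _ n%:R) ?ltr_nat //.
  by near: n; exact: nbhs_infty_gtr.
rewrite -kE !powRN ltf_pV2 ?posrE ?powR_gt0 ?mulr_gt0 //.
by apply: gt0_ltr_powR; rewrite ?nnegrE ?(ltW k0) // ltW // mulr_gt0.
Unshelve. all: by end_near. Qed.

(** Dominated convergence, with |f| as the dominating function. *)
Lemma cvg_truncated_moment (s : nat -> R) : (forall n, 0 <= s n) ->
  s @ \oo --> (0 : R) -> truncated_moment f (s n) @[n --> \oo] --> (0 : \bar R).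
Proof.
move=> s0 s_to0.
have mf : measurable_fun setT f by apply/measurable_EFinP; case/integrableP : f_L1.
pose F n y := (`|f y| * Num.min 1 (enorm y * s n))%:E.
have m01 n (y : N.-tuple R) : 0 <= Num.min 1 (enorm y * s n) <= 1.
  by rewrite le_min ler01 mulr_ge0 ?enorm_ge0 //= ge_min lexx.
have F0 n y : (0 <= F n y)%E by rewrite lee_fin mulr_ge0 //; case/andP : (m01 n y).
have mF n : measurable_fun setT (F n).
  apply/measurable_EFinP; apply: measurable_funM.
    exact: (measurableT_comp (@normr_measurable R setT) mf).
  apply: measurable_minr => //; apply: measurable_funM => //; exact: measurable_enorm.
have cF : {ae lebN, forall y, [set: N.-tuple R] y -> F n y @[n --> \oo] --> (0 : \bar R)}.
  apply: aeW => y _; apply/fine_cvgP; split; first by apply: nearW => n.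
  apply: (@squeeze_cvgr _ _ _ _ (fun=> 0) (fun n => `|f y| * (enorm y * s n))).
  - apply: nearW => n /=; case/andP: (m01 n y) => a _.
    by rewrite mulr_ge0 //= ler_wpM2l // ge_min lexx orbT.
  - exact: cvg_cst.
  - have -> : (0 : R) = `|f y| * (enorm y * 0) by rewrite !mulr0.
    by apply: cvgMr; apply: cvgMr.
have ig : lebN.-integrable setT (fun y => `|(f y)%:E|%E) by exact: integrable_abse.
have dF : {ae lebN, forall y n, [set: N.-tuple R] y -> (`|F n y| <= `|(f y)%:E|)%E}.
  apply: aeW => y n _; rewrite gee0_abs // abse_EFin lee_fin.
  by rewrite ler_piMr //; case/andP : (m01 n y).
have [_ _] := dominated_convergence measurableT mF (measurable_cst 0%E) cF ig dF.
by rewrite integral0.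
Qed.

Lemma truncated_moment_le (s : R) : 0 <= s ->
  (truncated_moment f s <= s%:E * \int[lebN]_y `|(enorm y * f y)%:E|)%E.
Proof.
move=> s0.
have mf : measurable_fun setT f by apply/measurable_EFinP; case/integrableP : f_L1.
have ma : measurable_fun setT (fun y => `|(enorm y * f y)%:E|%E).
  apply: measurableT_comp => //; apply/measurable_EFinP; apply: measurable_funM => //.
  exact: measurable_enorm.
rewrite -ge0_integralZl_EFin //; apply: ge0_le_integral => //.
- move=> y _; rewrite lee_fin mulr_ge0 // le_min ler01.
  by rewrite mulr_ge0 ?enorm_ge0.
- apply/measurable_EFinP; apply: measurable_funM.
    exact: (measurableT_comp (@normr_measurable R setT) mf).
  apply: measurable_minr => //; apply: measurable_funM => //; exact: measurable_enorm.
- by apply: emeasurable_funM.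
- move=> y _; rewrite abse_EFin -EFinM lee_fin normrM (ger0_norm (enorm_ge0 y)).
  rewrite mulrA [leRHS]mulrC (mulrC s); apply: ler_wpM2l => //.
  by rewrite ge_min lexx orbT.
Qed.

End limits.

(** Both sides are equivalent to p (N - 1) < N, which always holds for N = 1. *)
Lemma heat_rate_lt (R : realType) (N : nat) (p : R) : (0 < N)%N -> 1 <= p ->
  ((1 < N)%N -> p < N%:R / (N%:R - 1)) -> heat_rate N p < 2^-1.
Proof.
move=> N0 p1 pN; have p0 : 0 < p by exact: lt_le_trans p1.
suff H : p * (N%:R - 1) < N%:R :> R.
  have -> : heat_rate N p = 2^-1 + (p * (N%:R - 1) - N%:R) / (2 * p).
    by rewrite /heat_rate; field; rewrite gt_eqF.
  by rewrite gtrDl pmulr_llt0 ?subr_lt0 // invr_gt0 mulr_gt0.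
move: N0 pN; rewrite leq_eqVlt => /predU1P[<- _|N1 /(_ N1)].
  by rewrite subrr mulr0.
by rewrite ltr_pdivlMr // subr_gt0 ltr1n.
Qed.

Theorem theorem6p5 (R : realType) (N : nat) (alpha p : R)
    (f : N.-tuple R -> R)
    (N_gt0 : (0 < N)%N) (alpha01 : 0 < alpha < 1)
    (p_ge1 : 1 <= p) (p_lt : (1 < N)%N -> p < N%:R / (N%:R - 1))
    (f_L1 : (lebesgueN N).-integrable setT (EFin \o f)) :
  let M := \int[lebesgueN N]_x f x in
  let w := alpha * N%:R / 2 * (1 - p^-1) in
  (forall (h r : R) (G u : nat -> N.-tuple R -> R),
     0 < h -> 0 < r < 1 ->
     is_fundamental_solution r alpha h G ->
     caputo_heat_solution alpha h f u ->
     (forall n x, (0 < n)%N -> u n x = convol (G n) f x) ->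
     ((((n%:R * h) `^ w)%:E *
       'N[lebesgueN N]_(p%:E)[(fun x => (u n x - M * G n x)%:E)])%E
        @[n --> \oo] --> 0%E))
  /\
  ((lebesgueN N).-integrable setT (fun x => (enorm x * f x)%:E) ->
   exists C : R, forall (h r : R) (G u : nat -> N.-tuple R -> R),
     0 < h -> 0 < r < 1 ->
     is_fundamental_solution r alpha h G ->
     caputo_heat_solution alpha h f u ->
     (forall n x, (0 < n)%N -> u n x = convol (G n) f x) ->
     forall n, (0 < n)%N ->
       (((n%:R * h) `^ w)%:E *
        'N[lebesgueN N]_(p%:E)[(fun x => (u n x - M * G n x)%:E)] <=
        (C * (n%:R * h) `^ (- (alpha / 2)))%:E)%E).
Proof.
move=> M w; have al0 : 0 < alpha by case/andP: alpha01.
have gam_lt : heat_rate N p < 2^-1 by exact: heat_rate_lt.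
have wE : w = alpha * heat_rate N p by rewrite /w /heat_rate; ring.
have K0 : 0 <= defect_const N p.
  by rewrite mulr_ge0 ?powR_ge0 ?divr_ge0 // subr_ge0 ltW.
have key h r (G u : nat -> N.-tuple R -> R) n : 0 < h -> 0 < r < 1 ->
    is_fundamental_solution r alpha h G -> caputo_heat_solution alpha h f u ->
    (forall n x, (0 < n)%N -> u n x = convol (G n) f x) ->
    (((n.+1%:R * h) `^ w)%:E *
        'N[lebesgueN N]_(p%:E)[(fun x => (u n.+1 x - M * G n.+1 x)%:E)] <=
     (defect_const N p)%:E * truncated_moment f ((n.+1%:R * h) `^ (- (alpha / 2))))%E.
  move=> h0 r01 GP [_ uP] uE; rewrite wE.
  have [/integrableP[/measurable_EFinP mu_ _] _ _] := uP n.+1 isT.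
  apply: (Lnorm_defect_le N_gt0 r01 h0 alpha01 p_ge1 GP f_L1 gam_lt mu_) => x.
  exact: uE.
split=> [h r G u h0 r01 GP uP uE|xf_L1].
- have H : ((defect_const N p)%:E * truncated_moment f ((n.+1%:R * h) `^ (- (alpha / 2))))%E
      @[n --> \oo] --> (0 : \bar R)%E.
    rewrite -(mule0 (defect_const N p)%:E); apply: cvgeZl => //.
    apply: (cvg_truncated_moment f_L1) => [n|]; first exact: powR_ge0.
    by apply: cvg_powRN => //; rewrite divr_gt0.
  rewrite -cvg_shiftS /=; apply: (squeeze_cvge _ (cvg_cst (0 : \bar R)%E) H).
  apply: nearW => n; rewrite (key h r G u) // andbT.
  by rewrite mule_ge0 ?Lnorm_ge0 // lee_fin powR_ge0.
- pose m := fine (\int[lebesgueN N]_y `|(enorm y * f y)%:E|)%E.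
  have mE : (\int[lebesgueN N]_y `|(enorm y * f y)%:E| = m%:E)%E.
    rewrite fineK // ge0_fin_numE; last by apply: integral_ge0.
    by case/integrableP: xf_L1.
  exists (defect_const N p * m) => h r G u h0 r01 GP uP uE [//|n] _.
  apply: (le_trans (key h r G u n h0 r01 GP uP uE)).
  set s := _ `^ _; have s0 : 0 <= s by exact: powR_ge0.
  apply: le_trans (lee_wpmul2l _ (truncated_moment_le f_L1 s0)) _.
    by rewrite lee_fin.
  by rewrite mE -!EFinM lee_fin (mulrC s) mulrA.
Qed.
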